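(* Let $\lambda>0$, $c>0$, $\theta\ge0$, and let $\Psi_\theta(k,\ell)$ and $U_\theta(k,\ell)$ be the matrices associated with the Markov-modulated fluid flow defined in the context. Then the matrices $\Psi_\theta(k,\ell)$ are given by $$\Psi_\theta(k,k)=\frac{\lambda}{\lambda+\theta}\left(I-\frac{c}{\lambda+\theta}A_k\right)^{-1},\qquad k\ge1,$$ and, for $\ell>k\ge 1$, $$\Psi_\theta(k,\ell)=\left(\frac{c}{\lambda+\theta}\sum_{v=k}^{\ell-1}\Psi_\theta(k,v)\,D_v\,\Psi_\theta(v+1,\ell)\right)\left(I-\frac{c}{\lambda+\theta}A_\ell\right)^{-1}.$$ The matrices $U_\theta(k,\ell)$ are given, for $1\le k\le\ell$, by $$U_\theta(k,\ell)=A_k\,\delta_{k,\ell}+(1-\delta_{k,\ell})\,D_k\,\Psi_\theta(k+1,\ell),$$ where $\delta_{k,\ell}$ is the Kronecker delta.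
   Context: $I$ is an identity matrix of appropriate size; $\bm{1}$, $\bm{0}$ are vectors of ones and zeros. For $k\ge1$ let $\mathcal{S}_k$ be a finite nonempty set, $A_k$ a square matrix indexed by $\mathcal{S}_k$ with nonnegative off-diagonal entries, and $D_k$ a nonnegative $|\mathcal{S}_k|\times|\mathcal{S}_{k+1}|$ matrix, with $A_k\bm{1}+D_k\bm{1}=\bm{0}$ and $A_k$ invertible (a sub-generator with transient states). Markov-modulated fluid flow. $\{(X(t),\phi(t))\}$ has phase space $\mathcal{E}=\mathcal{E}_+\cup\mathcal{E}_-$ with $\mathcal{E}_+=\mathcal{S}_1^+\cup\mathcal{S}_2^+\cup\cdots$, $\mathcal{E}_-=\mathcal{S}_1^-\cup\mathcal{S}_2^-\cup\cdots$, where $\mathcal{S}_k^+,\mathcal{S}_k^-$ are two disjoint copies of $\mathcal{S}_k$. The phase $\phi$ is a Markov jump process on $\mathcal{E}$ with transitions: from each state of $\mathcal{S}_k^+$, at rate $\lambda$, to its copy in $\mathcal{S}_k^-$; within $\mathcal{S}_k^-$ according to $A_k$; from $\mathcal{S}_k^-$ to $\mathcal{S}_{k+1}^+$ with rate matrix $D_k$; no others. The level $X$ is continuous and piecewise linear, with slope $c$ when $\phi(t)\in\mathcal{E}_+$ and slope $-1$ when $\phi(t)\in\mathcal{E}_-$. Let $J(t)=\int_0^t\mathbf{1}_{\{\phi(s)\in\mathcal{E}_+\}}ds$ and $\tau_0=\inf\{t>0\mid X(t)<0\}$. First passage matrices. For $\theta\ge0$, $x\ge0$, $k,\ell\ge1$,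 $\Psi_\theta(k,\ell)$ and $\Phi_\theta(x;k,\ell)$ are the $|\mathcal{S}_k|\times|\mathcal{S}_\ell|$ matrices with entries $$(\Psi_\theta(k,\ell))_{ij}=\mathbb{E}\big[e^{-\theta J(\tau_0)}\mathbf{1}_{\{\tau_0<\infty,\,\phi(\tau_0)=j\}}\mid X(0)=0,\phi(0)=i\big],\quad i\in\mathcal{S}_k^+,\ j\in\mathcal{S}_\ell^-,$$ $$(\Phi_\theta(x;k,\ell))_{ij}=\mathbb{E}\big[e^{-\theta J(\tau_0)}\mathbf{1}_{\{\tau_0<\infty,\,\phi(\tau_0)=j\}}\mid X(0)=x,\phi(0)=i\big],\quad i\in\mathcal{S}_k^-,\ j\in\mathcal{S}_\ell^-.$$ These blocks vanish for $\ell<k$, so the infinite matrices $\Psi_\theta=(\Psi_\theta(k,\ell))_{k,\ell\ge1}$ and $\Phi_\theta(x)=(\Phi_\theta(x;k,\ell))_{k,\ell\ge1}$ are block upper triangular. The matrix $U_\theta=(U_\theta(k,\ell))_{k,\ell\ge1}$, block upper triangular with $U_\theta(k,\ell)$ of size $|\mathcal{S}_k|\times|\mathcal{S}_\ell|$, is the sub-generator such that $\Phi_\theta(x)=e^{U_\theta x}$ for all $x\ge0$ (so that $U_\theta=\Phi_\theta'(0)$, blockwise; exponentials of block upper triangular matrices are computed on the finite truncations to the first $n$ block rows and columns). *)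

(* Defs.v *)
(* MathComp / MathComp-Analysis. *)
From HB Require Import structures.
From mathcomp Require Import all_boot all_order all_algebra.
From mathcomp Require Import all_classical all_reals all_analysis.

Set Implicit Arguments.
Unset Strict Implicit.
Unset Printing Implicit Defensive.

Import Order.TTheory GRing.Theory Num.Theory.
Import numFieldNormedType.Exports.

Local Open Scope classical_set_scope.
Local Open Scope ring_scope.

(* Blocks are numbered from 0, so block k here is the (k+1)-st block when
   numbering starts at 1; S_k is 'I_(s k). *)

Section BlockMatrices.
Context {R : realType} (s : nat -> nat).

(* Block-diagonal and block-superdiagonal families. As in the library's mxdiag,
   conform_mx is only a transport: it is used where the sizes agree. *)
Definition diag_block (A : forall k, 'M[R]_(s k)) (k l : nat)
  : 'M[R]_(s k, s l) :=
  if k == l then conform_mx 0 (A k) else 0.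

Definition superdiag_block (D : forall k, 'M[R]_(s k, s k.+1)) (k l : nat)
  : 'M[R]_(s k, s l) :=
  if k.+1 == l then conform_mx 0 (D k) else 0.

Definition truncation (n : nat) (M : forall k l, 'M[R]_(s k, s l)) :=
  \mxblock_(k < n, l < n) M k l.

End BlockMatrices.

Definition subgenerator {R : realType} (m : nat) (M : 'M[R]_m) :=
  (forall i j, i != j -> 0 <= M i j) /\ (forall i, \sum_j M i j <= 0).

Definition expmx {R : realType} (m : nat) (M : 'M[R]_m) : 'M[R]_m :=
  \matrix_(i, j)
    limn (fun N => \sum_(0 <= p < N) (p`!%:R)^-1 * (M ^+ p) i j).

Section MarkovJumpProcess.
Context {R : realType} {E : countType} (Q : E -> E -> R).

Definition exit_rate (e : E) : R := - Q e e.

Definition jump_probability (e f : E) : R :=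
  if e == f then 0 else Q e f / exit_rate e.

Definition jump_time {T : Type} (S : nat -> T -> R) (n : nat) (w : T) : R :=
  \sum_(m < n) S m w.

(* phi is, under P, a Markov jump process with generator Q and initial state e0,
   in jump chain / holding time form: the visited states Y form a Markov chain
   with the jump probabilities of Q and, given Y, the holding times S are
   independent, S n being exponential with the exit rate of Y n. This is meant
   for Q without absorbing states. Nothing is required of phi past an explosion
   time, nor on a null set. *)
Definition markov_jump_process {dsp : measure_display}
    {T : measurableType dsp} (P : probability T R) (e0 : E)
    (phi : R -> T -> E) : Prop :=
  exists (Y : nat -> T -> E) (S : nat -> T -> R),
    [/\ forall n e, measurable [set w | Y n w = e],
        forall n, measurable_fun setT (S n),
        forall (n : nat) (e : nat -> E) (t : nat -> R),
          (forall m, 0 <= t m) ->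
          P [set w | forall m, (m <= n)%N -> Y m w = e m /\ t m < S m w] =
          ((e 0%N == e0)%:R *
           (\prod_(m < n) jump_probability (e m) (e m.+1)) *
           (\prod_(m < n.+1) expR (- exit_rate (e m) * t m)))%:E
      & {ae P, forall w, forall (n : nat) (t : R),
          jump_time S n w <= t < jump_time S n.+1 w -> phi t w = Y n w}].

End MarkovJumpProcess.

Section FluidFlow.
Context {R : realType} (s : nat -> nat).

(* (true, (k, i)) is the copy of i in S_k^+, (false, (k, i)) that in S_k^-. *)
Definition phase : Type := (bool * {k : nat & 'I_(s k)})%type.

Definition phase_up (k : nat) (i : 'I_(s k)) : phase :=
  (true, Tagged (fun k => 'I_(s k)) i).
Definition phase_down (k : nat) (i : 'I_(s k)) : phase :=
  (false, Tagged (fun k => 'I_(s k)) i).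

Definition fluid_generator (lambda : R) (A : forall k, 'M[R]_(s k))
    (D : forall k, 'M[R]_(s k, s k.+1)) (e f : phase) : R :=
  let k := tag e.2 in let i := tagged e.2 in
  let l := tag f.2 in let j := tagged f.2 in
  match e.1, f.1 with
  | true, true => diag_block (fun k => (- lambda)%:M) k l i j
  | true, false => diag_block (fun k => lambda%:M) k l i j
  | false, false => diag_block A k l i j
  | false, true => superdiag_block D k l i j
  end.

Context {dsp : measure_display} {T : measurableType dsp}.
Variables (c theta : R) (phi : R -> T -> phase).

Definition slope (e : phase) : R := if e.1 then c else -1.

Definition level (x t : R) (w : T) : R :=
  x + \int[lebesgue_measure]_(u in `[0, t]) slope (phi u w).

Definition time_up (t : R) (w : T) : R :=
  \int[lebesgue_measure]_(u in `[0, t]) ((phi u w).1)%:R.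

Definition passage_time (x : R) (w : T) : \bar R :=
  ereal_inf (EFin @` [set t | 0 < t /\ level x t w < 0]).

Definition discounted_passage (x : R) (f : phase) (w : T) : R :=
  let tau := passage_time x w in
  if (tau < +oo)%E && (phi (fine tau) w == f)
  then expR (- theta * time_up (fine tau) w) else 0.

(* P e is the law of the flow started in phase e; the expectations are finite,
   so that fine is only a change of type. *)
Variable P : phase -> probability T R.

Definition Psi (k l : nat) : 'M[R]_(s k, s l) :=
  \matrix_(i, j) fine ('E_(P (phase_up i))[discounted_passage 0 (phase_down j)])%E.

Definition Phi (x : R) (k l : nat) : 'M[R]_(s k, s l) :=
  \matrix_(i, j) fine ('E_(P (phase_down i))[discounted_passage x (phase_down j)])%E.

(* U is the sub-generator with Phi x = exp (x U) for all x >= 0; the row sums of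
   a truncation of U are partial sums of the infinite row sums. *)
Definition passage_generator (U : forall k l, 'M[R]_(s k, s l)) : Prop :=
  [/\ forall k l, (l < k)%N -> U k l = 0,
      forall n, subgenerator (truncation n U)
    & forall x, 0 <= x -> forall n,
        truncation n (Phi x) = expmx (x *: truncation n U)].

End FluidFlow.

(* Main.v *)
Require Import Defs.
From HB Require Import structures.
From mathcomp Require Import all_boot all_order all_algebra.
From mathcomp Require Import zify lra ring.
From mathcomp Require Import all_classical all_reals all_analysis.
From mathcomp Require Import measurable_realfun.
Set Implicit Arguments.
Unset Strict Implicit.
Unset Printing Implicit Defensive.

Import Order.TTheory GRing.Theory Num.Theory.
Import numFieldNormedType.Exports.
Local Open Scope classical_set_scope.
Local Open Scope ring_scope.

(** The idea is to verify explicit candidates for the passage expectations.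

    Let Psi be given by the recursion and put U = A + D Psi, blockwise. On each
    truncation to n blocks the recursion says exactly that
    Psi ((lambda + theta) I - c U) = lambda I ([truncation_psi_eq]), and U is a
    subgenerator ([subgenerator_truncation]). For a fixed final phase, let
    h (e, x) be the corresponding entry of exp (x U) when e is a descending
    phase, and of Psi exp (x U) when e is an ascending one.

    Conditioning on the first sojourn leads to an equation f = C + K f: here C is
    the contribution of the paths whose passage occurs during the first sojourn,
    and K averages the value found after the jump, weighted by the discount of
    the sojourn and by the indicator that the level is still nonnegative at its
    end. The function h solves this equation, because the integrals over the
    exponential sojourn time have explicit antiderivatives: - exp (- q t)
    exp ((x - t) U) on a descending phase and - exp (- (lambda + theta) t) Psi
    exp ((x + c t) U) on an ascending one ([passage_mean_renewal]).

    By iteration, h is the sum of the K^m C for m < N, plus K^N h. As h is bounded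
    and vanishes outside the first n blocks, K^N h is at most a constant times the
    probability that the jump chain has not left these blocks after N jumps. The
    limit of these probabilities is harmonic, so on each block it is in the kernel
    of A k, which is trivial ([transient]). Hence h is the sum of all the K^m C
    ([passage_mean_series]).

    The expectation of the discounted passage is the same series, term by term.
    Along a path whose jump times are unbounded, the passage occurs in the first
    sojourn that ends at a negative level, and the phase is then descending; so
    the discounted passage is a series whose m-th term depends on the phase, the
    level and the discount at the m-th jump and on the m-th holding time
    ([discounted_passage_series]). By the Markov property the m-th term has
    expectation K^m C ([integral_path_sojourn]). Almost every path is of this kind
    because the expectation of exp (- T_n), for the n-th jump time T_n, tends to 0
    ([vanishing_discount], [no_explosion]).

    Thus the expectations are the values of h ([expectation_discounted_passage]):
    the ascending phases at level 0 give Psi, and the descending phases at level x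
    give exp (x U). Since the exponentials of the multiples of a matrix determine
    it ([expmx_inj]), no other U has this property. *)

(** * Subgenerators and their resolvents *)

(** The maximum principle: the off-diagonal entries weigh the nonnegative numbers
    [u j - u i], and the row sum, which is nonpositive, weighs [u i]. *)
Lemma subgenerator_min {R : realType} {m : nat} (M : 'M[R]_m) (u : 'cV[R]_m) i :
  subgenerator M -> (forall j, u i 0 <= u j 0) -> u i 0 <= 0 ->
  0 <= (M *m u) i 0.
Proof.
move=> [Moff Mrow] umin ui0; rewrite mxE.
rewrite [leRHS](_ : _ = \sum_j M i j * (u j 0 - u i 0) + (\sum_j M i j) * u i 0).
  apply: addr_ge0; last by rewrite mulr_le0.
  apply: sumr_ge0 => j _; have [->|ij] := eqVneq j i; first by rewrite subrr mulr0.
  by rewrite mulr_ge0 ?subr_ge0// Moff// eq_sym.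
rewrite mulr_suml -big_split/=; apply: eq_bigr => j _.
by rewrite mulrBr subrK.
Qed.

(** At a row where [u] is minimal, a negative value would make
    [((1 - a M) u) i] negative as well. *)
Lemma resolvent_ge0 {R : realType} {m : nat} (M : 'M[R]_m) (a : R) (u : 'cV[R]_m) :
  subgenerator M -> 0 <= a ->
  (forall i, 0 <= ((1%:M - a *: M) *m u) i 0) -> forall i, 0 <= u i 0.
Proof.
move=> sM a0 Mu i0; case: (@arg_minP _ _ _ i0 xpredT (fun i => u i 0)) => // i _ imin.
have umin j : u i 0 <= u j 0 by exact: imin.
apply: le_trans (umin i0); rewrite leNgt; apply/negP => ui0.
have := Mu i; rewrite mulmxBl mul1mx -scalemxAl !mxE leNgt => /negP; apply.
have := subgenerator_min sM umin (ltW ui0); rewrite mxE => Mi.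
by rewrite subr_lt0 (lt_le_trans ui0)// mulr_ge0.
Qed.

Lemma resolvent_unit {R : realType} {m : nat} (M : 'M[R]_m) (a : R) :
  subgenerator M -> 0 <= a -> 1%:M - a *: M \in unitmx.
Proof.
move=> sM a0; rewrite -unitmx_tr -row_free_unit -kermx_eq0; apply/rowV0P => v.
move=> /sub_kermxP vM.
have Mv : (1%:M - a *: M) *m v^T = 0.
  by apply: trmx_inj; rewrite trmx_mul trmxK vM trmx0.
have v0 : forall i, 0 <= v^T i 0 by apply: (resolvent_ge0 sM a0) => i; rewrite Mv mxE.
have v0' : forall i, 0 <= (- v^T) i 0.
  by apply: (resolvent_ge0 sM a0) => i; rewrite mulmxN Mv oppr0 mxE.
apply/rowP => i; apply/eqP; rewrite eq_le.
have := v0 i; have := v0' i; rewrite !mxE oppr_ge0 => -> ->; done.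
Qed.

Lemma invmx_resolvent_ge0 {R : realType} {m : nat} (M : 'M[R]_m) (a : R) :
  subgenerator M -> 0 <= a -> forall i j, 0 <= invmx (1%:M - a *: M) i j.
Proof.
move=> sM a0 i j.
have -> : invmx (1%:M - a *: M) i j = col j (invmx (1%:M - a *: M)) i 0 by rewrite mxE.
apply: (resolvent_ge0 sM a0) => k.
by rewrite colE mulmxA mulmxV ?resolvent_unit// mul1mx mxE ler0n.
Qed.

Lemma mulmx_ge0 {R : realType} {m n p : nat} (M : 'M[R]_(m, n)) (N : 'M[R]_(n, p)) :
  (forall i j, 0 <= M i j) -> (forall i j, 0 <= N i j) ->
  forall i j, 0 <= (M *m N) i j.
Proof. by move=> M0 N0 i j; rewrite mxE sumr_ge0// => k _; rewrite mulr_ge0. Qed.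

(** * The matrix exponential *)

Section Expmx.
Context {R : realType} {m : nat}.
Implicit Types (U : 'M[R]_m).

Definition expmx_coef U (i j : 'I_m) (p : nat) : R := p`!%:R^-1 * (U ^+ p) i j.

Lemma expmx_powZ U (x : R) p : (x *: U) ^+ p = x ^+ p *: U ^+ p.
Proof.
elim: p => [|p IH]; first by rewrite !expr0 scale1r.
by rewrite !exprS IH -!mulmxE -scalemxAl -scalemxAr scalerA.
Qed.

Lemma expmxE U (x : R) i j :
  expmx (x *: U) i j = limn (pseries (expmx_coef U i j) x).
Proof.
rewrite mxE; congr (limn _); apply/funext => N /=; rewrite /pseries /series/=.
by apply: eq_bigr => p _; rewrite expmx_powZ mxE mulrCA mulrC.
Qed.

(** The sum of all absolute values is a crude submultiplicative norm, which is
    enough to dominate every entry of the exponential series by that of [expR]. *)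
Lemma mx_exp_bound U p i j : `|(U ^+ p) i j| <= (\sum_i \sum_j `|U i j|) ^+ p.
Proof.
set C := \sum_i _.
have C0 : 0 <= C by rewrite sumr_ge0// => ? _; rewrite sumr_ge0.
have rowC k : \sum_l `|U k l| <= C.
  rewrite /C [leRHS](bigD1 k)//= lerDl sumr_ge0// => k' _; exact: sumr_ge0.
elim: p i j => [|p IH] i j.
  by rewrite !expr0 mxE; case: (_ == _); rewrite ?normr1 ?normr0.
rewrite !exprS mxE (le_trans (ler_norm_sum _ _ _))//.
apply: le_trans (_ : (\sum_l `|U i l|) * C ^+ p <= _).
  by rewrite mulr_suml ler_sum// => l _; rewrite normrM ler_wpM2l.
by rewrite ler_wpM2r// exprn_ge0.
Qed.

Lemma cvg_pseries_fact (c : nat -> R) (B C x : R) : 0 <= C ->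
  (forall p, `|c p| <= B * (C ^+ p / p`!%:R)) -> cvgn (pseries c x).
Proof.
move=> C0 cB; apply: normed_cvg.
have cxB n : `|c n * x ^+ n| <= B * exp_coeff (C * `|x|) n.
  rewrite /exp_coeff/= normrM normrX exprMn.
  rewrite [leRHS](_ : _ = B * (C ^+ n / n`!%:R) * `|x| ^+ n).
    by rewrite ler_wpM2r// exprn_ge0.
  by rewrite mulrAC !mulrA.
apply: (series_le_cvg (v_ := B *: exp_coeff (C * `|x|))) => //.
- by move=> n /=; exact: normr_ge0.
- by move=> n; exact: (le_trans (normr_ge0 _) (cxB n)).
- by apply: is_cvg_seriesZ; exact: is_cvg_series_exp_coeff.
Qed.

Lemma pseries_diffs_expmx U i j p :
  pseries_diffs (expmx_coef U i j) p = p`!%:R^-1 * (U ^+ p.+1) i j.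
Proof.
rewrite /pseries_diffs /expmx_coef factS natrM invfM !mulrA divff ?mul1r// pnatr_eq0.
Qed.

Lemma pseries_diffs_expmx_l U i j p :
  pseries_diffs (expmx_coef U i j) p = \sum_k U i k * expmx_coef U k j p.
Proof.
rewrite pseries_diffs_expmx exprS -mulmxE mxE mulr_sumr.
by apply: eq_bigr => k _; rewrite mulrCA.
Qed.

Lemma pseries_diffs_expmx_r U i j p :
  pseries_diffs (expmx_coef U i j) p = \sum_k expmx_coef U i k p * U k j.
Proof.
rewrite pseries_diffs_expmx exprSr -mulmxE mxE mulr_sumr.
by apply: eq_bigr => k _; rewrite mulrA.
Qed.

Lemma expmx_coef_bound U i j p :
  `|expmx_coef U i j p| <= 1 * ((\sum_i \sum_j `|U i j|) ^+ p / p`!%:R).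
Proof.
rewrite mul1r mulrC normrM ger0_norm ?invr_ge0// ler_wpM2l ?invr_ge0//.
exact: mx_exp_bound.
Qed.

Let C0 U : 0 <= \sum_i \sum_j `|U i j|.
Proof. by rewrite sumr_ge0// => i _; rewrite sumr_ge0. Qed.

Lemma cvg_expmx_coef U i j x : cvgn (pseries (expmx_coef U i j) x).
Proof. exact: cvg_pseries_fact (C0 U) (expmx_coef_bound U i j). Qed.

Lemma limn_sum_scale (I : finType) (a : I -> R) (u : I -> nat -> R) :
  (forall k, cvgn (u k)) ->
  limn (fun n => \sum_k a k * u k n) = \sum_k a k * limn (u k).
Proof.
move=> cu; apply/cvg_lim => //.
by apply: cvg_big => [|k _]; [exact: add_continuous|apply: cvgMl_tmp; exact: cu].
Qed.

Lemma limn_diffs_l U i j x :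
  limn (pseries (pseries_diffs (expmx_coef U i j)) x) =
  (U *m expmx (x *: U)) i j.
Proof.
rewrite mxE; under eq_bigr do rewrite expmxE.
rewrite -limn_sum_scale; last by move=> k; exact: cvg_expmx_coef.
congr (limn _); apply/funext => N; rewrite /pseries /series/=.
under [RHS]eq_bigr do rewrite mulr_sumr.
rewrite exchange_big/=; apply: eq_bigr => p _.
by rewrite pseries_diffs_expmx_l mulr_suml; apply: eq_bigr => k _; rewrite mulrA.
Qed.

Lemma limn_diffs_r U i j x :
  limn (pseries (pseries_diffs (expmx_coef U i j)) x) =
  (expmx (x *: U) *m U) i j.
Proof.
rewrite mxE; under eq_bigr do rewrite expmxE mulrC.
rewrite -limn_sum_scale; last by move=> k; exact: cvg_expmx_coef.
congr (limn _); apply/funext => N; rewrite /pseries /series/=.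
under [RHS]eq_bigr do rewrite mulr_sumr.
rewrite exchange_big/=; apply: eq_bigr => p _.
rewrite pseries_diffs_expmx_r mulr_suml; apply: eq_bigr => k _.
by rewrite mulrA; congr (_ * _); rewrite mulrC.
Qed.

Lemma expmx_comm U x : expmx (x *: U) *m U = U *m expmx (x *: U).
Proof. by apply/matrixP => i j; rewrite -limn_diffs_l -limn_diffs_r. Qed.

(** Differentiation of a power series term by term; the series of the first and
    second derivatives are dominated by exponential series too. *)
Lemma is_derive_expmx U i j (x : R) :
  is_derive x 1 (fun x => expmx (x *: U) i j) ((U *m expmx (x *: U)) i j).
Proof.
rewrite (_ : (fun x => _) = fun x => limn (pseries (expmx_coef U i j) x)); last first.
  by apply/funext => y; rewrite expmxE.
rewrite -limn_diffs_l.
set C := \sum_i \sum_j `|U i j|.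
have b1 p : `|pseries_diffs (expmx_coef U i j) p| <= C * (C ^+ p / p`!%:R).
  rewrite pseries_diffs_expmx normrM ger0_norm ?invr_ge0// mulrA -exprS mulrC.
  by rewrite ler_wpM2r ?invr_ge0//; exact: mx_exp_bound.
have b2 p : `|pseries_diffs (pseries_diffs (expmx_coef U i j)) p| <=
    C ^+ 2 * (C ^+ p / p`!%:R).
  have -> : pseries_diffs (pseries_diffs (expmx_coef U i j)) p =
    p.+1%:R * pseries_diffs (expmx_coef U i j) p.+1 :> R by [].
  rewrite pseries_diffs_expmx factS natrM invfM !mulrA divff ?pnatr_eq0// mul1r.
  rewrite normrM ger0_norm ?invr_ge0// -exprD mulrC.
  by rewrite ler_wpM2r ?invr_ge0//; exact: mx_exp_bound.
apply: (@pseries_snd_diffs _ _ (`|x| + 1)).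
- exact: cvg_expmx_coef.
- exact: cvg_pseries_fact (C0 U) b1.
- exact: cvg_pseries_fact (C0 U) b2.
- by rewrite [ltRHS]ger0_norm ?addr_ge0// ltrDl.
Qed.
End Expmx.

Section Expmx.
Context {R : realType} {m : nat}.
Implicit Types (U : 'M[R]_m).

Lemma expmx0 U : expmx (0 *: U) = 1%:M.
Proof.
apply/matrixP => i j; rewrite scale0r mxE; apply/cvg_lim => //.
rewrite -cvg_shiftS/=; under eq_cvg => n.
  rewrite big_nat_recl// big1/= ?addr0; last first.
    by move=> p _; rewrite exprS -mulmxE mul0mx mxE mulr0.
  over.
by rewrite expr0 fact0 invr1 mul1r; exact: cvg_cst.
Qed.

Lemma is_derive_comp_scale (f : R -> R) (a b d x : R) :
  is_derive (b + a * x) 1 f d -> is_derive x 1 (fun x => f (b + a * x)) (a * d).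
Proof.
move=> fd; have gd : is_derive x 1 (fun x : R => b + a * x) a.
  by apply: is_derive_eq; rewrite add0r mul1r [_%:A]mulr1.
by rewrite mulrC; exact: (@is_derive1_comp _ f (fun x => b + a * x) x _ _ fd gd).
Qed.

Lemma is_derive_expmxN U i j (x : R) :
  is_derive x 1 (fun x => expmx ((- x) *: U) i j)
    (- (expmx ((- x) *: U) *m U) i j).
Proof.
have h : is_derive (0 + -1 * x) 1 (fun x => expmx (x *: U) i j)
    ((expmx ((- x) *: U) *m U) i j).
  by rewrite expmx_comm add0r mulN1r; exact: is_derive_expmx.
have := is_derive_comp_scale h; rewrite mulN1r.
by under eq_fun do rewrite add0r mulN1r.
Qed.

Lemma is_derive_bigsum (I : finType) (f : I -> R -> R) (d : I -> R) (x : R) :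
  (forall k, is_derive x 1 (f k) (d k)) ->
  is_derive x 1 (fun x => \sum_k f k x) (\sum_k d k).
Proof.
move=> fd.
have -> : (fun x => \sum_k f k x) = \sum_(k < #|I|) f (enum_val k).
  apply/funext => y; rewrite fct_sumE (reindex (@enum_val I predT)).
    exact: eq_bigr.
  by exists enum_rank => k _; rewrite ?enum_valK ?enum_rankK.
rewrite (reindex (@enum_val I predT)); last first.
  by exists enum_rank => k _; rewrite ?enum_valK ?enum_rankK.
by apply: is_derive_sum => k.
Qed.

Lemma is_derive_mulmx n p (F : R -> 'M[R]_(n, m)) (G : R -> 'M[R]_(m, p))
    (F' : 'M[R]_(n, m)) (G' : 'M[R]_(m, p)) (x : R) :
  (forall i j, is_derive x 1 (fun x => F x i j) (F' i j)) ->
  (forall i j, is_derive x 1 (fun x => G x i j) (G' i j)) ->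
  forall i j, is_derive x 1 (fun x => (F x *m G x) i j)
                ((F' *m G x + F x *m G') i j).
Proof.
move=> dF dG i j; under eq_fun do rewrite mxE.
rewrite !mxE -big_split/=.
apply: (@is_derive_bigsum _ (fun k x => F x i k * G x k j)) => k.
have := is_deriveM (dF i k) (dG k j); rewrite /GRing.scale/=.
by rewrite addrC [G x k j * _]mulrC.
Qed.

(** The product has zero derivative, since [U] commutes with its exponential. *)
Lemma expmxN_ode U p (H : R -> 'M[R]_(m, p)) :
  (forall (x : R) i j, is_derive x 1 (fun x => H x i j) ((U *m H x) i j)) ->
  forall x, expmx ((- x) *: U) *m H x = H 0.
Proof.
move=> dH x; apply/matrixP => i j.
transitivity ((expmx ((- 0) *: U) *m H 0) i j); last first.
  by rewrite oppr0 expmx0 mul1mx.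
apply: (@is_derive_0_is_cst _ (fun x => (expmx ((- x) *: U) *m H x) i j)) => y.
have := is_derive_mulmx (F := fun x => expmx ((- x) *: U))
  (F' := - (expmx ((- y) *: U) *m U)) (G := H) (G' := U *m H y) (x := y) _ (dH y) i j.
rewrite mulNmx mulmxA addNr mxE; apply => k l.
by rewrite mxE; exact: is_derive_expmxN.
Qed.

Lemma expmxN U x : expmx ((- x) *: U) *m expmx (x *: U) = 1%:M.
Proof.
rewrite -(expmx0 U); apply: (expmxN_ode (H := fun x => expmx (x *: U))).
by move=> z i j; exact: is_derive_expmx.
Qed.

Lemma expmx_ode U p (H : R -> 'M[R]_(m, p)) :
  (forall (x : R) i j, is_derive x 1 (fun x => H x i j) ((U *m H x) i j)) ->
  forall x, H x = expmx (x *: U) *m H 0.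
Proof.
move=> dH x; have := expmxN U (- x); rewrite opprK => E1.
by rewrite -(expmxN_ode dH x) mulmxA E1 mul1mx.
Qed.

(** The right-hand side solves the differential equation of the left-hand side. *)
Lemma expmx_shift U (a x : R) :
  expmx (x *: U) = expR (- a * x) *: expmx (x *: (U + a%:M)).
Proof.
pose H (y : R) := expR (- a * y) *: expmx (y *: (U + a%:M)).
have H0 : H 0 = 1%:M by rewrite /H mulr0 expR0 scale1r expmx0.
rewrite -[LHS]mulmx1 -H0 -[RHS]/(H x); symmetry.
apply: (expmx_ode (H := H)) => y i j.
have e : is_derive y 1 (fun y => expR (- a * y)) (- a * expR (- a * y)).
  rewrite -[X in expR X]add0r.
  under eq_fun do rewrite -[X in expR X]add0r.
  by apply: (@is_derive_comp_scale expR); exact: is_derive_expR.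
under eq_fun do rewrite mxE.
have := is_deriveM e (is_derive_expmx (U + a%:M) i j y); rewrite /GRing.scale/=.
congr (is_derive _ _ _ _); rewrite /H -scalemxAr mulmxDl mul_scalar_mx !mxE.
by rewrite mulrDr addrAC -addrA mulrCA; lra.
Qed.

(** Comparing the derivatives at 1, an interior point of the half-line, gives
    [U exp U = V exp U], and [exp U] is invertible. *)
Lemma expmx_inj U V :
  (forall x, 0 <= x -> expmx (x *: U) = expmx (x *: V)) -> U = V.
Proof.
move=> UV.
have E1 : U *m expmx (1 *: U) = V *m expmx (1 *: U).
  rewrite [in RHS]UV//; apply/matrixP => i j.
  have dU := is_derive_expmx U i j 1; have dV := is_derive_expmx V i j 1.
  rewrite -(derive_val (is_derive := dU)) -(derive_val (is_derive := dV)).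
  apply: near_eq_derive; near=> x; rewrite UV//.
  by near: x; apply: lt_le_nbhsr; exact: ltr01.
have := congr1 (fun M => M *m expmx ((- 1) *: U)) E1.
by rewrite -!mulmxA (mulmx1C (expmxN U 1)) !mulmx1.
Unshelve. all: by end_near. Qed.

Section Subgenerator.
Variables (U : 'M[R]_m) (sU : subgenerator U).

(** After a shift by a large multiple [a] of the identity the matrix is nonnegative
    with row sums at most [a], so the entries of its powers are at most [a ^+ p] and
    the factor [expR (- a x)] of the shift compensates the sum of the series. *)
Lemma expmx_subgenerator_bounds x i j : 0 <= x -> 0 <= expmx (x *: U) i j <= 1.
Proof.
move=> x0; pose a := \sum_i `|U i i|; pose N := U + a%:M.
have N0 k l : 0 <= N k l.
  rewrite !mxE; have [->|kl] := eqVneq k l; last by rewrite addr0 sU.1.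
  rewrite mulr1n /a (bigD1 l)//= addrA addr_ge0//.
    by rewrite -lerBlDl sub0r -normrN ler_norm.
  by rewrite sumr_ge0.
have Np0 p : forall k l, 0 <= (N ^+ p) k l.
  elim: p => [|p IH] k l; first by rewrite expr0 mxE ler0n.
  by rewrite exprS -mulmxE; exact: mulmx_ge0.
have Nrow k : \sum_l N k l <= a.
  under eq_bigr do rewrite !mxE; rewrite big_split/= -[leRHS]add0r lerD//.
    exact: sU.2.
  rewrite (bigD1 k)//= eqxx mulr1n big1 ?addr0// => l; rewrite eq_sym.
  by move=> /negbTE ->; rewrite mulr0n.
have a0 : 0 <= a by rewrite sumr_ge0.
have Npa p k l : (N ^+ p) k l <= a ^+ p.
  elim: p k l => [|p IH] k l.
    by rewrite !expr0 mxE; case: eqP.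
  rewrite !exprS -mulmxE mxE.
  apply: le_trans (_ : \sum_j N k j * a ^+ p <= _).
    by apply: ler_sum => j' _; rewrite ler_wpM2l.
  by rewrite -mulr_suml ler_wpM2r ?exprn_ge0.
rewrite (expmx_shift _ a) mxE mulr_ge0 ?expR_ge0//=; last first.
  rewrite expmxE; apply: limr_ge; first exact: cvg_expmx_coef.
  apply: nearW => n; rewrite /pseries /series/= sumr_ge0// => p _.
  by rewrite mulr_ge0 ?exprn_ge0// mulr_ge0 ?invr_ge0.
rewrite mulNr expRN ler_pdivrMl ?expR_gt0// mulr1 expmxE.
apply: lim_series_le.
- exact: cvg_expmx_coef.
- exact: is_cvg_series_exp_coeff.
move=> p; have /le_trans : p`!%:R^-1 * (N ^+ p) i j * x ^+ p <=
    p`!%:R^-1 * a ^+ p * x ^+ p.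
  by rewrite ler_wpM2r ?exprn_ge0// ler_wpM2l ?invr_ge0.
by apply; rewrite /exp_coeff/= exprMn [leRHS]mulrC mulrA.
Qed.

End Subgenerator.

End Expmx.

(** * The passage matrices as solutions of the recursion *)

Lemma truncationE {R : realType} (s : nat -> nat) n
    (M : forall k l, 'M[R]_(s k, s l)) (k l : 'I_n) (i : 'I_(s k)) (j : 'I_(s l)) :
  truncation n M (tagnat.Rank k i) (tagnat.Rank l j) = M k l i j.
Proof.
have := congr1 (fun N : 'M[R]_(s k, s l) => N i j)
  (mxblockK (fun k l : 'I_n => M k l) k l).
by rewrite mxE.
Qed.

Lemma sum_Rank {R : realType} n (p : 'I_n -> nat) (F : 'I_(\sum_(k < n) p k) -> R) :
  \sum_I F I = \sum_(k < n) \sum_(i < p k) F (tagnat.Rank k i).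
Proof.
rewrite sig_big_dep/= (reindex _ tagnat.rank_bij_on)/=.
by apply: eq_bigr => -[k i] _; rewrite tagnat.rankE.
Qed.

Section PassageMatrices.
Context {R : realType} (s : nat -> nat).
Variables (A : forall k, 'M[R]_(s k)) (D : forall k, 'M[R]_(s k, s k.+1)).
Variables (lambda c theta : R).

Let a : R := c / (lambda + theta).

(** The recursion defines the block [(k, l)] from blocks with a smaller gap
    [l - k]; [d] bounds the gap. On the diagonal [conform_mx] only transports along
    [k = l]. *)
Fixpoint psi_fuel (d k l : nat) : 'M[R]_(s k, s l) :=
  if d is d'.+1 then
    if k == l
    then conform_mx 0 ((lambda / (lambda + theta)) *: invmx (1%:M - a *: A k))
    else (a *: \sum_(k <= v < l) psi_fuel d' k v *m D v *m psi_fuel d' v.+1 l)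
         *m invmx (1%:M - a *: A l)
  else 0.

Definition psi k l := psi_fuel (l - k).+1 k l.

Definition umx k l : 'M[R]_(s k, s l) := diag_block A k l + D k *m psi k.+1 l.

Lemma psi_fuelE d d' k l : (l - k < d)%N -> (l - k < d')%N ->
  psi_fuel d k l = psi_fuel d' k l.
Proof.
elim: d d' k l => [//|d IH] [//|d'] k l lkd lkd' /=.
case: ifPn => // kl; congr (_ *: _ *m _); apply: eq_big_nat => v /andP[kv vl].
by rewrite (IH d' k v) ?(IH d' v.+1 l)//; lia.
Qed.

Lemma psi_diag k :
  psi k k = (lambda / (lambda + theta)) *: invmx (1%:M - a *: A k).
Proof. by rewrite /psi subnn /= eqxx conform_mx_id. Qed.

Lemma psi_off k l : k != l ->
  psi k l = (a *: \sum_(k <= v < l) psi k v *m D v *m psi v.+1 l)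
            *m invmx (1%:M - a *: A l).
Proof.
move=> kl; rewrite {1}/psi /= (negbTE kl); congr (_ *: _ *m _).
apply: eq_big_nat => v /andP[kv vl]; congr (_ *m _ *m _).
  by apply: psi_fuelE; lia.
by apply: psi_fuelE; lia.
Qed.

Lemma psi_lower k l : (l < k)%N -> psi k l = 0.
Proof.
move=> lk; rewrite psi_off ?gtn_eqF// big_geq ?scaler0 ?mul0mx//.
exact: ltnW.
Qed.

Hypotheses (lambda_gt0 : 0 < lambda) (c_gt0 : 0 < c) (theta_ge0 : 0 <= theta).
Hypotheses (A_offdiag : forall k i j, i != j -> 0 <= A k i j)
  (D_ge0 : forall k i j, 0 <= D k i j)
  (AD_rowsum : forall k,
      A k *m const_mx 1 + D k *m const_mx 1 = 0 :> 'cV[R]_(s k)).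

Let lt_gt0 : 0 < lambda + theta. Proof. exact: ltr_wpDr. Qed.
Let a_ge0 : 0 <= a. Proof. by rewrite divr_ge0// ltW. Qed.

Lemma subgenerator_block k : subgenerator (A k).
Proof.
split=> [i j|i]; first exact: A_offdiag.
have /matrixP/(_ i 0) := AD_rowsum k; rewrite !mxE.
under eq_bigr do rewrite mxE mulr1; move/eqP; rewrite addr_eq0 => /eqP ->.
by rewrite oppr_le0 sumr_ge0// => j _; rewrite !mxE mulr1.
Qed.

Lemma psi_ge0 k l i j : 0 <= psi k l i j.
Proof.
move: {2}(l - k).+1 (ltnSn (l - k)) => d; elim: d k l i j => // d IH k l i j lkd.
have [kl|kl] := eqVneq k l.
  subst l; rewrite psi_diag mxE mulr_ge0 ?divr_ge0 ?(ltW lambda_gt0) ?(ltW lt_gt0)//.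
  by apply: invmx_resolvent_ge0 => //; exact: subgenerator_block.
rewrite psi_off//; apply: mulmx_ge0 => {i j} [i j|]; last first.
  by apply: invmx_resolvent_ge0 => //; exact: subgenerator_block.
rewrite mxE mulr_ge0// summxE big_nat_cond sumr_ge0// => v /andP[/andP[kv vl] _].
apply: mulmx_ge0 => [i1 j1|i1 j1]; last by apply: IH; lia.
by apply: mulmx_ge0 => // i2 j2; apply: IH; lia.
Qed.

(** Splitting [umx] into its two summands, the first one turns the left-hand side
    into a multiple of [1 - a A l] on the right of [psi k l], which cancels the inverse
    in the recursion; the second one is the sum in the recursion. *)
Lemma psi_eq n (k l : 'I_n) :
  (lambda + theta) *: psi k l - c *: \sum_(v < n) psi k v *m umx v l =
  diag_block (fun k => lambda%:M) k l.
Proof.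
have split_sum : \sum_(v < n) psi k v *m umx v l = psi k l *m A l +
    \sum_(k <= v < l) psi k v *m D v *m psi v.+1 l.
  under eq_bigr do rewrite mulmxDr mulmxA; rewrite big_split/=; congr (_ + _).
    rewrite (bigD1 l)//= /diag_block eqxx conform_mx_id big1 ?addr0// => v vl.
    by rewrite val_eqE (negbTE vl) mulmx0.
  rewrite (big_nat_widen _ _ n)//; last exact: ltnW.
  rewrite (big_nat_widenl _ 0)//= big_mkord [RHS]big_mkcond/=.
  apply: eq_bigr => v _; case: ifPn => // kvl.
  have [kv|vk] := leqP k v; last by rewrite (psi_lower vk) !mul0mx.
  by rewrite (@psi_lower v.+1 l) ?mulmx0//; lia.
rewrite split_sum scalerDr opprD addrA.
have -> : (lambda + theta) *: psi k l - c *: (psi k l *m A l) =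
    (lambda + theta) *: (psi k l *m (1%:M - a *: A l)).
  rewrite mulmxBr mulmx1 scalerBr -scalemxAr scalerA /a mulrC divfK//.
  exact: lt0r_neq0.
rewrite /diag_block; have [kl|kl] := eqVneq (k : nat) l.
  have {kl}-> : k = l by exact: val_inj.
  rewrite big_geq// scaler0 subr0 psi_diag conform_mx_id.
  rewrite -scalemxAl mulVmx ?scalerA ?resolvent_unit//; last exact: subgenerator_block.
  by rewrite mulrC divfK ?scalemx1// lt0r_neq0.
rewrite psi_off// -mulmxA mulVmx ?resolvent_unit//; last exact: subgenerator_block.
by rewrite mulmx1 scalerA /a mulrC divfK ?subrr// lt0r_neq0.
Qed.

Lemma truncation_psi_eq n :
  truncation n psi *m ((lambda + theta)%:M - c *: truncation n umx) = lambda%:M.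
Proof.
rewrite mulmxBr mul_mx_scalar -scalemxAr /truncation mul_mxblock.
apply/mxblockP => k l; have E1 := psi_eq k l.
transitivity (diag_block (fun k => lambda%:M : 'M[R]_(s k)) k l).
  rewrite -E1; apply/matrixP => i j; rewrite !mxE.
  have := congr1 (fun M : 'M[R]_(s k, s l) => M i j)
    (mxblockK (fun k l : 'I_n => psi k l) k l).
  rewrite !mxE => ->; congr (_ - _ * _).
  have := congr1 (fun M : 'M[R]_(s k, s l) => M i j)
    (mxblockK (fun k l : 'I_n => \sum_(v < n) psi k v *m umx v l) k l).
  by rewrite !mxE => ->.
apply/matrixP => i j; rewrite !mxE /diag_block.
rewrite -[X in _ *+ X]/(nat_of_bool (_ == _)) -val_eqE/= tagnat.eq_Rank.
have [e|e] := eqVneq k l; last by rewrite val_eqE (negbTE e) mxE.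
by subst l; rewrite eqxx conform_mx_id mxE.
Qed.

(** By downward induction on the block: if the row sums of [psi] in block [k.+1] are
    at most 1, those of [umx] in block [k] are at most those of [A k] and [D k]
    together, namely 0; then [psi_eq] bounds the row sums of [psi] in block [k] by
    [lambda / (lambda + theta)]. *)
Lemma umx_row_le0 n (k : 'I_n) :
  forall i, (\sum_(l < n) (umx k l *m const_mx 1 : 'cV_(s k))) i 0 <= 0.
Proof.
have key m : forall k : nat, (n - k < m)%N ->
    (forall i, (\sum_(l < n) (psi k l *m const_mx 1 : 'cV_(s k))) i 0 <= 1) /\
    ((k < n)%N -> forall i, (\sum_(l < n) (umx k l *m const_mx 1 : 'cV_(s k))) i 0 <= 0).
  elim: m => // m IH {}k nkm.
  have [nk|kn] := leqP n k.
    split=> // i; rewrite big1 ?mxE// => l _.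
    by rewrite psi_lower ?mul0mx// (leq_trans (ltn_ord l)).
  have umx_le0 v : (k <= v)%N -> (v < n)%N ->
      forall i, (\sum_(l < n) (umx v l *m const_mx 1 : 'cV_(s v))) i 0 <= 0.
    move=> kv vn i; have [psi1 _] := IH v.+1 ltac:(lia).
    have -> : \sum_(l < n) (umx v l *m const_mx 1 : 'cV_(s v)) =
        A v *m const_mx 1 + D v *m \sum_(l < n) (psi v.+1 l *m const_mx 1 : 'cV_(s v.+1)).
      under eq_bigr do rewrite mulmxDl -mulmxA; rewrite big_split/= -mulmx_sumr.
      congr (_ + _); rewrite (bigD1 (Ordinal vn))//= /diag_block eqxx conform_mx_id.
      by rewrite big1 ?addr0// => l; rewrite eq_sym -val_eqE/= => /negbTE ->; rewrite mul0mx.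
    have /matrixP/(_ i 0) := AD_rowsum v; rewrite mxE [RHS]mxE => AD0.
    rewrite mxE -AD0 lerD2l !mxE; apply: ler_sum => j _.
    by rewrite ler_wpM2l// [leRHS]mxE.
  split; last by move=> _; exact: umx_le0.
  have e : (lambda + theta) *: \sum_(l < n) (psi k l *m const_mx 1 : 'cV_(s k)) -
      c *: \sum_(v < n) psi k v *m \sum_(l < n) (umx v l *m const_mx 1 : 'cV_(s v)) =
      const_mx lambda.
    transitivity (\sum_(l < n)
        (diag_block (fun k => lambda%:M) k l *m const_mx 1 : 'cV[R]_(s k))).
      under [RHS]eq_bigr => l _ do rewrite -(psi_eq (Ordinal kn)) mulmxBl -!scalemxAl.
      rewrite sumrB -!scaler_sumr; congr (_ - _ *: _).
      under eq_bigr do rewrite mulmx_sumr; rewrite exchange_big/=.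
      apply: eq_bigr => l _; rewrite mulmx_suml.
      by apply: eq_bigr => v _; rewrite mulmxA.
    rewrite (bigD1 (Ordinal kn))//= /diag_block eqxx conform_mx_id big1 ?addr0.
      by apply/matrixP => i j; rewrite mul_scalar_mx !mxE mulr1.
    by move=> l; rewrite eq_sym -val_eqE/= => /negbTE ->; rewrite mul0mx.
  move=> i; move/matrixP/(_ i 0): e; rewrite !mxE => /eqP; rewrite subr_eq => /eqP e.
  rewrite -(ler_pM2l lt_gt0) e mulr1 lerD2l (le_trans _ theta_ge0)//.
  rewrite pmulr_rle0// summxE sumr_le0// => v _; rewrite mxE sumr_le0// => j _.
  have [kv|vk] := leqP k v; last by rewrite psi_lower// mxE mul0r.
  by rewrite mulr_ge0_le0 ?psi_ge0// umx_le0.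
by have [_ /(_ (ltn_ord k))] := key _ k (ltnSn _).
Qed.

Lemma subgenerator_truncation n : subgenerator (truncation n umx).
Proof.
split=> [I J IJ|I].
  rewrite -(tagnat.sig2K I) -(tagnat.sig2K J) truncationE mxE addr_ge0//; last first.
    by apply: mulmx_ge0 => // i j; exact: psi_ge0.
  move: IJ; rewrite -{1}(tagnat.sig2K I) -{1}(tagnat.sig2K J).
  move: (tagnat.sig1 I) (tagnat.sig1 J) (tagnat.sig2 I) (tagnat.sig2 J) => k l i j.
  rewrite -val_eqE/= tagnat.eq_Rank /diag_block.
  have [kl|kl] := eqVneq k l; last by rewrite val_eqE (negbTE kl) mxE.
  by subst l; rewrite eqxx conform_mx_id/=; exact: A_offdiag.
rewrite -(tagnat.sig2K I) sum_Rank.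
move: (tagnat.sig1 I) (tagnat.sig2 I) => k i.
apply: le_trans (umx_row_le0 i); rewrite summxE; apply: ler_sum => l _.
rewrite mxE; apply: ler_sum => j _.
by rewrite truncationE [X in _ <= _ * X]mxE mulr1.
Qed.

End PassageMatrices.

(** * Integration against exponential laws *)

Section WeightedTransfer.
Context {R : realType} {d d'} {T : measurableType d} {U : measurableType d'}.
Variables (mu : {measure set T -> \bar R}) (m : {measure set U -> \bar R}).
Variables (h : T -> R) (g : T -> U).
Hypotheses (mh : measurable_fun setT h) (h0 : forall x, 0 <= h x)
  (mg : measurable_fun setT g).
Hypothesis hgm : forall X, measurable X ->
  (\int[mu]_x (h x * \1_X (g x))%:E = m X)%E.

Import HBNNSimple.

Let transfer_nnsfun (F : {nnsfun U >-> R}) :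
  (\int[mu]_x ((h x)%:E * (F (g x))%:E) = \int[m]_y (F y)%:E)%E.
Proof.
rewrite integralT_nnsfun sintegralE.
transitivity (\int[mu]_x (\sum_(r \in range F)
    (r * (h x * \1_(F @^-1` [set r]) (g x)))%:E)%E)%E.
  apply: eq_integral => x _; rewrite {1}(fimfunE F (g x)) -EFinM fsumEFin//.
  congr EFin; rewrite mulr_fsumr//; apply: eq_fsbigr => r _.
  by rewrite mulrCA.
have m1 r : measurable_fun setT (fun x => h x * \1_(F @^-1` [set r]) (g x)).
  apply: measurable_funM => //.
  by apply: (@measurableT_comp _ _ _ _ _ _ (\1_(F @^-1` [set r]) : U -> R)).
rewrite ge0_integral_fsum//; last 2 first.
- by move=> r; apply/measurable_EFinP; exact: measurable_funM.
- move=> r x _; rewrite lee_fin mulrCA mulr_ge0//.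
  by have := nnfun_muleindic_ge0 F r (g x); rewrite -EFinM lee_fin.
apply: eq_fsbigr => r /set_mem [y _ Fy].
under eq_integral do rewrite EFinM.
rewrite ge0_integralZl//.
- by rewrite hgm.
- exact/measurable_EFinP.
- by move=> x _; rewrite lee_fin mulr_ge0.
- by rewrite lee_fin -Fy.
Qed.

(** Equality on indicators extends to simple functions and then to monotone limits.
    With a density for [h] this is integration against an absolutely continuous law,
    and with an indicator for [h] integration against a restricted image law. *)
Lemma weighted_transfer (F : U -> \bar R) :
  measurable_fun setT F -> (forall y, 0 <= F y)%E ->
  (\int[mu]_x ((h x)%:E * F (g x)) = \int[m]_y F y)%E.
Proof.
move=> mF F0; pose F_ := nnsfun_approx measurableT mF.
have F_F y : (F_ n y)%:E @[n --> \oo] --> F y by exact: cvg_nnsfun_approx.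
have ndF y : {homo (fun n => (F_ n y)%:E) : a b / (a <= b)%N >-> (a <= b)%E}.
  by move=> a b ab; rewrite lee_fin; exact/lefP/nd_nnsfun_approx.
have mh' : measurable_fun setT (fun x => (h x)%:E) by exact/measurable_EFinP.
transitivity (limn (fun n => \int[mu]_x ((h x)%:E * (F_ n (g x))%:E))%E).
  rewrite -monotone_convergence//.
  - apply: eq_integral => x _; apply/esym/cvg_lim => //.
    exact: cvgeZl (F_F _).
  - by move=> n; apply: emeasurable_funM => //;
      apply/measurable_EFinP; exact: measurableT_comp.
  - by move=> n x _; rewrite -EFinM lee_fin mulr_ge0.
  - by move=> x _ a b ab; apply: lee_wpmul2l; [rewrite lee_fin|exact: ndF].
transitivity (limn (fun n => \int[m]_y (F_ n y)%:E))%E.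
  by congr (limn _); apply/funext => n; exact: transfer_nnsfun.
rewrite -monotone_convergence//.
- by apply: eq_integral => y _; apply/cvg_lim => //; exact: F_F.
- by move=> n; exact/measurable_EFinP.
- by move=> n y _; rewrite lee_fin.
Qed.

End WeightedTransfer.

Section LawOn.
Context {R : realType} {d d'} {T : measurableType d} {U : measurableType d'}.
Variables (P : probability T R).

(** The proofs of measurability are arguments so that the structure of finite measure
    can be inferred from the term. *)
Definition law_on (H : set T) (g : T -> U) (mH : measurable H)
  (mg : measurable_fun setT g) : set U -> \bar R := fun X => P (H `&` g @^-1` X).

Section Instances.
Variables (H : set T) (g : T -> U) (mH : measurable H) (mg : measurable_fun setT g).
Local Notation law := (law_on mH mg).

Let mpre X : measurable X -> measurable (g @^-1` X).
Proof. by move=> mX; rewrite -[X in measurable X]setTI; exact: mg. Qed.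

Let law0 : law set0 = 0%E.
Proof. by rewrite /law_on preimage_set0 setI0 measure0. Qed.

Let law_ge0 X : (0 <= law X)%E.
Proof. exact: measure_ge0. Qed.

Let law_sigma_additive : semi_sigma_additive law.
Proof.
move=> F mF tF mUF; rewrite /law_on preimage_bigcup setI_bigcupr.
apply: measure_semi_sigma_additive.
- by move=> n; apply: measurableI => //; exact: mpre.
- apply/trivIsetP => /= i j _ _ ij; rewrite setIACA setIid -preimage_setI.
  by move/trivIsetP : tF => /(_ _ _ _ _ ij) ->//; rewrite preimage_set0 setI0.
- by apply: bigcupT_measurable => n; apply: measurableI => //; exact: mpre.
Qed.

HB.instance Definition _ := isMeasure.Build _ _ _ law law0 law_ge0 law_sigma_additive.

Let law_fin : fin_num_fun law.
Proof.
move=> X mX; rewrite ge0_fin_numE ?measure_ge0//.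
apply: (@le_lt_trans _ _ 1%E); last exact: ltry.
apply: probability_le1; apply: measurableI => //; exact: mpre.
Qed.

HB.instance Definition _ := @Measure_isFinite.Build _ _ _ law law_fin.

End Instances.
End LawOn.

Section ExponentialLaw.
Context {R : realType}.

(** The positivity proof is an argument so that the structure of probability can be
    inferred from the term. *)
Definition exp_law (q : R) (q0 : 0 < q) : set R -> \bar R := exponential_prob q.

Section Instances.
Variables (q : R) (q0 : 0 < q).
Let m : probability _ R :=
  exponential_distribution_exponential_prob__canonical__probability_measure_Probability q0.

HB.instance Definition _ := isMeasure.Build _ _ _ (exp_law q0) (measure0 m)
  (measure_ge0 m) (@measure_semi_sigma_additive _ _ _ m).

HB.instance Definition _ :=
  @Measure_isProbability.Build _ _ R (exp_law q0) (@probability_setT _ _ _ m).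
End Instances.

Variables (q : R) (q0 : 0 < q).

Lemma exp_law_ray t : exp_law q0 `]t, +oo[ = (expR (- q * Num.max t 0))%:E.
Proof.
have [t0|t0] := leP 0 t; last first.
  rewrite mulr0 expR0.
  transitivity (exp_law q0 setT); last by rewrite probability_setT.
  rewrite /exp_law /exponential_prob; rewrite [RHS]integral_mkcond [LHS]integral_mkcond.
  apply: eq_integral => u _; rewrite !patchE in_setT; case: ifPn => //.
  rewrite notin_setE/= in_itv/= andbT => /negP; rewrite -leNgt => ut.
  by rewrite lt0_exponential_pdf// (le_lt_trans ut).
rewrite /exp_law /exponential_prob integral_itv_obnd_cbnd; last first.
  by apply/measurable_EFinP/measurable_funTS; exact: measurable_exponential_pdf.
have cE : continuous (fun z : R^o => - expR (- q * z)).
  move=> z; apply: cvgN; apply: continuous_comp; last exact: continuous_expR.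
  by apply: continuousM => //; exact: cst_continuous.
have lE : - expR (- q * x) @[x --> +oo%R] --> (0 : R).
  rewrite -oppr0; apply: cvgN.
  under eq_fun do rewrite mulNr.
  apply: (@cvg_comp _ _ _ (fun x => q * x) (fun z => expR (- z)) _ (pinfty_nbhs R)).
    exact: gt0_cvgMry.
  exact: cvgr_expR.
rewrite (@ge0_continuous_FTC2y _ _ (fun x => - expR (- q * x)) _ 0)//.
- by rewrite sub0e -EFinN opprK.
- by move=> x tx; apply: exponential_pdf_ge0; exact: ltW.
- apply: (@continuous_subspaceW R^o _ _ [set` `[0, +oo[%R]).
    by move=> x/=; rewrite !in_itv/= !andbT; exact: le_trans.
  exact: within_continuous_exponential_pdf.
- by apply/cvg_at_right_filter; exact: cE.
- move=> x; rewrite in_itv/= andbT => tx.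
  by apply: derive1_exponential_pdf; rewrite in_itv/= andbT (le_lt_trans t0).
Qed.

Lemma integral_exp_law (F : R -> \bar R) : measurable_fun setT F ->
  (forall t, 0 <= F t)%E ->
  (\int[exp_law q0]_t F t = \int[lebesgue_measure]_t ((exponential_pdf q t)%:E * F t))%E.
Proof.
move=> mF F0; symmetry.
have h0 t : 0 <= exponential_pdf q t by rewrite exponential_pdf_ge0 ?ltW.
refine (@weighted_transfer _ _ _ _ _ lebesgue_measure (exp_law q0)
  (exponential_pdf q) id (measurable_exponential_pdf q) h0 _ _ F mF F0).
  exact: measurable_id.
move=> X mX; rewrite /exp_law/= /exponential_prob [RHS]integral_mkcond.
apply: eq_integral => t _; rewrite patchE indicE.
by case: (t \in X); rewrite ?mulr1 ?mulr0.
Qed.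

End ExponentialLaw.

(** The rays form a pi-system that generates the Borel sets and exhausts the line. *)
Lemma measure_eq_rays {R : realType} (m1 m2 : {measure set R -> \bar R}) :
  (forall t, m1 `]t, +oo[%classic = m2 `]t, +oo[%classic) ->
  (forall t, m1 `]t, +oo[%classic < +oo)%E ->
  forall B, measurable B -> m1 B = m2 B.
Proof.
move=> m12 m1oo B mB.
refine (@measure_unique _ _ _ (@RGenOInfty.G R)
  (fun n => `](- n%:R), +oo[%classic) _ _ _ _ m1 m2 _ _ B mB).
- exact: RGenOInfty.measurableE.
- move=> _ _ [x ->] [y ->]; exists (Num.max x y).
  by apply/seteqP; split => z /=; rewrite !in_itv/= !andbT gt_max => /andP.
- by move=> n; exists (- n%:R).
- apply/seteqP; split => // x _; exists (Num.bound `|x|) => //=.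
  rewrite in_itv/= andbT ltrNl.
  by rewrite (le_lt_trans _ (archi_boundP (normr_ge0 x)))// -normrN ler_norm.
- by move=> _ [x ->]; exact: m12.
- by move=> n; exact: m1oo.
Qed.

(** * The Markov property of a jump chain with its holding times *)

Lemma measurable_countable_cases {d d'} {T : measurableType d}
    {U : measurableType d'} {E : countType} (X : T -> E) (g : E -> T -> U) :
  (forall e, measurable [set w | X w = e]) ->
  (forall e, measurable_fun setT (g e)) ->
  measurable_fun setT (fun w => g (X w) w).
Proof.
move=> mX mg _ B mB; rewrite setTI.
have -> : (fun w => g (X w) w) @^-1` B = \bigcup_(k in setT)
    (if unpickle k is Some e then [set w | X w = e] `&` g e @^-1` B else set0).
  apply/seteqP; split => [w Bw|w [k _]].
    by exists (pickle (X w)) => //; rewrite pickleK.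
  by case: unpickle => // e [/= <-].
apply: bigcupT_measurable => k; case: unpickle => // e.
by apply: measurableI => //; rewrite -[X in measurable X]setTI; exact: mg.
Qed.

(** A variable with countably many values cuts the space into measurable cells,
    indexed here by the codes of the values, on which identities can be checked one at
    a time. *)
Section CountablePartition.
Context {R : realType} {d} {T : measurableType d} (P : probability T R).
Context {E : countType} (X : T -> E) (mX : forall e, measurable [set w | X w = e]).

Let cell k := [set w | pickle (X w) = k].

Let cellP k : (exists e, cell k = [set w | X w = e]) \/ cell k = set0.
Proof.
have [[w wk]|nw] := pselect (exists w, pickle (X w) = k); [left|right].
  exists (X w); apply/seteqP; split => v; rewrite /cell/= -wk; last by move=> ->.
  exact: (pcan_inj pickleK).
by rewrite -subset0 => w wk; apply: nw; exists w.
Qed.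

Let measurable_cell k : measurable (cell k).
Proof. by case: (cellP k) => [[e ->]|->]. Qed.

Let trivIset_cell : trivIset setT cell.
Proof.
apply/trivIsetP => /= i j _ _ ij; rewrite -subset0 => w [/= wi wj].
by move/eqP: ij; apply; rewrite -wi -wj.
Qed.

Let bigcup_cell : [set: T] = \bigcup_k cell k.
Proof. by apply/seteqP; split => // w _; exists (pickle (X w)). Qed.

Lemma eq_countable_partition (B C : set T) (M : R) :
  0 <= M -> measurable B -> measurable C ->
  (forall e, P (B `&` [set w | X w = e]) = (M%:E * P (C `&` [set w | X w = e]))%E) ->
  P B = (M%:E * P C)%E.
Proof.
move=> M0 mB mC BC.
have PF G : measurable G -> P G = (\sum_(k <oo) P (G `&` cell k))%E.
  move=> mG; rewrite -[in LHS](setIT G) bigcup_cell setI_bigcupr.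
  rewrite measure_bigcup//=; last first.
    by apply: trivIset_setIl; exact: trivIset_cell.
  - by move=> k _; exact: measurableI.
  - by apply: eq_eseriesl => k; rewrite in_setT.
rewrite PF// (PF C)// -nneseriesZl; last by move=> k _; exact: measure_ge0.
apply: eq_eseriesr => k _; case: (cellP k) => [[e ->]//|->].
by rewrite !setI0 measure0 mule0.
Qed.

Lemma ge0_integral_countable_partition (f g : T -> \bar R) :
  measurable_fun setT f -> measurable_fun setT g ->
  (forall w, 0 <= f w)%E -> (forall w, 0 <= g w)%E ->
  (forall e, \int[P]_(w in [set w | X w = e]) f w =
             \int[P]_(w in [set w | X w = e]) g w)%E ->
  (\int[P]_w f w = \int[P]_w g w)%E.
Proof.
move=> mf mg f0 g0 fg.
rewrite bigcup_cell !ge0_integral_bigcup -?bigcup_cell//.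
apply: eq_eseriesr => k _; case: (cellP k) => [[e ->]//|->].
by rewrite !integral_set0.
Qed.

Lemma measurable_mem_seq (s : seq E) : measurable [set w | X w \in s].
Proof.
rewrite (_ : [set w | _] = \bigcup_(e in [set` s]) [set w | X w = e]).
  by apply: fin_bigcup_measurable.
by apply/seteqP; split => w /=; [exists (X w)|move=> [f fs /= ->]].
Qed.

Let setI_mem_cons (B : set T) e s : B `&` [set w | X w \in e :: s] =
  (B `&` [set w | X w = e]) `|` (B `&` [set w | X w \in s]).
Proof.
rewrite -setIUr; congr (_ `&` _); apply/seteqP; split => w /=; rewrite inE.
  by case/predU1P; [left|right].
by case=> [->|->]; rewrite ?eqxx ?orbT.
Qed.

Let disjoint_mem_cons (B : set T) e (s : seq E) : e \notin s ->
  (B `&` [set w | X w = e]) `&` (B `&` [set w | X w \in s]) = set0.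
Proof.
by move=> es; rewrite -subset0 => w [[_ /= we] [_ /= ws]]; move: es; rewrite -we ws.
Qed.

Lemma measure_seq_partition (B : set T) (s : seq E) : measurable B -> uniq s ->
  P (B `&` [set w | X w \in s]) = (\sum_(e <- s) P (B `&` [set w | X w = e]))%E.
Proof.
move=> mB; elim: s => [|e s IH] /=.
  move=> _; rewrite big_nil (_ : _ `&` _ = set0) ?measure0//.
  by rewrite -subset0 => w [].
move=> /andP[es us]; rewrite big_cons -IH// setI_mem_cons measureU//.
- exact: measurableI.
- by apply: measurableI => //; exact: measurable_mem_seq.
- exact: disjoint_mem_cons.
Qed.

Lemma ge0_integral_seq_partition (B : set T) (f : T -> \bar R) (s : seq E) :
  measurable B -> measurable_fun setT f -> (forall w, 0 <= f w)%E -> uniq s ->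
  (\int[P]_(w in B `&` [set w | X w \in s]) f w =
   \sum_(e <- s) \int[P]_(w in B `&` [set w | X w = e]) f w)%E.
Proof.
move=> mB mf f0; elim: s => [|e s IH] /=.
  move=> _; rewrite big_nil (_ : _ `&` _ = set0) ?integral_set0//.
  by rewrite -subset0 => w [].
move=> /andP[es us]; rewrite big_cons -IH// setI_mem_cons ge0_integral_setU//.
- exact: measurableI.
- by apply: measurableI => //; exact: measurable_mem_seq.
- exact: measurable_funTS.
- by apply/eqP/disjoint_mem_cons.
Qed.

Lemma eq_measure_null (B C N : set T) : measurable B -> measurable C ->
  measurable N -> P N = 0%E -> C `<=` B -> B `\` C `<=` N -> P B = P C.
Proof.
move=> mB mC mN N0 CB BCN.
rewrite -(setDUK CB) measureU//.
- rewrite [X in (_ + X)%E](_ : _ = 0%E) ?adde0//.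
  by apply: subset_measure0 BCN N0 => //; exact: measurableD.
- exact: measurableD.
- by rewrite setIDA setIC -setIDA setDv setI0.
Qed.

End CountablePartition.

Lemma integral_law_on {R : realType} {d d'} {T : measurableType d}
    {U : measurableType d'} (P : probability T R) (H : set T) (g : T -> U)
    (mH : measurable H) (mg : measurable_fun setT g) (F : U -> \bar R) :
  measurable_fun setT F -> (forall y, 0 <= F y)%E ->
  (\int[P]_(w in H) F (g w) = \int[law_on P mH mg]_y F y)%E.
Proof.
move=> mF F0; rewrite -(@weighted_transfer _ _ _ _ _ P _ (\1_H : T -> R) g)//.
- rewrite [LHS]integral_mkcond; apply: eq_integral => w _; rewrite patchE indicE.
  by case: (w \in H); rewrite ?mul1e ?mul0e.
- move=> X mX; transitivity (\int[P]_w (\1_(H `&` g @^-1` X) w)%:E)%E.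
    by apply: eq_integral => w _; rewrite indicI/= !indicE; congr (_ * _)%:E; congr (_%:R); apply/idP/idP; rewrite !inE.
  rewrite integral_indic ?setIT//.
  by apply: measurableI => //; rewrite -[X in measurable X]setTI; exact: mg.
Qed.

Lemma product_mscale {R : realType} {d1 d2} {T1 : measurableType d1}
    {T2 : measurableType d2} (m1 : {measure set T1 -> \bar R})
    (m2 : {sigma_finite_measure set T2 -> \bar R}) (r : {nonneg R}) X :
  measurable X ->
  (mscale r m1 \x m2)%E X = (r%:num%:E * (m1 \x m2) X)%E.
Proof.
move=> mX; rewrite /product_measure1 ge0_integral_mscale//.
exact: measurable_fun_xsection.
Qed.

Section JumpProcess.
Context {R : realType} {d} {T : measurableType d} (P : probability T R).
Context {E : countType} (q : E -> R) (p : E -> E -> R) (succ : E -> seq E).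
Hypotheses (q_gt0 : forall e, 0 < q e) (p_ge0 : forall e f, 0 <= p e f)
  (succ_uniq : forall e, uniq (succ e))
  (p_sum : forall e, \sum_(f <- succ e) p e f = 1).
Variables (Y : nat -> T -> E) (S : nat -> T -> R) (e0 : E).
Hypotheses (mY : forall n e, measurable [set w | Y n w = e])
  (mS : forall n, measurable_fun setT (S n)).
Hypothesis law : forall (n : nat) (e : nat -> E) (t : nat -> R),
  (forall m, 0 <= t m) ->
  P [set w | forall m, (m <= n)%N -> Y m w = e m /\ t m < S m w] =
  ((e 0%N == e0)%:R * (\prod_(m < n) p (e m) (e m.+1)) *
   (\prod_(m < n.+1) expR (- q (e m) * t m)))%:E.

Definition future n k (e : nat -> E) (t : nat -> R) :=
  [set w | forall i, (i <= k)%N -> Y (n + i) w = e i /\ t i < S (n + i) w].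

Definition future_weight k (e : nat -> E) (t : nat -> R) : R :=
  (\prod_(i < k) p (e i) (e i.+1)) * \prod_(i < k.+1) expR (- q (e i) * t i).

Lemma future_weight_ge0 k e t : 0 <= future_weight k e t.
Proof.
by rewrite mulr_ge0//; apply: prodr_ge0 => i _; rewrite ?expR_ge0.
Qed.

Lemma measurable_gtS n t : measurable [set w | t < S n w].
Proof.
rewrite (_ : [set w | _] = S n @^-1` `]t, +oo[); last first.
  by apply/seteqP; split => w; rewrite /= in_itv/= andbT.
by rewrite -[X in measurable X]setTI; apply: mS.
Qed.

Lemma measurable_future n k e t : measurable (future n k e t).
Proof.
rewrite (_ : future _ _ _ _ = \bigcap_(i in [set i | (i <= k)%N])
   ([set w | Y (n + i) w = e i] `&` [set w | t i < S (n + i) w])) //.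
apply: bigcap_measurable; first by exists 0%N.
by move=> i _; apply: measurableI => //; exact: measurable_gtS.
Qed.

Lemma initial_state e : P [set w | Y 0 w = e] = (e == e0)%:R%:E.
Proof.
have P0 : P [set w | Y 0 w = e0] = 1%E.
  apply/eqP; rewrite eq_le probability_le1//=.
  have := @law 0%N (fun=> e0) (fun=> 0) (fun=> lexx _).
  rewrite eqxx big_ord0 big_ord1 mulr0 expR0 !mulr1 => <-.
  apply: le_measure; rewrite ?inE//; last by move=> w /(_ 0%N isT) [].
  exact: (@measurable_future 0 0 (fun=> e0) (fun=> 0)).
have [->//|ee0] := eqVneq e e0.
apply: (@subset_measure0 _ _ _ _ _ (~` [set w | Y 0 w = e0])) => //.
- exact: measurableC.
- by move=> w /= we we0; move/eqP: ee0; rewrite -we -we0.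
- by have := probability_setC P (mY 0 e0); rewrite P0 subee.
Qed.

Context {d'} {Z : measurableType d'} (z0 : Z) (step : E -> Z -> R -> Z).
Hypothesis mstep : forall e, measurable_fun setT (fun zt : Z * R => step e zt.1 zt.2).

(** [state n] accumulates a functional of the first [n] sojourns. Keeping it arbitrary
    lets one Markov property serve levels, discounts and jump times alike. *)
Fixpoint state n w : Z :=
  if n is m.+1 then step (Y m w) (state m w) (S m w) else z0.

Lemma measurable_state n : measurable_fun setT (state n).
Proof.
elim: n => [|n IH] /=; first exact: measurable_cst.
apply: (measurable_countable_cases (g := fun e w => step e (state n w) (S n w))) => // e.
exact: (measurableT_comp (mstep e) (measurable_fun_pair IH (mS n))).
Qed.

(** Given the current phase, the phases and holding times from the [n]-th sojourn on
    are independent of the accumulated past. *)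
Definition markov_at n := forall A, measurable A -> forall k e t,
  (forall i, 0 <= t i) ->
  P (state n @^-1` A `&` future n k e t) =
  ((future_weight k e t)%:E * P (state n @^-1` A `&` [set w | Y n w = e 0%N]))%E.

Lemma markov_at0 : markov_at 0.
Proof.
move=> A mA k e t t0.
have [Az0|Az0] := pselect (A z0); last first.
  rewrite (_ : state 0 @^-1` A = set0) ?set0I ?measure0 ?mule0//.
  by rewrite -subset0.
rewrite (_ : state 0 @^-1` A = setT) ?setTI; last by apply/seteqP; split.
rewrite initial_state -EFinM; transitivity (P [set w | forall m, (m <= k)%N ->
    Y m w = e m /\ t m < S m w]); first by [].
by rewrite law// -mulrA mulrC.
Qed.

Let mpre n A : measurable A -> measurable (state n @^-1` A).
Proof. by move=> mA; rewrite -[X in measurable X]setTI; apply: measurable_state. Qed.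

Definition state_law n e := law_on P (mY n e) (measurable_state n).

Definition step_event n e k e' t' :=
  [set w | Y n w = e] `&` [set w | 0 < S n w] `&` future n.+1 k e' t'.

Lemma measurable_step_event n e k e' t' : measurable (step_event n e k e' t').
Proof.
apply: measurableI; last exact: measurable_future.
by apply: measurableI => //; exact: measurable_gtS.
Qed.

Lemma measurable_state_S n : measurable_fun setT (fun w => (state n w, S n w)).
Proof. by apply: measurable_fun_pair => //; exact: measurable_state. Qed.

Definition step_weight e k e' t' := p e (e' 0%N) * future_weight k e' t'.

Lemma step_weight_ge0 e k e' t' : 0 <= step_weight e k e' t'.
Proof. by rewrite mulr_ge0// future_weight_ge0. Qed.

(** On rays for the holding time the claim is the Markov property at [n] with one more
    phase and threshold in front; both sides being finite measures, rays and then
    rectangles determine them. *)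
Lemma joint_law n e k e' t' : markov_at n -> (forall i, 0 <= t' i) ->
  forall X : set (Z * R), measurable X ->
  P (step_event n e k e' t' `&` (fun w => (state n w, S n w)) @^-1` X) =
  (mscale (NngNum (step_weight_ge0 e k e' t')) (state_law n e)
    \x exp_law (q_gt0 e))%E X.
Proof.
move=> markn t'0 X mX; symmetry.
pose m' := law_on P (measurable_step_event n e k e' t') (measurable_state_S n).
apply: (@product_measure_unique _ _ _ _ _ _ _ m') => // A B mA mB.
rewrite /mscale/=.
have mA' : measurable (step_event n e k e' t' `&` state n @^-1` A).
  by apply: measurableI; [exact: measurable_step_event|exact: mpre].
pose r := (step_weight e k e' t' * fine (state_law n e A)).
have r0 : 0 <= r by rewrite mulr_ge0 ?step_weight_ge0 ?fine_ge0.
have nufin : state_law n e A \is a fin_num by exact: fin_num_measure.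
have key : forall B, measurable B -> law_on P mA' (mS n) B =
    mscale (NngNum r0) (exp_law (q_gt0 e)) B.
  apply: measure_eq_rays => [t|t]; last first.
    by rewrite -ge0_fin_numE// fin_num_measure.
  rewrite -[RHS]/(r%:E * exp_law (q_gt0 e) `]t, +oo[)%E exp_law_ray.
  rewrite -[LHS]/(P (_ `&` _)).
  (* The maximum with 0 makes the new threshold admissible; holding times are
     positive on the event, so it changes nothing for negative [t]. *)
  pose e1 i := if i is j.+1 then e' j else e.
  pose t1 i := if i is j.+1 then t' j else Num.max t 0.
  have t10 i : 0 <= t1 i by case: i => [|i] //=; rewrite le_max lexx orbT.
  have -> : step_event n e k e' t' `&` state n @^-1` A `&` S n @^-1` `]t, +oo[ =
      state n @^-1` A `&` future n k.+1 e1 t1.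
    apply/seteqP; split => w.
      move=> [[[[/= Yn Sn] fut] Aw]]; rewrite in_itv/= andbT => tS; split=> //.
      move=> [|i] ik /=; first by rewrite addn0 gt_max tS Sn.
      by rewrite -addSnnS; exact: fut.
    move=> [Aw fut]; have /= := fut 0%N isT; rewrite addn0 gt_max => -[Yn /andP[tS Sn]].
    split; last by rewrite /= in_itv/= andbT.
    split=> //; split=> // i ik; have := fut i.+1 ik.
    by rewrite addSnnS.
  rewrite markn// /state_law/= setIC /e1/=.
  rewrite -[P _]/(state_law n e A) -(fineK nufin) -!EFinM; congr EFin.
  rewrite /r /step_weight /future_weight big_ord_recl/= big_ord_recl/=.
  rewrite (mulrC (_ * future_weight _ _ _)).
  set a := p e _; set b := \prod_(i < k) _; set u := expR _; set v := \prod_(i < k.+1) _.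
  set x := fine _.
  by rewrite /future_weight -/b -/v; ring.
have := key B mB; rewrite /mscale/= /r EFinM fineK// => <-.
by rewrite /m' /law_on/= -setIA; congr (P (_ `&` _)); apply/seteqP; split => w.
Qed.

Lemma step_event_law n e k e' t' : markov_at n -> (forall i, 0 <= t' i) ->
  forall X : set (Z * R), measurable X ->
  P (step_event n e k e' t' `&` (fun w => (state n w, S n w)) @^-1` X) =
  ((step_weight e k e' t')%:E * (state_law n e \x exp_law (q_gt0 e)) X)%E.
Proof. by move=> markn t'0 X mX; rewrite joint_law// product_mscale. Qed.

Definition step1 n e f := step_event n e 0 (fun=> f) (fun=> 0).

Lemma step_weight1 e f : step_weight e 0 (fun=> f) (fun=> 0) = p e f.
Proof.
by rewrite /step_weight /future_weight big_ord0 big_ord1 mulr0 expR0 !mulr1.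
Qed.

Definition regular n := [set w | 0 < S n w /\ 0 < S n.+1 w] `&`
  [set w | Y n.+1 w \in succ (Y n w)].

Lemma measurable_succ n : measurable [set w | Y n.+1 w \in succ (Y n w)].
Proof.
have m : measurable_fun setT (fun w => Y n.+1 w \in succ (Y n w)).
  apply: (measurable_countable_cases (g := fun e w => Y n.+1 w \in succ e)) => // e.
  apply: (measurable_fun_bool true); rewrite setTI.
  exact: (measurable_mem_seq (mY n.+1) (succ e)).
by have := m measurableT [set true] I; rewrite setTI; apply.
Qed.

Lemma measurable_regular n : measurable (regular n).
Proof.
apply: measurableI; last exact: measurable_succ.
by apply: measurableI; exact: measurable_gtS.
Qed.

Lemma step1E n e f : step1 n e f =
  [set w | Y n w = e] `&` [set w | 0 < S n w /\ 0 < S n.+1 w] `&` [set w | Y n.+1 w = f].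
Proof.
apply/seteqP; split => w.
  by move=> [[/= Yn Sn] /(_ 0%N isT)]; rewrite addn0 => -[].
move=> [[/= Yn [Sn Sn1]] Yf]; split=> // i; rewrite leqn0 => /eqP ->.
by rewrite addn0.
Qed.

(** Given the current phase, the listed successors with positive holding times carry
    total mass [\sum_(f <- succ e) p e f = 1]. *)
Lemma regular_ae n : markov_at n -> P (~` regular n) = 0%E.
Proof.
move=> markn; rewrite -[RHS](mule0 1%E) -[X in (_ * X)%E](measure0 P).
apply: (eq_countable_partition (mY n)) => // [|e].
  by apply: measurableC; exact: measurable_regular.
rewrite set0I measure0 mule0.
pose B := [set w | Y n w = e] `&` [set w | 0 < S n w /\ 0 < S n.+1 w].
have mB : measurable B.
  by apply: measurableI => //; apply: measurableI; exact: measurable_gtS.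
have PB : P ([set w | Y n w = e] `&` regular n) = P [set w | Y n w = e].
  rewrite (_ : _ `&` _ = B `&` [set w | Y n.+1 w \in succ e]); last first.
    apply/seteqP; split => w; first by move=> [/= Yn [? ]]; rewrite /= Yn.
    by move=> [[/= Yn ?] ?]; split=> //; split=> //=; rewrite Yn.
  rewrite (measure_seq_partition P (mY n.+1))//.
  transitivity (\sum_(f <- succ e) (p e f)%:E * P [set w | Y n w = e])%E.
    apply: eq_bigr => f _; rewrite -step1E -(setIT (step1 _ _ _)).
    rewrite -(preimage_setT (fun w => (state n w, S n w))) /step1.
    rewrite step_event_law// step_weight1 -setXTT product_measure1E//.
    rewrite [X in (_ * (_ * X))%E](_ : _ = 1%E); last exact: probability_setT.
    rewrite mule1; congr (_ * _)%E.
    by rewrite -[LHS]/(P (_ `&` state n @^-1` setT)) preimage_setT setIT.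
  by rewrite -ge0_sume_distrl ?sumEFin ?p_sum ?mul1e// => f _; rewrite lee_fin.
rewrite setIC -setDE measureD//; last 2 first.
- exact: measurable_regular.
- by rewrite (le_lt_trans (probability_le1 _ _))// ltry.
rewrite [X in (_ - X)%E](_ : _ = P [set w | Y n w = e]); last exact: PB.
by rewrite subee// fin_num_measure.
Qed.

Lemma two_step_law n e f : markov_at n ->
  forall X : set (Z * R), measurable X ->
  P ([set w | Y n w = e] `&` [set w | Y n.+1 w = f] `&`
     (fun w => (state n w, S n w)) @^-1` X) =
  ((p e f)%:E * (state_law n e \x exp_law (q_gt0 e)) X)%E.
Proof.
move=> markn X mX; rewrite -step_weight1 -(@step_event_law n e 0%N)//.
have mX' : measurable ((fun w => (state n w, S n w)) @^-1` X).
  by rewrite -[X in measurable X]setTI; apply: measurable_state_S.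
apply: (@eq_measure_null _ _ _ P _ _ (~` regular n)).
- by apply: measurableI => //; exact: measurableI.
- by apply: measurableI => //; exact: measurable_step_event.
- by apply: measurableC; exact: measurable_regular.
- exact: regular_ae.
- rewrite -/(step1 n e f) step1E => w [[[/= Yn _] Yf] Xw]; by [].
- rewrite -/(step1 n e f) step1E => w [[[/= Yn Yf] Xw]] nw [[Sn Sn1] _].
  by apply: nw.
Qed.

(** On the event that the [n]-th phase is [e], a condition on the next state is a
    condition on the current state and holding time, to which the joint law applies.
    The joint law only sees positive holding times; the rest is a null set. *)
Lemma markov_atS n : markov_at n -> markov_at n.+1.
Proof.
move=> markn A mA k e' t' t'0.
apply: (eq_countable_partition (mY n)) => // [|||e].
- exact: future_weight_ge0.
- by apply: measurableI; [exact: mpre|exact: measurable_future].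
- by apply: measurableI; [exact: mpre|].
pose X : set (Z * R) := (fun zt => step e zt.1 zt.2) @^-1` A.
have mX : measurable X by rewrite -[X]setTI; apply: mstep.
have mX' : measurable ((fun w => (state n w, S n w)) @^-1` X).
  by rewrite -[X in measurable X]setTI; apply: measurable_state_S.
have -> : P (state n.+1 @^-1` A `&` [set w | Y n.+1 w = e' 0%N] `&` [set w | Y n w = e])
    = ((p e (e' 0%N))%:E * (state_law n e \x exp_law (q_gt0 e)) X)%E.
  rewrite -two_step_law//; congr (P _); apply/seteqP; split => w.
    by move=> [[/= Aw Y1] Y0]; rewrite /X/= -Y0.
  by move=> [[/= Y0 Y1] Xw]; move: Xw; rewrite /X/= -Y0.
rewrite muleA -EFinM mulrC -/(step_weight e k e' t') -step_event_law//.
apply: (@eq_measure_null _ _ _ P _ _ (~` regular n)).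
- apply: measurableI => //; apply: measurableI; first exact: mpre.
  exact: measurable_future.
- by apply: measurableI => //; exact: measurable_step_event.
- by apply: measurableC; exact: measurable_regular.
- exact: regular_ae.
- by move=> w [[[/= Yn Sn] fut] Xw]; split=> //; split=> //=; rewrite Yn.
- move=> w [[[/= Aw fut] Yn]] nw [[Sn Sn1] _]; apply: nw; split=> //.
  by rewrite /X/= -Yn.
Qed.

Lemma markov_property n : markov_at n.
Proof. by elim: n => [|n IH]; [exact: markov_at0|exact: markov_atS]. Qed.

Lemma integral_two_step n e f (F : Z * R -> \bar R) :
  measurable_fun setT F -> (forall x, 0 <= F x)%E ->
  (\int[P]_(w in [set w | Y n w = e] `&` [set w | Y n.+1 w = f])
      F (state n w, S n w) =
   (p e f)%:E * \int[P]_(w in [set w | Y n w = e])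
      \int[exp_law (q_gt0 e)]_t F (state n w, t))%E.
Proof.
move=> mF F0.
have mH : measurable ([set w | Y n w = e] `&` [set w | Y n.+1 w = f]) by exact: measurableI.
rewrite (@integral_law_on _ _ _ _ _ P _ (fun w => (state n w, S n w)) mH (measurable_state_S n))//.
rewrite (eq_measure_integral
    (mscale (NngNum (p_ge0 e f)) (state_law n e) \x exp_law (q_gt0 e))%E); last first.
  move=> X mX _; apply: (etrans (two_step_law e f (markov_property n) mX)).
  by symmetry; exact: product_mscale.
rewrite fubini_tonelli1// /fubini_F ge0_integral_mscale//; last 2 first.
- exact: measurable_fun_fubini_tonelli_F.
- by move=> z _; exact: integral_ge0.
congr (_ * _)%E; rewrite (@integral_law_on _ _ _ _ _ P _ (state n) (mY n e)
  (measurable_state n) (fun z => \int[exp_law (q_gt0 e)]_t F (z, t)))%E//.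
- exact: measurable_fun_fubini_tonelli_F.
- by move=> z; exact: integral_ge0.
Qed.

Definition step_mean (F : E -> E -> Z * R -> \bar R) e z : \bar R :=
  (\sum_(f <- succ e) (p e f)%:E *
    \int[lebesgue_measure]_t ((exponential_pdf (q e) t)%:E * F e f (z, t)))%E.

Section OneStep.
Variable F : E -> E -> Z * R -> \bar R.
Hypotheses (mF : forall e f, measurable_fun setT (F e f))
  (F0 : forall e f x, (0 <= F e f x)%E).

Let mF2 e f z : measurable_fun setT (fun t => F e f (z, t)).
Proof. by apply: measurableT_comp => //; exact: measurable_fun_pair. Qed.

Lemma step_meanE e z : step_mean F e z =
  (\sum_(f <- succ e) (p e f)%:E * \int[exp_law (q_gt0 e)]_t F e f (z, t))%E.
Proof. by apply: eq_bigr => f _; rewrite integral_exp_law. Qed.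

Lemma measurable_step_mean e : measurable_fun setT (step_mean F e).
Proof.
rewrite (_ : step_mean F e = fun z => step_mean F e z)//.
under eq_fun do rewrite step_meanE.
apply: emeasurable_sum => f; apply: measurable_funeM.
exact: (measurable_fun_fubini_tonelli_F (m2 := exp_law (q_gt0 e)) (F e f)).
Qed.

Lemma step_mean_ge0 e z : (0 <= step_mean F e z)%E.
Proof.
rewrite step_meanE sume_ge0// => f _; rewrite mule_ge0 ?lee_fin//.
exact: integral_ge0.
Qed.

(** Fubini's theorem for the joint law, on each cell of the current phase and after
    restriction to the successors, which carry all the mass. *)
Lemma integral_step n :
  (\int[P]_w F (Y n w) (Y n.+1 w) (state n w, S n w) =
   \int[P]_w step_mean F (Y n w) (state n w))%E.
Proof.
have m1 e f : measurable_fun setT (fun w => F e f (state n w, S n w)).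
  by apply: measurableT_comp => //; exact: measurable_state_S.
have m1' e : measurable_fun setT (fun w => F e (Y n.+1 w) (state n w, S n w)).
  exact: (measurable_countable_cases (g := fun f w => F e f (state n w, S n w))).
have m2 e : measurable_fun setT (fun w => step_mean F e (state n w)).
  apply: measurableT_comp; [exact: measurable_step_mean|exact: measurable_state].
apply: (ge0_integral_countable_partition (mY n)) => //.
- exact: (measurable_countable_cases
    (g := fun e w => F e (Y n.+1 w) (state n w, S n w))).
- exact: (measurable_countable_cases (g := fun e w => step_mean F e (state n w))).
- by move=> w; exact: step_mean_ge0.
move=> e.
transitivity (\int[P]_(w in [set w | Y n w = e]) F e (Y n.+1 w) (state n w, S n w))%E.
  by apply: eq_integral => w /set_mem/= ->.
transitivity (\int[P]_(w in [set w | Y n w = e] `&` [set w | Y n.+1 w \in succ e])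
    F e (Y n.+1 w) (state n w, S n w))%E.
  rewrite (@ge0_negligible_integral _ _ _ P [set w | Y n w = e] (~` regular n))//; first last.
  - by apply: regular_ae; exact: markov_property.
  - exact: measurable_funTS.
  - by apply: measurableC; exact: measurable_regular.
  have msucc := measurable_mem_seq (mY n.+1) (succ e).
  rewrite [RHS](@ge0_negligible_integral _ _ _ P _ (~` regular n))//; first last.
  - by apply: regular_ae; exact: markov_property.
  - exact: measurable_funTS.
  - exact: measurableI.
  - by apply: measurableC; exact: measurable_regular.
  congr (integral _ _ _); apply/seteqP; split => w.
    by move=> [/= Yn reg]; split=> //; split=> //=; move: reg => /contrapT[_ /=]; rewrite Yn.
  by move=> [[/= Yn _] reg].
rewrite (ge0_integral_seq_partition P (mY n.+1))//.
transitivity (\int[P]_(w in [set w | Y n w = e]) step_mean F e (state n w))%E; last first.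
  by apply: eq_integral => w /set_mem/= ->.
under [RHS]eq_integral do rewrite step_meanE.
rewrite ge0_integral_sum//; last 2 first.
- move=> f; apply: measurable_funeM; apply: measurable_funTS.
  apply: (measurableT_comp (f := fun z => \int[exp_law (q_gt0 e)]_t F e f (z, t))%E).
    exact: (measurable_fun_fubini_tonelli_F (m2 := exp_law (q_gt0 e)) (F e f)).
  exact: measurable_state.
- by move=> f w _; rewrite mule_ge0 ?lee_fin//; exact: integral_ge0.
apply: eq_bigr => f _; rewrite ge0_integralZl//; last 3 first.
- apply: measurable_funTS.
  apply: (measurableT_comp (f := fun z => \int[exp_law (q_gt0 e)]_t F e f (z, t))%E).
    exact: (measurable_fun_fubini_tonelli_F (m2 := exp_law (q_gt0 e)) (F e f)).
  exact: measurable_state.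
- by move=> w _; exact: integral_ge0.
- by rewrite lee_fin.
rewrite -integral_two_step//.
by apply: eq_integral => w /set_mem[_ /= ->].
Qed.

End OneStep.

End JumpProcess.

(** * Expectations of multiplicative functionals of the path *)

Lemma measurable_fun2 {d1 d2 d3 d4} {T : measurableType d1} {U : measurableType d2}
    {V : measurableType d3} {X : measurableType d4} (f : U -> V -> X)
    (a : T -> U) (b : T -> V) :
  measurable_fun setT (fun uv : U * V => f uv.1 uv.2) ->
  measurable_fun setT a -> measurable_fun setT b ->
  measurable_fun setT (fun w => f (a w) (b w)).
Proof.
by move=> mf ma mb; exact: (measurableT_comp mf (measurable_fun_pair ma mb)).
Qed.

Section FeynmanKac.
Context {R : realType} {d} {T : measurableType d} (P : probability T R).
Context {E : countType} (q : E -> R) (p : E -> E -> R) (succ : E -> seq E).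
Hypotheses (q_gt0 : forall e, 0 < q e) (p_ge0 : forall e f, 0 <= p e f)
  (succ_uniq : forall e, uniq (succ e))
  (p_sum : forall e, \sum_(f <- succ e) p e f = 1).
Variables (Y : nat -> T -> E) (S : nat -> T -> R) (e0 : E).
Hypotheses (mY : forall n e, measurable [set w | Y n w = e])
  (mS : forall n, measurable_fun setT (S n)).
Hypothesis law : forall (n : nat) (e : nat -> E) (t : nat -> R),
  (forall m, 0 <= t m) ->
  P [set w | forall m, (m <= n)%N -> Y m w = e m /\ t m < S m w] =
  ((e 0%N == e0)%:R * (\prod_(m < n) p (e m) (e m.+1)) *
   (\prod_(m < n.+1) expR (- q (e m) * t m)))%:E.

Variables (W : E -> R -> R -> R) (slope : E -> R) (x0 : R).
Hypotheses (W0 : forall e x t, 0 <= W e x t)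
  (mW : forall e, measurable_fun setT (fun xt : R * R => W e xt.1 xt.2)).

Let wstep (e : E) (z : R * R) (t : R) : R * R :=
  (z.1 * W e z.2 t, z.2 + slope e * t).

Definition weighted_state n w := state (Z := (R * R)%type) Y S (1, x0) wstep n w.
Definition path_weight n w := (weighted_state n w).1.
Definition path_level n w := (weighted_state n w).2.

Lemma path_weightS n w : path_weight n.+1 w =
  path_weight n w * W (Y n w) (path_level n w) (S n w).
Proof. by []. Qed.

Lemma path_levelS n w :
  path_level n.+1 w = path_level n w + slope (Y n w) * S n w.
Proof. by []. Qed.

Lemma path_weight_ge0 n w : 0 <= path_weight n w.
Proof. by elim: n => [|n IH]; [exact: ler01|rewrite path_weightS mulr_ge0]. Qed.

(** The operator that averages over one sojourn in [e], of duration [t], and the jump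
    that ends it, starting from level [x]. *)
Definition renewal (g : E -> R -> \bar R) e x : \bar R :=
  (\sum_(f <- succ e) (p e f)%:E * \int[lebesgue_measure]_t
     ((exponential_pdf (q e) t)%:E * ((W e x t)%:E * g f (x + slope e * t)%R)))%E.

Definition sojourn_mean (F : E -> R -> R -> \bar R) e x : \bar R :=
  (\int[lebesgue_measure]_t ((exponential_pdf (q e) t)%:E * F e x t))%E.

Let mwstep e : measurable_fun setT (fun zt : (R * R) * R => wstep e zt.1 zt.2).
Proof.
apply: measurable_fun_pair; last first.
  apply: measurable_funD; first exact: measurableT_comp measurable_snd measurable_fst.
  by apply: measurable_funM => //; exact: measurable_snd.
apply: measurable_funM; first exact: measurableT_comp measurable_fst measurable_fst.
apply: (measurable_fun2 (mW e)); last exact: measurable_snd.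
exact: measurableT_comp measurable_snd measurable_fst.
Qed.

Lemma measurable_weighted_state n : measurable_fun setT (weighted_state n).
Proof. exact: (measurable_state mY mS _ mwstep). Qed.

Lemma measurable_path_level n : measurable_fun setT (path_level n).
Proof. exact: (measurableT_comp measurable_snd (measurable_weighted_state n)). Qed.

Lemma measurable_path_weight n : measurable_fun setT (path_weight n).
Proof. exact: (measurableT_comp measurable_fst (measurable_weighted_state n)). Qed.

Let mpdf e : measurable_fun setT (fun t : R => (exponential_pdf (q e) t)%:E).
Proof. by apply/measurable_EFinP; exact: measurable_exponential_pdf. Qed.

Let pdf0 e t : (0 <= (exponential_pdf (q e) t)%:E)%E.
Proof. by rewrite lee_fin exponential_pdf_ge0// ltW. Qed.

Lemma measurable_sojourn_mean F e :
  measurable_fun setT (fun xt : R * R => F e xt.1 xt.2) ->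
  (forall x t, 0 <= F e x t)%E ->
  measurable_fun setT (sojourn_mean F e).
Proof.
move=> mF F0; pose G (xt : R * R) := ((exponential_pdf (q e) xt.2)%:E * F e xt.1 xt.2)%E.
apply: (measurable_fun_fubini_tonelli_F (m2 := lebesgue_measure) G).
- by apply: emeasurable_funM => //; exact: measurableT_comp (mpdf e) measurable_snd.
- by move=> xt; rewrite mule_ge0.
Qed.

Lemma sojourn_mean_ge0 F e x : (forall t, 0 <= F e x t)%E ->
  (0 <= sojourn_mean F e x)%E.
Proof. by move=> F0; apply: integral_ge0 => t _; rewrite mule_ge0. Qed.

(** The state carries the weight and the level. The weight is taken in absolute value
    in [F], which has to be nonnegative at every point of the state space and not only
    at those visited by the path. *)
Lemma integral_renewal n (g : E -> R -> \bar R) :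
  (forall e, measurable_fun setT (g e)) -> (forall e x, 0 <= g e x)%E ->
  (\int[P]_w ((path_weight n.+1 w)%:E * g (Y n.+1 w) (path_level n.+1 w)) =
   \int[P]_w ((path_weight n w)%:E * renewal g (Y n w) (path_level n w)))%E.
Proof.
move=> mg g0.
pose F (e f : E) (zt : (R * R) * R) : \bar R :=
  ((`|zt.1.1|)%:E * ((W e zt.1.2 zt.2)%:E * g f (zt.1.2 + slope e * zt.2)%R))%E.
have mF e f : measurable_fun setT (F e f).
  apply: emeasurable_funM.
    apply/measurable_EFinP; apply: measurableT_comp => //.
    exact: measurableT_comp measurable_fst measurable_fst.
  apply: emeasurable_funM.
    apply/measurable_EFinP; apply: (measurable_fun2 (mW e)); last exact: measurable_snd.
    exact: measurableT_comp measurable_snd measurable_fst.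
  apply: (measurableT_comp (mg f)).
  apply: measurable_funD; first exact: measurableT_comp measurable_snd measurable_fst.
  by apply: measurable_funM => //; exact: measurable_snd.
have F0 e f zt : (0 <= F e f zt)%E by rewrite !mule_ge0 ?lee_fin.
have := integral_step (Z := (R * R)%type) q_gt0 p_ge0 succ_uniq p_sum mY mS law (1, x0) mwstep mF F0 n.
rewrite -/(weighted_state n) => H.
transitivity (\int[P]_w F (Y n w) (Y n.+1 w) (weighted_state n w, S n w))%E.
  apply: eq_integral => w _; rewrite /F/= path_weightS EFinM -muleA path_levelS.
  by rewrite -/(path_weight n w) ger0_norm ?path_weight_ge0.
rewrite H; apply: eq_integral => w _.
rewrite /step_mean /renewal ge0_sume_distrr; last first.
  move=> f _; rewrite mule_ge0 ?lee_fin//; apply: integral_ge0 => t _.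
  by rewrite !mule_ge0 ?lee_fin// exponential_pdf_ge0// ltW.
apply: eq_bigr => f _; rewrite muleCA; congr (_ * _)%E.
rewrite -ge0_integralZl//; last 3 first.
- apply: emeasurable_funM; first exact: mpdf.
  apply: emeasurable_funM.
    apply/measurable_EFinP; exact: (measurable_fun2 (mW (Y n w))).
  by apply: (measurableT_comp (mg f)); apply: measurable_funD.
- by move=> t _; rewrite !mule_ge0 ?lee_fin// exponential_pdf_ge0// ltW.
- by rewrite lee_fin path_weight_ge0.
apply: eq_integral => t _; rewrite /F/= muleCA ger0_norm//.
exact: path_weight_ge0.
Qed.

Lemma measurable_renewal (g : E -> R -> \bar R) e :
  (forall e, measurable_fun setT (g e)) -> (forall e x, 0 <= g e x)%E ->
  measurable_fun setT (renewal g e).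
Proof.
move=> mg g0; apply: emeasurable_sum => f; apply: measurable_funeM.
apply: (@measurable_sojourn_mean
  (fun e x t => (W e x t)%:E * g f (x + slope e * t)%R)%E e).
- apply: emeasurable_funM; first exact/measurable_EFinP.
  apply: (measurableT_comp (mg f)); apply: measurable_funD; first exact: measurable_fst.
  by apply: measurable_funM => //; exact: measurable_snd.
- by move=> x t; rewrite mule_ge0 ?lee_fin.
Qed.

Lemma renewal_ge0 (g : E -> R -> \bar R) e x :
  (forall e x, 0 <= g e x)%E -> (0 <= renewal g e x)%E.
Proof.
move=> g0; rewrite /renewal sume_ge0// => f _; rewrite mule_ge0 ?lee_fin//.
by apply: integral_ge0 => t _; rewrite !mule_ge0 ?lee_fin// exponential_pdf_ge0// ltW.
Qed.

(** A Feynman-Kac formula: conditioning on the past removes the last sojourn and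
    applies [renewal] once. *)
Lemma integral_path_weight n (g : E -> R -> \bar R) :
  (forall e, measurable_fun setT (g e)) -> (forall e x, 0 <= g e x)%E ->
  (\int[P]_w ((path_weight n w)%:E * g (Y n w) (path_level n w)) =
   iter n renewal g e0 x0)%E.
Proof.
elim: n g => [|n IH] g mg g0; last first.
  rewrite integral_renewal// IH ?iterSr//; last by move=> *; exact: renewal_ge0.
  by move=> e; exact: measurable_renewal.
transitivity (\int[P]_w g e0 x0)%E; last first.
  rewrite integral_cst//= [X in (_ * X)%E](_ : _ = 1%E) ?mule1//.
  exact: probability_setT.
apply: ge0_ae_eq_integral => //.
- apply: emeasurable_funM; first by apply/measurable_EFinP; exact: measurable_path_weight.
  apply: (measurable_countable_cases (g := fun e w => g e (path_level 0 w))) => // e.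
  exact: (measurableT_comp (mg e) (measurable_path_level 0)).
- by move=> w _; rewrite mule_ge0// lee_fin path_weight_ge0.
exists (~` [set w | Y 0 w = e0]); split.
- exact: measurableC.
- have := probability_setC P (mY 0 e0); rewrite (initial_state mY mS law) eqxx.
  by rewrite subee.
- move=> w /= nw Y0; apply: nw => _.
  by rewrite Y0 /path_weight /path_level/= mul1e.
Qed.

Lemma integral_path_sojourn n (F : E -> R -> R -> \bar R) :
  (forall e, measurable_fun setT (fun xt : R * R => F e xt.1 xt.2)) ->
  (forall e x t, 0 <= F e x t)%E ->
  (\int[P]_w ((path_weight n w)%:E * F (Y n w) (path_level n w) (S n w)) =
   iter n renewal (sojourn_mean F) e0 x0)%E.
Proof.
move=> mF F0.
rewrite -integral_path_weight; last 2 first.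
- by move=> e; exact: measurable_sojourn_mean.
- by move=> e x; exact: sojourn_mean_ge0.
pose G (e f : E) (zt : (R * R) * R) : \bar R :=
  ((`|zt.1.1|)%:E * F e zt.1.2 zt.2)%E.
have mG e f : measurable_fun setT (G e f).
  apply: emeasurable_funM.
    apply/measurable_EFinP; apply: measurableT_comp => //.
    exact: measurableT_comp measurable_fst measurable_fst.
  apply: (measurable_fun2 (mF e)); last exact: measurable_snd.
  exact: measurableT_comp measurable_snd measurable_fst.
have G0 e f zt : (0 <= G e f zt)%E by rewrite mule_ge0 ?lee_fin.
have := integral_step (Z := (R * R)%type) q_gt0 p_ge0 succ_uniq p_sum mY mS law (1, x0) mwstep mG G0 n.
rewrite -/(weighted_state n) => H.
transitivity (\int[P]_w G (Y n w) (Y n.+1 w) (weighted_state n w, S n w))%E.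
  apply: eq_integral => w _; rewrite /G/= -/(path_weight n w).
  by rewrite ger0_norm ?path_weight_ge0.
rewrite H; apply: eq_integral => w _.
rewrite /step_mean (eq_bigr (fun f => (p (Y n w) f)%:E * \int[lebesgue_measure]_t
  ((exponential_pdf (q (Y n w)) t)%:E * G (Y n w) e0 (weighted_state n w, t)))%E)//.
rewrite -ge0_sume_distrl; last by move=> f _; rewrite lee_fin.
rewrite sumEFin p_sum mul1e /sojourn_mean -ge0_integralZl//; last 3 first.
- by apply: emeasurable_funM; [exact: mpdf|exact: (measurable_fun2 (mF (Y n w)))].
- by move=> t _; rewrite mule_ge0.
- by rewrite lee_fin path_weight_ge0.
apply: eq_integral => t _; rewrite /G/= muleCA ger0_norm//.
exact: path_weight_ge0.
Qed.

End FeynmanKac.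

(** * The jump chain of the fluid flow *)

Section FluidGenerator.
Context {R : realType} (s : nat -> nat).
Variables (A : forall k, 'M[R]_(s k)) (D : forall k, 'M[R]_(s k, s k.+1)).
Variable (lambda : R).
Hypotheses (lambda_gt0 : 0 < lambda)
  (A_offdiag : forall k i j, i != j -> 0 <= A k i j)
  (D_ge0 : forall k i j, 0 <= D k i j)
  (AD_rowsum : forall k,
      A k *m const_mx 1 + D k *m const_mx 1 = 0 :> 'cV[R]_(s k))
  (A_unit : forall k, A k \in unitmx).

Local Notation Q := (fluid_generator lambda A D).

Lemma generator_up_down k (i j : 'I_(s k)) :
  Q (phase_up i) (phase_down j) = (i == j)%:R * lambda.
Proof.
rewrite /fluid_generator/= /diag_block eqxx conform_mx_id mxE mulr_natl.
by case: (i == j).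
Qed.

Lemma generator_up_up k (i j : 'I_(s k)) :
  Q (phase_up i) (phase_up j) = - (i == j)%:R * lambda.
Proof.
rewrite /fluid_generator/= /diag_block eqxx conform_mx_id mxE mulNr mulr_natl.
by case: (i == j); rewrite ?oppr0.
Qed.

Lemma generator_down_down k (i j : 'I_(s k)) :
  Q (phase_down i) (phase_down j) = A k i j.
Proof. by rewrite /fluid_generator/= /diag_block eqxx conform_mx_id. Qed.

Lemma generator_down_up k (i : 'I_(s k)) (j : 'I_(s k.+1)) :
  Q (phase_down i) (phase_up j) = D k i j.
Proof. by rewrite /fluid_generator/= /superdiag_block eqxx conform_mx_id. Qed.

Lemma phase_cases (e : phase s) :
  (exists k (i : 'I_(s k)), e = phase_up i) \/ (exists k (i : 'I_(s k)), e = phase_down i).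
Proof. by case: e => -[] [k i]; [left|right]; exists k, i. Qed.

Lemma phase_down_inj k : injective (@phase_down s k).
Proof. by move=> i j /eqP; rewrite -pair_eqE/= eq_Tagged/= => /eqP. Qed.

Lemma phase_up_inj k : injective (@phase_up s k).
Proof. by move=> i j /eqP; rewrite -pair_eqE/= eq_Tagged/= => /eqP. Qed.

Lemma exit_rate_up k (i : 'I_(s k)) : exit_rate Q (phase_up i) = lambda.
Proof. by rewrite /exit_rate generator_up_up eqxx mulN1r opprK. Qed.

Lemma exit_rate_down k (i : 'I_(s k)) : exit_rate Q (phase_down i) = - A k i i.
Proof. by rewrite /exit_rate generator_down_down. Qed.

Lemma row_sum_block k i :
  - A k i i = \sum_(j | j != i) A k i j + \sum_j D k i j.
Proof.
have /matrixP/(_ i 0) := AD_rowsum k; rewrite !mxE.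
under eq_bigr do rewrite mxE mulr1; under [X in _ + X]eq_bigr do rewrite mxE mulr1.
rewrite (bigD1 i)//= -addrA => /eqP; rewrite addrC addr_eq0 => /eqP ->.
by [].
Qed.

(** A zero exit rate would make a whole row of the invertible block zero. *)
Lemma exit_rate_gt0 e : 0 < exit_rate Q e.
Proof.
case: (phase_cases e) => [[k [i ->]]|[k [i ->]]]; first by rewrite exit_rate_up.
rewrite exit_rate_down lt_neqAle; apply/andP; split; last first.
  by rewrite row_sum_block addr_ge0// sumr_ge0// => j ij; rewrite A_offdiag// eq_sym.
apply/negP => /eqP e0.
have Aj j : A k i j = 0.
  have [<-|ji] := eqVneq i j; first by apply/eqP; rewrite -oppr_eq0 -e0.
  have : \sum_(j | j != i) A k i j = 0.
    apply/eqP; rewrite eq_le; apply/andP; split.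
      rewrite -[leRHS]/(0 : R) [leRHS]e0 row_sum_block lerDl.
      by rewrite sumr_ge0.
    by apply: sumr_ge0 => l li; rewrite A_offdiag// eq_sym.
  move/psumr_eq0P => -> //; last by rewrite eq_sym.
  by move=> l li; rewrite A_offdiag// eq_sym.
have := congr1 (fun M : 'M[R]_(s k) => M i i) (mulmxV (A_unit k)).
rewrite !mxE eqxx big1 => [/eqP|l _]; first by rewrite eq_sym oner_eq0.
by rewrite Aj mul0r.
Qed.

Definition successors (e : phase s) : seq (phase s) :=
  let: (up, u) := e in
  if up then [:: phase_down (tagged u)]
  else [seq phase_down j | j <- enum 'I_(s (tag u)) & j != tagged u] ++
       [seq phase_up j | j <- enum 'I_(s (tag u).+1)].

Lemma successors_uniq e : uniq (successors e).
Proof.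
case: (phase_cases e) => [[k [i ->]]//|[k [i ->]]] /=.
rewrite cat_uniq; apply/and3P; split.
- by rewrite (map_inj_uniq (@phase_down_inj k)) filter_uniq// enum_uniq.
- by apply/hasPn => f /mapP[j _ ->]; apply/negP => /mapP[j' _ /eqP].
- by rewrite (map_inj_uniq (@phase_up_inj k.+1)) enum_uniq.
Qed.

Lemma sum_successors_down (V : nmodType) k (i : 'I_(s k)) (F : phase s -> V) :
  \sum_(f <- successors (phase_down i)) F f =
  \sum_(j | j != i) F (phase_down j) + \sum_j F (phase_up (j : 'I_(s k.+1))).
Proof.
rewrite big_cat/= !big_map big_filter_cond/= !big_enum_cond/=.
by congr (_ + _); apply: eq_bigl => j; rewrite andbT.
Qed.

Lemma sum_successors_up (V : nmodType) k (i : 'I_(s k)) (F : phase s -> V) :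
  \sum_(f <- successors (phase_up i)) F f = F (phase_down i).
Proof. by rewrite big_seq1. Qed.

Local Notation jp := (jump_probability Q).

Lemma jump_up k (i : 'I_(s k)) : jp (phase_up i) (phase_down i) = 1.
Proof.
by rewrite /jump_probability /= generator_up_down exit_rate_up eqxx mul1r divff// lt0r_neq0.
Qed.

Lemma jump_down_down k (i j : 'I_(s k)) : j != i ->
  jp (phase_down i) (phase_down j) = A k i j / exit_rate Q (phase_down i).
Proof.
move=> ji; rewrite /jump_probability generator_down_down.
by rewrite (inj_eq (@phase_down_inj k)) eq_sym (negbTE ji).
Qed.

Lemma jump_down_up k (i : 'I_(s k)) (j : 'I_(s k.+1)) :
  jp (phase_down i) (phase_up j) = D k i j / exit_rate Q (phase_down i).
Proof. by rewrite /jump_probability generator_down_up. Qed.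

(** Multiplied by the exit rate, the average over the jumps out of a descending phase
    is the action of the generator, up to the diagonal term. *)
Lemma jump_mean_down k (i : 'I_(s k)) (g : phase s -> R) :
  exit_rate Q (phase_down i) * (\sum_(f <- successors (phase_down i)) jp (phase_down i) f * g f) =
  exit_rate Q (phase_down i) * g (phase_down i) +
  (\sum_j A k i j * g (phase_down j) + \sum_j D k i j * g (phase_up j)).
Proof.
have q0 : exit_rate Q (phase_down i) != 0 by rewrite lt0r_neq0// exit_rate_gt0.
rewrite sum_successors_down mulrDr !mulr_sumr addrA; congr (_ + _).
  rewrite [in RHS](bigD1 i)//= exit_rate_down addrA mulNr addNr add0r.
  apply: eq_bigr => j ji; rewrite jump_down_down// exit_rate_down mulrA mulrCA.
  by rewrite divff ?mulr1// -exit_rate_down.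
apply: eq_bigr => j _; rewrite jump_down_up mulrA mulrCA divff ?mulr1//.
Qed.

Lemma jump_ge0 e f : 0 <= jp e f.
Proof.
rewrite /jump_probability; case: eqP => // /eqP ef.
apply: divr_ge0; last exact/ltW/exit_rate_gt0.
case: e f ef => [[] [k i]] [[] [l j]] ef; rewrite /fluid_generator/=.
- rewrite /diag_block; case: eqP => [kl|]; last by rewrite mxE.
  subst l; rewrite conform_mx_id mxE; case: (i =P j) => [ij|//].
  by move: ef; rewrite ij eqxx.
- rewrite /diag_block; case: eqP => [kl|]; last by rewrite mxE.
  by subst l; rewrite conform_mx_id mxE mulrn_wge0// ltW.
- rewrite /superdiag_block; case: eqP => [kl|]; last by rewrite mxE.
  by subst l; rewrite conform_mx_id.
- rewrite /diag_block; case: eqP => [kl|]; last by rewrite mxE.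
  subst l; rewrite conform_mx_id; apply: A_offdiag.
  by apply: contra ef => /eqP ->.
Qed.

(** The row sums of the generator vanish. *)
Lemma jump_sum e : \sum_(f <- successors e) jp e f = 1.
Proof.
case: (phase_cases e) => [[k [i ->]]|[k [i ->]]].
  by rewrite sum_successors_up jump_up.
have q0 : exit_rate Q (phase_down i) != 0 by rewrite lt0r_neq0// exit_rate_gt0.
apply: (mulfI q0); rewrite mulr1.
have := jump_mean_down i (fun=> 1).
under eq_bigr do rewrite mulr1; move=> ->.
rewrite mulr1 -[RHS]addr0; congr (_ + _).
have /matrixP/(_ i 0) := AD_rowsum k; rewrite !mxE; apply: etrans.
by congr (_ + _); apply: eq_bigr => j _; rewrite mxE.
Qed.

End FluidGenerator.

(** * The first-jump equation *)

Lemma FTC_segment {R : realType} (F f : R -> R) (x : R) : 0 <= x ->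
  (forall t : R, is_derive t 1 F (f t)) -> (forall t : R, derivable f t 1) ->
  (\int[lebesgue_measure]_(t in `[0%R, x]) (f t)%:E = (F x - F 0)%R%:E)%E.
Proof.
rewrite le_eqVlt => /predU1P[<-|x0] dF df.
  by rewrite set_itv1 integral_set1 subrr.
have cf : continuous f.
  by move=> t; apply: differentiable_continuous; exact/derivable1_diffP.
have cF : continuous F.
  by move=> t; apply: differentiable_continuous; apply/derivable1_diffP; exact: ex_derive.
rewrite (@continuous_FTC2 _ f F 0 x)// ?EFinB//.
- by apply: continuous_subspaceT => t; exact: cf.
- split; first by move=> t _; exact: ex_derive.
  + by apply: cvg_at_right_filter; exact: cF.
  + by apply: cvg_at_left_filter; exact: cF.
- by move=> t _; rewrite derive1E; exact: derive_val.
Qed.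

Lemma FTC_halfline {R : realType} (F f : R -> R) (l : R) :
  (forall t : R, is_derive t 1 F (f t)) -> (forall t : R, derivable f t 1) ->
  (forall t, 0 <= t -> 0 <= f t) -> F t @[t --> +oo] --> l ->
  (\int[lebesgue_measure]_(t in `[0%R, +oo[) (f t)%:E = (l - F 0)%R%:E)%E.
Proof.
move=> dF df f0 Fl.
have cf : continuous f.
  by move=> t; apply: differentiable_continuous; exact/derivable1_diffP.
have cF : continuous F.
  by move=> t; apply: differentiable_continuous; apply/derivable1_diffP; exact: ex_derive.
rewrite (@ge0_continuous_FTC2y _ f F 0 l)// ?EFinB//.
- by apply: continuous_subspaceT => t; exact: cf.
- by apply: cvg_at_right_filter; exact: cF.
- by move=> t _; rewrite derive1E; exact: derive_val.
Qed.

Lemma expR_cvg0 {R : realType} (a : R) : 0 < a -> expR (- a * t) @[t --> +oo] --> (0 : R).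
Proof.
move=> a0; under eq_fun do rewrite mulNr.
apply: (@cvg_comp _ _ _ (fun x => a * x) (fun z => expR (- z)) _ (pinfty_nbhs R)).
  exact: gt0_cvgMry.
exact: cvgr_expR.
Qed.

Lemma is_derive_expR_scale {R : realType} (a x : R) :
  is_derive x 1 (fun x => expR (a * x)) (a * expR (a * x)).
Proof.
have := @is_derive_comp_scale R expR a 0 (expR (a * x)) x.
rewrite add0r; under eq_fun do rewrite add0r.
by apply; exact: is_derive_expR.
Qed.

Section FluidRenewal.
Context {R : realType} (s : nat -> nat).
Variables (A : forall k, 'M[R]_(s k)) (D : forall k, 'M[R]_(s k, s k.+1)).
Variables (lambda c theta : R).
Hypotheses (lambda_gt0 : 0 < lambda) (c_gt0 : 0 < c) (theta_ge0 : 0 <= theta)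
  (A_offdiag : forall k i j, i != j -> 0 <= A k i j)
  (D_ge0 : forall k i j, 0 <= D k i j)
  (AD_rowsum : forall k,
      A k *m const_mx 1 + D k *m const_mx 1 = 0 :> 'cV[R]_(s k))
  (A_unit : forall k, A k \in unitmx).

Local Notation Q := (fluid_generator lambda A D).
Local Notation psi := (psi A D lambda c theta).
Local Notation umx := (umx A D lambda c theta).

Variables (n : nat) (J : 'I_(\sum_(k < n) s k)).

Local Notation U := (truncation n umx).
Local Notation Ps := (truncation n psi).
Local Notation Ex x := (expmx (x *: U)).

Definition block_index (I : 'I_(\sum_(k < n) s k)) : {k & 'I_(s k)} :=
  Tagged (fun k => 'I_(s k)) (tagnat.sig2 I).

(** The candidate for the expected discounted passage into the phase with flat index
    [J], written as a sum over flat indices so that no cast between block sizes is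
    needed; it vanishes on phases outside the first [n] blocks. *)
Definition passage_value (e : phase s) (x : R) : R :=
  \sum_I (block_index I == e.2)%:R *
    (if e.1 then (Ps *m Ex x) I J else Ex x I J).

Lemma block_index_Rank (k : 'I_n) (i : 'I_(s k)) :
  block_index (tagnat.Rank k i) = Tagged (fun k => 'I_(s k)) i.
Proof.
rewrite /block_index tagnat.Rank2K; move: (tagnat.Rank1K i).
move: (tagnat.sig1 _) => k' kk'; subst k'; congr Tagged.
by apply: val_inj.
Qed.

Lemma block_index_inj : injective block_index.
Proof.
move=> I I'; rewrite -(tagnat.sig2K I) -(tagnat.sig2K I') !block_index_Rank.
move: (tagnat.sig1 I) (tagnat.sig1 I') (tagnat.sig2 I) (tagnat.sig2 I') => k k' i i' e.
have kk' : k = k' by apply: val_inj; exact: (congr1 tag e).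
by subst k'; move/eqP: e; rewrite eq_Tagged/= => /eqP ->.
Qed.

Lemma passage_value_Rank b (k : 'I_n) (i : 'I_(s k)) x :
  passage_value (b, Tagged (fun k => 'I_(s k)) i) x =
  (if b then Ps *m Ex x else Ex x) (tagnat.Rank k i) J.
Proof.
rewrite /passage_value (bigD1 (tagnat.Rank k i))//= block_index_Rank eqxx mul1r.
rewrite [X in _ + X = _]big1 => [|I Ik]; first by rewrite addr0; case: b.
 rewrite -block_index_Rank (inj_eq block_index_inj) (negbTE Ik).
by rewrite mul0r.
Qed.

Lemma passage_value_out e x : (n <= tag e.2)%N -> passage_value e x = 0.
Proof.
move=> ne; rewrite /passage_value big1// => I _; case: eqP => [Ie|]; last by rewrite mul0r.
by move: ne; rewrite -Ie leqNgt ltn_ord.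
Qed.

(** The rows of [U] are those of [A k] plus those of [D k] times [psi]; this is where
    the shape of [U] meets the transitions of the flow. *)
Lemma value_down_derive k (kn : (k < n)%N) (i : 'I_(s k)) x :
  (U *m Ex x) (tagnat.Rank (Ordinal kn) i) J =
  \sum_j A k i j * passage_value (phase_down j) x +
  \sum_j D k i j * passage_value (phase_up j) x.
Proof.
pose v (l : 'I_n) (j : 'I_(s l)) := Ex x (tagnat.Rank l j) J.
have -> : (U *m Ex x) (tagnat.Rank (Ordinal kn) i) J =
    \sum_(l < n) \sum_j umx k l i j * v l j.
  rewrite mxE sum_Rank; apply: eq_bigr => l _; apply: eq_bigr => j _.
  by rewrite truncationE.
have vdown (l : 'I_n) j : passage_value (phase_down j) x = v l j.
  exact: (passage_value_Rank false).
have vup (m : 'I_(s k.+1)) : passage_value (phase_up m) x =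
    \sum_(l < n) \sum_j psi k.+1 l m j * v l j.
  have [k1n|nk1] := ltnP k.+1 n.
    rewrite (passage_value_Rank true (k := Ordinal k1n)) mxE sum_Rank.
    by apply: eq_bigr => l _; apply: eq_bigr => j _; rewrite truncationE.
  rewrite passage_value_out//; symmetry; apply: big1 => l _; apply: big1 => j _.
  by rewrite psi_lower ?mxE ?mul0r// (leq_trans (ltn_ord l)).
have -> : \sum_j A k i j * passage_value (phase_down j) x =
    \sum_j A k i j * v (Ordinal kn) j.
  by apply: eq_bigr => j _; rewrite -(vdown (Ordinal kn)).
have -> : \sum_j D k i j * passage_value (phase_up j) x =
    \sum_m D k i m * \sum_(l < n) \sum_j psi k.+1 l m j * v l j.
  by apply: eq_bigr => j _; rewrite vup.
move: v {vdown vup} => v.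
under eq_bigr do under eq_bigr do rewrite mxE mulrDl.
under eq_bigr do rewrite big_split/=; rewrite big_split/=; congr (_ + _).
  rewrite (bigD1 (Ordinal kn))//= [X in _ + X]big1 ?addr0.
    by apply: eq_bigr => j _; rewrite /diag_block eqxx conform_mx_id.
  move=> l; rewrite -val_eqE/= eq_sym => kl; rewrite big1// => j _.
  by rewrite /diag_block (negbTE kl) mxE mul0r.
under [RHS]eq_bigr do rewrite mulr_sumr; rewrite exchange_big/=.
apply: eq_bigr => l _; under [RHS]eq_bigr do rewrite mulr_sumr; rewrite exchange_big/=.
apply: eq_bigr => j _; rewrite mxE mulr_suml; apply: eq_bigr => m _.
by rewrite mulrA.
Qed.

Lemma psi_up_eq x I :
  (lambda + theta) * (Ps *m Ex x) I J - c * (Ps *m (U *m Ex x)) I J = lambda * Ex x I J.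
Proof.
have := truncation_psi_eq lambda_gt0 c_gt0 theta_ge0 A_offdiag D_ge0 AD_rowsum n.
move/(congr1 (fun M => (M *m Ex x) I J)).
rewrite mul_scalar_mx [RHS]mxE => <-.
by rewrite -mulmxA mulmxBl mul_scalar_mx mulmxBr -scalemxAl -!scalemxAr !mxE.
Qed.

Lemma is_derive_mulexp (M : 'M[R]_(\sum_(k < n) s k)) I (x a t : R) :
  is_derive t 1 (fun t => (M *m Ex (x + a * t)) I J)
    (a * (M *m (U *m Ex (x + a * t))) I J).
Proof.
apply: (@is_derive_comp_scale R (fun y => (M *m Ex y) I J)).
have := is_derive_mulmx (F := fun=> M) (F' := 0) (G := fun y => Ex y)
  (G' := U *m Ex (x + a * t)) (x := x + a * t) _
  (fun i j => is_derive_expmx U i j (x + a * t)) I J.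
rewrite mul0mx add0r; apply => i j; rewrite mxE.
exact: is_derive_cst.
Qed.

Lemma Ex_bounds x I I' : 0 <= x -> 0 <= Ex x I I' <= 1.
Proof.
apply: expmx_subgenerator_bounds.
exact: subgenerator_truncation.
Qed.

Lemma Ps_ge0 I I' : 0 <= Ps I I'.
Proof.
rewrite -(tagnat.sig2K I) -(tagnat.sig2K I') truncationE.
exact: psi_ge0.
Qed.

Definition value_bound := 1 + \sum_I \sum_I' Ps I I'.

Lemma value_bound_ge1 : 1 <= value_bound.
Proof. by rewrite lerDl sumr_ge0// => I _; rewrite sumr_ge0// => I' _; exact: Ps_ge0. Qed.

Lemma PsEx_bounds x I : 0 <= x -> 0 <= (Ps *m Ex x) I J <= value_bound.
Proof.
move=> x0; rewrite mxE; apply/andP; split.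
  by apply: sumr_ge0 => L _; rewrite mulr_ge0 ?Ps_ge0//; case/andP: (Ex_bounds L J x0).
apply: (@le_trans _ _ (\sum_L Ps I L)).
  apply: ler_sum => L _; rewrite -[leRHS]mulr1 ler_wpM2l ?Ps_ge0//.
  by case/andP: (Ex_bounds L J x0).
rewrite /value_bound [X in _ <= 1 + X](bigD1 I)//= addrCA lerDl addr_ge0// sumr_ge0// => I' _.
by rewrite sumr_ge0// => L _; exact: Ps_ge0.
Qed.

Lemma block_cases (e : phase s) :
  (n <= tag e.2)%N \/ exists (k : 'I_n) (i : 'I_(s k)), e.2 = Tagged (fun k => 'I_(s k)) i.
Proof.
case: e => b [k i] /=; have [nk|kn] := leqP n k; [by left|right].
by exists (Ordinal kn), i.
Qed.

Lemma passage_value_bounds e x : 0 <= x ->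
  0 <= passage_value e x <= value_bound * (tag e.2 < n)%:R.
Proof.
move=> x0; case: (block_cases e) => [ne|[k [i ei]]].
  by rewrite passage_value_out// ltnNge ne mulr0 lexx.
case: e ei => b e /= ->; rewrite passage_value_Rank ltn_ord mulr1.
case: b; first exact: PsEx_bounds.
have /andP[-> E1] := Ex_bounds (tagnat.Rank k i) J x0.
exact: le_trans value_bound_ge1.
Qed.

Local Notation q := (exit_rate Q).
Local Notation p := (jump_probability Q).

Definition target : phase s := phase_down (tagnat.sig2 J).

(** The level is monotone during a sojourn, so it stays nonnegative if and only if it
    is nonnegative at both ends; the discount runs in ascending phases. *)
Definition level_weight (e : phase s) (x t : R) : R :=
  (0 <= x + slope c e * t)%R%:R * (if e.1 then expR (- theta * t) else 1).

(** The passage into the target during the present sojourn takes place when the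
    sojourn outlasts the descent from [x] to 0. *)
Definition last_sojourn (e : phase s) (x t : R) : \bar R :=
  ((e == target) && (x < t)%R)%:R%:E.

(** Negative levels carry no weight in the renewal operator; truncating them at 0
    keeps the function nonnegative on the whole line. *)
Definition passage_mean (e : phase s) (x : R) : \bar R :=
  (passage_value e (Num.max x 0))%:E.

Local Notation fluid_renewal := (renewal q p (@successors s) level_weight (slope c)).

Lemma passage_valueE e : exists (M : 'M[R]_(\sum_(k < n) s k)) I, forall x, passage_value e x = (M *m Ex x) I J.
Proof.
case: (block_cases e) => [ne|[k [i ei]]].
  by exists 0, J => x; rewrite passage_value_out// mul0mx mxE.
case: e ei => -[] e /= ->.
  by exists Ps, (tagnat.Rank k i) => x; rewrite passage_value_Rank.
by exists 1%:M, (tagnat.Rank k i) => x; rewrite passage_value_Rank mul1mx.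
Qed.

Lemma continuous_passage_value e : continuous (passage_value e).
Proof.
move=> x; apply: differentiable_continuous; apply/derivable1_diffP.
have [M [I eM]] := passage_valueE e.
have -> : passage_value e = fun t => (M *m Ex (0 + 1 * t)) I J.
  by apply/funext => t; rewrite eM add0r mul1r.
exact: (ex_derive (is_derive := is_derive_mulexp M I 0 1 x)).
Qed.

Lemma measurable_passage_mean e : measurable_fun setT (passage_mean e).
Proof.
apply/measurable_EFinP; apply: (@measurableT_comp _ _ _ _ _ _ (passage_value e)).
  by apply: continuous_measurable_fun; exact: continuous_passage_value.
by apply: measurable_maxr.
Qed.

Lemma passage_mean_ge0 e x : (0 <= passage_mean e x)%E.
Proof.
have mx : 0 <= Num.max x 0 by rewrite le_max lexx orbT.
by rewrite lee_fin; case/andP: (passage_value_bounds e mx).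
Qed.

Lemma level_weight_ge0 e x t : 0 <= level_weight e x t.
Proof. by rewrite mulr_ge0//; case: ifP => // _; exact: expR_ge0. Qed.

Lemma level_weight_le1 e x t : 0 <= t -> level_weight e x t <= 1.
Proof.
move=> t0; rewrite mulr_ile1 ?ler0n ?lern1 ?leq_b1//.
  by case: ifP => // _; exact: expR_ge0.
case: ifP => // _; rewrite -expR0 ler_expR mulNr oppr_le0.
exact: mulr_ge0.
Qed.

Lemma measurable_nonneg_indicator {d} {T : measurableType d} (f : T -> R) :
  measurable_fun setT f -> measurable_fun setT (fun x => (0 <= f x)%R%:R : R).
Proof.
move=> mf; have mb : measurable_fun setT (fun b : bool => b%:R : R) by [].
by apply: (measurableT_comp mb); exact: measurable_fun_ler.
Qed.

Lemma measurable_level_weight e :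
  measurable_fun setT (fun xt : R * R => level_weight e xt.1 xt.2).
Proof.
apply: measurable_funM.
  apply: measurable_nonneg_indicator; apply: measurable_funD; first exact: measurable_fst.
  by apply: measurable_funM => //; exact: measurable_snd.
case: (e.1) => /=; last exact: measurable_cst.
apply: (@measurableT_comp _ _ _ _ _ _ (@expR R)); first exact: measurable_expR.
by apply: measurable_funM => //; exact: measurable_snd.
Qed.

Lemma measurable_last_sojourn e :
  measurable_fun setT (fun xt : R * R => last_sojourn e xt.1 xt.2).
Proof.
apply/measurable_EFinP.
have mb : measurable_fun setT (fun b : bool => b%:R : R) by [].
apply: (measurableT_comp mb); case: (e == target); last exact: measurable_cst.
by apply: measurable_fun_ltr; [exact: measurable_fst|exact: measurable_snd].
Qed.

Lemma last_sojourn_ge0 e x t : (0 <= last_sojourn e x t)%E.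
Proof. by rewrite lee_fin. Qed.

Lemma measurable_pdf a : measurable_fun setT (fun t : R => (exponential_pdf a t)%:E).
Proof. by apply/measurable_EFinP; exact: measurable_exponential_pdf. Qed.

Let q_gt0 e : 0 < q e. Proof. exact: exit_rate_gt0. Qed.
Let p_ge0 e f : 0 <= p e f. Proof. exact: jump_ge0. Qed.

Lemma renewal_passage_mean e x : fluid_renewal passage_mean e x =
  (\int[lebesgue_measure]_t (exponential_pdf (q e) t * level_weight e x t *
    \sum_(f <- successors e) p e f * passage_value f (Num.max (x + slope c e * t) 0))%R%:E)%E.
Proof.
have mW : measurable_fun setT (fun t => (level_weight e x t)%:E).
  apply/measurable_EFinP.
  exact: (measurable_fun2 (measurable_level_weight e) (measurable_cst x) (@measurable_id _ _ _)).
have mg f : measurable_fun setT (fun t => passage_mean f (x + slope c e * t)).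
  apply: (measurableT_comp (measurable_passage_mean f)).
  by apply: measurable_funD => //; apply: measurable_funM.
have pdf0 t : (0 <= (exponential_pdf (q e) t)%:E)%E.
  by rewrite lee_fin exponential_pdf_ge0// ltW.
have W0 t : (0 <= (level_weight e x t)%:E)%E by rewrite lee_fin level_weight_ge0.
pose G f t := ((p e f)%:E * ((exponential_pdf (q e) t)%:E *
  ((level_weight e x t)%:E * passage_mean f (x + slope c e * t)%R)))%E.
have mG f : measurable_fun setT (G f).
  apply: measurable_funeM; apply: emeasurable_funM; first exact: measurable_pdf.
  by apply: emeasurable_funM; [exact: mW|exact: mg].
have G0 f t : setT t -> (0 <= G f t)%E.
  move=> _; apply: mule_ge0; first by rewrite lee_fin.
  by apply: mule_ge0 => //; apply: mule_ge0 => //; exact: passage_mean_ge0.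
transitivity (\sum_(f <- successors e) \int[lebesgue_measure]_t G f t)%E.
  apply: eq_bigr => f _; rewrite -ge0_integralZl//.
  - by apply: emeasurable_funM; [exact: measurable_pdf|apply: emeasurable_funM; [exact: mW|exact: mg]].
  - by move=> t _; rewrite !mule_ge0//; exact: passage_mean_ge0.
  - by rewrite lee_fin.
apply: (etrans (esym (ge0_integral_sum lebesgue_measure measurableT mG G0 (successors e)))).
apply: eq_integral => t _; rewrite mulr_sumr -sumEFin; apply: eq_bigr => f _.
by rewrite /G /passage_mean -!EFinM; congr EFin; ring.
Qed.

Lemma sojourn_mean_last e x : 0 <= x ->
  sojourn_mean q last_sojourn e x = ((e == target)%:R * expR (- q e * x))%:E.
Proof.
move=> x0; rewrite /sojourn_mean /last_sojourn.
have [_|_] := eqVneq e target; last first.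
  by rewrite mul0r; apply: integral0_eq => t _; rewrite mule0.
have := exp_law_ray (q_gt0 e) x; rewrite max_l// mul1r => <-.
rewrite /exp_law /exponential_prob [RHS]integral_mkcond.
apply: eq_integral => t _; rewrite patchE mem_setE in_itv/= andbT.
by case: ltP; rewrite ?mule1 ?mule0.
Qed.

(** Both sides vanish, as jumps never lead to an earlier block. *)
Lemma passage_mean_out e x : (n <= tag e.2)%N ->
  passage_mean e x = (sojourn_mean q last_sojourn e x + fluid_renewal passage_mean e x)%E.
Proof.
move=> ne; rewrite /passage_mean passage_value_out//.
have et : (e == target) = false.
  apply/eqP => et; move: ne; rewrite et /= leqNgt.
  by rewrite (ltn_ord (tagnat.sig1 J)).
have -> : sojourn_mean q last_sojourn e x = 0%E.
  by apply: integral0_eq => t _; rewrite /last_sojourn et mule0.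
rewrite add0e renewal_passage_mean; symmetry; apply: integral0_eq => t _.
rewrite [X in _ * X]big1_seq ?mulr0// => f /andP[_ fe].
rewrite passage_value_out ?mulr0//.
move: ne fe; case: (phase_cases e) => [[k [i ->]]|[k [i ->]]] /= nk.
  by rewrite inE => /eqP ->.
rewrite mem_cat => /orP[] /mapP[j _ ->] //=.
exact: (leq_trans nk).
Qed.

(** Since [exp (x U)] has derivative [U exp (x U)], the integrand over the sojourn, which
    ends before the level 0 is reached, is the derivative of
    [t |-> - exp (- q t) exp ((x - t) U)]. The boundary term at [t = x] is what the
    last sojourn contributes. *)
Lemma passage_mean_down k (kn : (k < n)%N) (i : 'I_(s k)) x : 0 <= x ->
  let e := phase_down i in
  passage_mean e x = (sojourn_mean q last_sojourn e x + fluid_renewal passage_mean e x)%E.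
Proof.
move=> x0 e; rewrite sojourn_mean_last// renewal_passage_mean /passage_mean max_l//.
pose I : 'I_(\sum_(k < n) s k) := tagnat.Rank (Ordinal kn) i.
pose f (t : R) := expR (- q e * t) * (q e * (1%:M *m Ex (x + -1 * t)) I J + (U *m Ex (x + -1 * t)) I J).
pose F (t : R) := - (expR (- q e * t) * (1%:M *m Ex (x + -1 * t)) I J).
have dF (t : R) : is_derive t 1 F (f t).
  have := is_deriveN (is_deriveM (is_derive_expR_scale (- q e) t)
    (is_derive_mulexp 1%:M I x (-1) t)).
  rewrite /GRing.scale/=; congr (is_derive _ _ _ _).
  by rewrite /f !mul1mx; ring.
have df (t : R) : derivable f t 1.
  apply: (@derivableM _ _ (fun t => expR (- q e * t))).
    exact: (ex_derive (is_derive := is_derive_expR_scale (- q e) t)).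
  apply: derivableD.
    apply: derivableM => //.
    exact: (ex_derive (is_derive := is_derive_mulexp 1%:M I x (-1) t)).
  exact: (ex_derive (is_derive := is_derive_mulexp U I x (-1) t)).
have vI y : passage_value e y = (1%:M *m Ex y) I J.
  by rewrite mul1mx /e (passage_value_Rank false (k := Ordinal kn)).
transitivity ((e == target)%:R * expR (- q e * x) + (F x - F 0))%:E; last first.
  rewrite EFinD -FTC_segment//; congr (_ + _)%E.
  rewrite [LHS]integral_mkcond; apply: eq_integral => t _.
  rewrite patchE mem_setE in_itv/=; have [t0|t0] := leP 0 t; last first.
    by rewrite lt0_exponential_pdf// !mul0r.
  have WE : level_weight e x t = (0 <= x - t)%R%:R.
    by rewrite /level_weight /slope/= mulN1r mulr1.
  have slE : slope c e = -1 by [].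
  rewrite exponential_pdfE// WE slE mulN1r subr_ge0.
  have [tx|tx] := leP t x; last by rewrite mulr0 mul0r.
  rewrite max_l ?subr_ge0// mulr1 mulrAC.
  rewrite (jump_mean_down lambda_gt0 A_offdiag D_ge0 AD_rowsum A_unit).
  by rewrite -(value_down_derive kn) -/I /f mulN1r -vI mulrC.
congr EFin; rewrite vI /F !mulr0 expR0 mulN1r subrr expmx0 addr0 !mul1mx.
have -> : (e == target) = (I == J).
  rewrite -(inj_eq block_index_inj) block_index_Rank -pair_eqE/=.
  by [].
by rewrite [1%:M I J]mxE; ring.
Qed.

(** By [psi_up_eq] the integrand over the sojourn is the derivative of
    [t |-> - exp (- (lambda + theta) t) Psi exp ((x + c t) U)], which vanishes at
    infinity. *)
Lemma passage_mean_up k (kn : (k < n)%N) (i : 'I_(s k)) x : 0 <= x ->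
  let e := phase_up i in
  passage_mean e x = (sojourn_mean q last_sojourn e x + fluid_renewal passage_mean e x)%E.
Proof.
move=> x0 e; rewrite sojourn_mean_last// renewal_passage_mean /passage_mean max_l//.
rewrite mul0r add0e.
pose I : 'I_(\sum_(k < n) s k) := tagnat.Rank (Ordinal kn) i.
pose f (t : R) := lambda * (expR (- (lambda + theta) * t) * (1%:M *m Ex (x + c * t)) I J).
pose F (t : R) := - (expR (- (lambda + theta) * t) * (Ps *m Ex (x + c * t)) I J).
have dF (t : R) : is_derive t 1 F (f t).
  have := is_deriveN (is_deriveM (is_derive_expR_scale (- (lambda + theta)) t)
    (is_derive_mulexp Ps I x c t)).
  rewrite /GRing.scale/=; congr (is_derive _ _ _ _).
  by rewrite /f mul1mx [RHS]mulrCA -psi_up_eq; ring.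
have df (t : R) : derivable f t 1.
  apply: derivableM => //.
  apply: (@derivableM _ _ (fun t => expR (- (lambda + theta) * t))).
    exact: (ex_derive (is_derive := is_derive_expR_scale (- (lambda + theta)) t)).
  exact: (ex_derive (is_derive := is_derive_mulexp 1%:M I x c t)).
have xct (t : R) : 0 <= t -> 0 <= x + c * t by move=> t0; rewrite addr_ge0// mulr_ge0// ltW.
have f0 (t : R) : 0 <= t -> 0 <= f t.
  move=> /xct t0; apply: mulr_ge0; first exact: ltW.
  apply: mulr_ge0; first exact: expR_ge0.
  by rewrite mul1mx; case/andP: (Ex_bounds I J t0).
have lt0 : 0 < lambda + theta by rewrite ltr_wpDr.
have F0 : F t @[t --> +oo] --> 0.
  rewrite -oppr0; apply: cvgN.
  apply: (@squeeze_cvgr _ _ _ _ (fun=> 0) (fun t => expR (- (lambda + theta) * t) * value_bound)).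
  - near=> t; have t0 : 0 <= t by near: t; exact: nbhs_pinfty_ge.
    have /andP[P0 PB] := PsEx_bounds I (xct t t0).
    by rewrite mulr_ge0 ?expR_ge0//= ler_wpM2l ?expR_ge0.
  - exact: cvg_cst.
  - rewrite -[X in _ --> X](mul0r value_bound); apply: cvgMr_tmp.
    exact: expR_cvg0.
transitivity ((0 - F 0)%:E).
  rewrite sub0r opprK !mulr0 expR0 mul1r addr0; congr EFin.
  by rewrite /e (passage_value_Rank true (k := Ordinal kn)).
rewrite -(FTC_halfline dF df f0 F0) [LHS]integral_mkcond; apply: eq_integral => t _.
rewrite patchE mem_setE in_itv/= andbT; have [t0|t0] := leP 0 t; last first.
  by rewrite lt0_exponential_pdf// !mul0r.
have WE : level_weight e x t = expR (- theta * t).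
  by rewrite /level_weight /slope/= xct// mul1r.
have slE : slope c e = c by [].
rewrite exponential_pdfE// WE slE exit_rate_up max_l ?xct// sum_successors_up jump_up//.
rewrite mul1r (passage_value_Rank false (k := Ordinal kn)) -/I.
by rewrite /f mul1mx opprD mulrDl expRD; congr EFin; ring.
Unshelve. all: by end_near. Qed.

Lemma passage_mean_renewal e x : 0 <= x ->
  passage_mean e x = (sojourn_mean q last_sojourn e x + fluid_renewal passage_mean e x)%E.
Proof.
move=> x0; have [ne|en] := leqP n (tag e.2); first exact: passage_mean_out.
move: en; case: (phase_cases e) => [[k [i ->]]|[k [i ->]]] kn.
  exact: passage_mean_up.
exact: passage_mean_down.
Qed.

End FluidRenewal.

(** * Transience and the series solution of the first-jump equation *)

Section Harmonic.
Context {R : realType} (s : nat -> nat).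
Variables (A : forall k, 'M[R]_(s k)) (D : forall k, 'M[R]_(s k, s k.+1)).
Variable (lambda : R).
Hypotheses (lambda_gt0 : 0 < lambda)
  (A_offdiag : forall k i j, i != j -> 0 <= A k i j)
  (D_ge0 : forall k i j, 0 <= D k i j)
  (AD_rowsum : forall k,
      A k *m const_mx 1 + D k *m const_mx 1 = 0 :> 'cV[R]_(s k))
  (A_unit : forall k, A k \in unitmx).

Local Notation Q := (fluid_generator lambda A D).
Local Notation q := (exit_rate Q).
Local Notation p := (jump_probability Q).
Let q_gt0 e : 0 < q e. Proof. exact: exit_rate_gt0. Qed.
Let p_ge0 e f : 0 <= p e f. Proof. exact: jump_ge0. Qed.
Let p_sum e : \sum_(f <- successors e) p e f = 1. Proof. exact: jump_sum. Qed.

(** One step of the jump chain, killed or discounted by the factor [r]. *)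
Definition jump_average (r : phase s -> R) (a : phase s -> R) (e : phase s) : R :=
  r e * \sum_(f <- successors e) p e f * a f.

Lemma jump_average_le r a a' : (forall e, 0 <= r e) -> (forall e, a e <= a' e) ->
  forall e, jump_average r a e <= jump_average r a' e.
Proof. by move=> r0 aa' e; rewrite ler_wpM2l// ler_sum// => f _; rewrite ler_wpM2l. Qed.

(** The iterates decrease because the first step does and the operator is monotone;
    the sums being finite, the limit is a fixed point. *)
Lemma iter_jump_average_limit r a : (forall e, 0 <= r e) ->
  (forall e, 0 <= a e) -> (forall e, jump_average r a e <= a e) ->
  exists L, [/\ forall e, 0 <= L e, forall e, L e <= a e,
    forall e, L e = jump_average r L e
    & forall e, iter N (jump_average r) a e @[N --> \oo] --> L e].
Proof.
move=> r0 a0 ra.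
have ge0 N e : 0 <= iter N (jump_average r) a e.
  elim: N e => [|N IH] e //=.
  by rewrite mulr_ge0// sumr_ge0// => f _; rewrite mulr_ge0.
have dec N e : iter N.+1 (jump_average r) a e <= iter N (jump_average r) a e.
  by elim: N e => [|N IH] e; [exact: ra|exact: jump_average_le].
have ni e : nonincreasing_seq (fun N => iter N (jump_average r) a e).
  by apply/nonincreasing_seqP => N; exact: dec.
have cv e : cvgn (fun N => iter N (jump_average r) a e).
  apply: nonincreasing_is_cvgn => //; exists 0 => _ [N _ <-]; exact: ge0.
exists (fun e => limn (fun N => iter N (jump_average r) a e)); split => [e|e|e|e].
- by apply: limr_ge => //; exact: nearW.
- by have := nonincreasing_cvgn_ge (ni e) (cv e) 0%N.
- have h1 : iter N.+1 (jump_average r) a e @[N --> \oo] -->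
      limn (fun N => iter N (jump_average r) a e).
    by rewrite (cvg_shiftS (fun N => iter N (jump_average r) a e)); exact: cv.
  rewrite -(cvg_lim (@Rhausdorff R) h1); apply/cvg_lim => //=.
  apply: cvgMl_tmp; apply: cvg_big => [|f _]; first exact: add_continuous.
  by apply: cvgMl_tmp; exact: cv.
- exact: cv.
Qed.

(** The iterates are the probabilities that the chain has not left the first [n]
    blocks. Their limit is harmonic and, by downward induction, zero on later blocks;
    hence on descending phases of block [k] it is in the kernel of the invertible
    [A k], and an ascending phase inherits the value of its copy. *)
Lemma transient n e :
  iter N (jump_average (fun=> 1)) (fun e => (tag e.2 < n)%:R) e @[N --> \oo] --> (0 : R).
Proof.
have tag_succ e' f : f \in successors e' -> (tag e'.2 <= tag f.2)%N.
  case: (phase_cases e') => [[k [i ->]]|[k [i ->]]] /=.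
    by rewrite inE => /eqP ->.
  by rewrite mem_cat => /orP[] /mapP[j _ ->] /=.
have [//|//|e'|L [L0 L1 LH cvL]] := @iter_jump_average_limit (fun=> 1) (fun e => (tag e.2 < n)%:R).
  rewrite /jump_average mul1r; have [nk|kn] := leqP n (tag e'.2).
    rewrite big1_seq// => f /andP[_ fe]; rewrite ltnNge (leq_trans nk) ?mulr0//.
    exact: tag_succ.
  rewrite -[leRHS](p_sum e'); apply: ler_sum => f _.
  by rewrite ler_piMr// lern1 leq_b1.
(* Induction on the distance of the block to [n]: [Ldown] uses that [L] vanishes
   on the block [k.+1], reached through [D k]. *)
suff L00 m : forall e, (n - tag e.2 < m)%N -> L e = 0.
  by rewrite -(L00 (n - tag e.2).+1 e)//; exact: cvL.
elim: m => // m IH {}e em.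
have [nk|kn] := leqP n (tag e.2).
  apply/eqP; rewrite eq_le L0 andbT; apply: le_trans (L1 e) _.
  by rewrite ltnNge nk.
have Ldown k (i : 'I_(s k)) : (k < n)%N -> (n - k < m.+1)%N -> L (phase_down i) = 0.
  move=> {}kn nk; pose v : 'cV[R]_(s k) := \col_j L (phase_down j).
  suff v0 : A k *m v = 0.
    have := congr1 (mulmx (invmx (A k))) v0; rewrite mulKmx// mulmx0.
    by move=> /matrixP/(_ i 0); rewrite !mxE.
  apply/matrixP => j z; rewrite ord1 !mxE {z}.
  have := jump_mean_down lambda_gt0 A_offdiag D_ge0 AD_rowsum A_unit j L.
  have := LH (phase_down j); rewrite /jump_average mul1r => <-.
  rewrite -[X in X = _ -> _]addr0 => /addrI; rewrite [X in _ + X]big1 ?addr0.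
    by move=> e0; rewrite [RHS]e0; apply: eq_bigr => j' _; rewrite mxE.
  by move=> j' _; rewrite IH ?mulr0//=; lia.
move: kn em; case: (phase_cases e) => [[k [i ->]]|[k [i ->]]] /= kn em.
  by rewrite LH /jump_average mul1r big_seq1 Ldown ?mulr0.
exact: Ldown.
Qed.

(** The iterates are the expectations of [exp (- T_n)] for the [n]-th jump time. Their
    limit [L] satisfies [L = r L'] with [r = lambda / (1 + lambda)] between an ascending
    phase and its copy, and a maximum principle on a block bounds [L] on descending
    phases by the maximum over the ascending phases of the next block. So each
    passage through an ascending phase costs a factor [r], uniformly in the block. *)
Lemma vanishing_discount e :
  iter N (jump_average (fun e => q e / (1 + q e))) (fun=> 1) e @[N --> \oo] --> (0 : R).
Proof.
have q1 e' : 0 < 1 + q e' by rewrite addr_gt0.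
have [e'|//|e'|L [L0 L1 LH cvL]] := @iter_jump_average_limit (fun e => q e / (1 + q e)) (fun=> 1).
- by rewrite divr_ge0// ltW.
- rewrite /jump_average; under eq_bigr do rewrite mulr1.
  by rewrite p_sum mulr1 ler_pdivrMr// mul1r lerDr.
pose r := lambda / (1 + lambda).
have l1 : 0 < 1 + lambda by rewrite addr_gt0.
have r0 : 0 <= r by rewrite divr_ge0// ltW.
have r1 : r < 1 by rewrite ltr_pdivrMr// mul1r ltrDr.
have Lup k (i : 'I_(s k)) : L (phase_up i) = r * L (phase_down i).
  by rewrite LH /jump_average sum_successors_up jump_up// mul1r exit_rate_up.
have Lr j : forall k (i : 'I_(s k)), L (phase_down i) <= r ^+ j.
  elim: j => [|j IH] k i0; first by rewrite expr0.
  (* At a maximum over the block, a value above [r ^+ j.+1] would be positive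
     and, by the bound below, at most a nonpositive number. *)
  case: (@arg_maxP _ _ _ i0 xpredT (fun i => L (phase_down i))) => // i _ imax.
  apply: le_trans (imax i0 isT) _; set beta := L (phase_down i).
  have := jump_mean_down lambda_gt0 A_offdiag D_ge0 AD_rowsum A_unit i L.
  set q' := q _; set Sg := \sum_(f <- _) _.
  have bE : beta = q' / (1 + q') * Sg by rewrite /beta LH.
  have q'1 : 1 + q' != 0 by rewrite lt0r_neq0//; exact: q1.
  have -> : q' * Sg = (1 + q') * beta by rewrite bE mulrA mulrCA divff ?mulr1.
  rewrite mulrDl mul1r addrC -/beta => /addrI bE'.
  rewrite leNgt; apply/negP => rb.
  have b0 : 0 < beta by apply: le_lt_trans rb; rewrite exprn_ge0.
  have AS : \sum_j A k i j * L (phase_down j) <= (\sum_j A k i j) * beta.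
    rewrite mulr_suml; apply: ler_sum => j' _.
    have [->//|ij] := eqVneq j' i.
    by apply: ler_wpM2l; [rewrite A_offdiag// eq_sym|exact: imax].
  have DS : \sum_j D k i j * L (phase_up j) <= (\sum_j D k i j) * r ^+ j.+1.
    rewrite mulr_suml; apply: ler_sum => j' _.
    by rewrite ler_wpM2l// Lup exprS ler_wpM2l.
  have AD : \sum_j A k i j = - \sum_j D k i j.
    have /matrixP/(_ i 0) := AD_rowsum k; rewrite !mxE.
    under eq_bigr do rewrite mxE mulr1; under [X in _ + X]eq_bigr do rewrite mxE mulr1.
    by move/eqP; rewrite addr_eq0 => /eqP.
  have : beta <= (\sum_j D k i j) * (r ^+ j.+1 - beta).
    rewrite [X in X <= _]bE' mulrBr [leRHS]addrC -mulNr -AD; exact: lerD.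
  rewrite leNgt => /negP; apply; apply: le_lt_trans b0.
  by rewrite mulr_ge0_le0 ?sumr_ge0// subr_le0 ltW.
have Ldown k (i : 'I_(s k)) : L (phase_down i) = 0.
  apply/eqP; rewrite eq_le L0 andbT.
  have rj : r ^+ j @[j --> \oo] --> (0 : R) by apply: cvg_expr; rewrite ger0_norm.
  rewrite -(cvg_lim (@Rhausdorff R) rj); apply: limr_ge; first by apply/cvg_ex; exists 0.
  by apply: nearW => j; exact: Lr.
have <- : L e = 0.
  by case: (phase_cases e) => [[k [i ->]]|[k [i ->]]]; rewrite ?Lup Ldown ?mulr0.
exact: cvL.
Qed.

End Harmonic.

Section FluidSeries.
Context {R : realType} (s : nat -> nat).
Variables (A : forall k, 'M[R]_(s k)) (D : forall k, 'M[R]_(s k, s k.+1)).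
Variables (lambda c theta : R).
Hypotheses (lambda_gt0 : 0 < lambda) (c_gt0 : 0 < c) (theta_ge0 : 0 <= theta)
  (A_offdiag : forall k i j, i != j -> 0 <= A k i j)
  (D_ge0 : forall k i j, 0 <= D k i j)
  (AD_rowsum : forall k,
      A k *m const_mx 1 + D k *m const_mx 1 = 0 :> 'cV[R]_(s k))
  (A_unit : forall k, A k \in unitmx).

Local Notation Q := (fluid_generator lambda A D).
Local Notation q := (exit_rate Q).
Local Notation p := (jump_probability Q).
Let q_gt0 e : 0 < q e. Proof. exact: exit_rate_gt0. Qed.
Let p_ge0 e f : 0 <= p e f. Proof. exact: jump_ge0. Qed.
Let p_sum e : \sum_(f <- successors e) p e f = 1. Proof. exact: jump_sum. Qed.

Let pdf0 e t : (0 <= (exponential_pdf (q e) t)%:E)%E.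
Proof. by rewrite lee_fin exponential_pdf_ge0// ltW. Qed.

Local Notation K := (renewal q p (@successors s) (level_weight c theta) (slope c)).

Let mW (e : phase s) : measurable_fun setT
  (fun xt : R * R => level_weight c theta e xt.1 xt.2).
Proof. exact: measurable_level_weight. Qed.

Let mWx (e : phase s) x : measurable_fun setT (fun t : R => (level_weight c theta e x t)%:E).
Proof.
apply/measurable_EFinP.
exact: (measurable_fun2 (mW e) (measurable_cst x) (@measurable_id _ _ _)).
Qed.

Let mshift (g : R -> \bar R) (e : phase s) x : measurable_fun setT g ->
  measurable_fun setT (fun t : R => g (x + slope c e * t)).
Proof.
move=> mg; apply: (measurableT_comp mg).
by apply: measurable_funD => //; apply: measurable_funM.
Qed.

Lemma eq_renewal g g' e x : (forall f y, 0 <= y -> g f y = g' f y) ->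
  K g e x = K g' e x.
Proof.
move=> gg'; apply: eq_bigr => f _; congr (_ * _)%E; apply: eq_integral => t _.
congr (_ * _)%E; rewrite /level_weight.
by have [y0|y0] := leP 0 (x + slope c e * t); [rewrite gg'|rewrite mul0r !mul0e].
Qed.

Lemma renewalD g g' e x :
  (forall e, measurable_fun setT (g e)) -> (forall e y, 0 <= g e y)%E ->
  (forall e, measurable_fun setT (g' e)) -> (forall e y, 0 <= g' e y)%E ->
  K (fun e y => g e y + g' e y)%E e x = (K g e x + K g' e x)%E.
Proof.
move=> mg g0 mg' g'0; rewrite /renewal -big_split/=; apply: eq_bigr => f _.
have m1 (u : phase s -> R -> \bar R) : (forall e, measurable_fun setT (u e)) ->
    measurable_fun setT (fun t => (exponential_pdf (q e) t)%:E *
      ((level_weight c theta e x t)%:E * u f (x + slope c e * t)%R))%E.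
  move=> mu; apply: emeasurable_funM; first exact: measurable_pdf.
  by apply: emeasurable_funM; [exact: mWx|exact: mshift].
have p0 (u : phase s -> R -> \bar R) t : (forall e y, 0 <= u e y)%E ->
    (0 <= (exponential_pdf (q e) t)%:E *
      ((level_weight c theta e x t)%:E * u f (x + slope c e * t)%R))%E.
  move=> u0; apply: mule_ge0; first exact: pdf0.
  by apply: mule_ge0 => //; rewrite lee_fin level_weight_ge0.
rewrite -ge0_muleDr; last 2 first.
- by apply: integral_ge0 => t _; exact: p0.
- by apply: integral_ge0 => t _; exact: p0.
congr (_ * _)%E; rewrite -ge0_integralD//; last 4 first.
- by move=> t _; exact: p0.
- exact: m1.
- by move=> t _; exact: p0.
- exact: m1.
apply: eq_integral => t _; rewrite ge0_muleDr// ge0_muleDr//.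
- by apply: mule_ge0 => //; rewrite lee_fin level_weight_ge0.
- by apply: mule_ge0 => //; rewrite lee_fin level_weight_ge0.
Qed.

Variables (n : nat) (J : 'I_(\sum_(k < n) s k)).
Local Notation h := (passage_mean A D lambda c theta J).
Local Notation C := (sojourn_mean q (last_sojourn (R := R) J)).

Let mC e : measurable_fun setT (C e).
Proof.
apply: measurable_sojourn_mean => //; last by move=> x t; exact: last_sojourn_ge0.
exact: measurable_last_sojourn.
Qed.

Let C0 e x : (0 <= C e x)%E.
Proof. by apply: sojourn_mean_ge0 => // t; exact: last_sojourn_ge0. Qed.

Let mh e : measurable_fun setT (h e).
Proof. exact: measurable_passage_mean. Qed.

Let h0 e x : (0 <= h e x)%E.
Proof. exact: passage_mean_ge0. Qed.

Let iter_measurable N g : (forall e, measurable_fun setT (g e)) ->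
  (forall e x, 0 <= g e x)%E ->
  (forall e, measurable_fun setT (iter N K g e)) /\ (forall e x, 0 <= iter N K g e x)%E.
Proof.
move=> mg g0; elim: N => [//|N [IHm IH0]] /=; split=> [e|e x].
  apply: measurable_renewal => // e' x t; exact: level_weight_ge0.
by apply: renewal_ge0 => // *; exact: level_weight_ge0.
Qed.

Lemma iter_renewal_split N e x : 0 <= x ->
  iter N K h e x = (iter N K C e x + iter N.+1 K h e x)%E.
Proof.
elim: N e x => [|N IH] e x x0; first exact: passage_mean_renewal.
have [mhN hN0] := iter_measurable N.+1 mh h0.
have [mCN CN0] := iter_measurable N mC C0.
rewrite -[LHS]/(K (iter N K h) e x) (eq_renewal (g' := fun e y => iter N K C e y + iter N.+1 K h e y)%E).
  by rewrite renewalD.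
by move=> f y y0; exact: IH.
Qed.

Lemma passage_mean_partial N e x : 0 <= x ->
  h e x = (\sum_(m < N) iter m K C e x + iter N K h e x)%E.
Proof.
move=> x0; elim: N => [|N IH]; first by rewrite big_ord0 add0e.
by rewrite big_ord_recr/= IH iter_renewal_split// addeA.
Qed.

Local Notation B := (value_bound A D lambda c theta n).

(** The weights are at most 1 and the densities have mass 1, so that only the jump
    probabilities remain. *)
Lemma iter_renewal_bound N e x :
  (iter N K h e x <= (B * iter N (jump_average A D lambda (fun=> 1))
    (fun e => (tag e.2 < n)%:R) e)%:E)%E.
Proof.
have B0 : 0 <= B.
  exact: (le_trans ler01
    (value_bound_ge1 lambda_gt0 c_gt0 theta_ge0 A_offdiag D_ge0 AD_rowsum n)).
have a0 M f : 0 <= iter M (jump_average A D lambda (fun=> 1)) (fun e => (tag e.2 < n)%:R) f.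
  elim: M f => [|M IH] f //=; rewrite /jump_average mul1r sumr_ge0// => f' _.
  by rewrite mulr_ge0.
elim: N e x => [|N IH] e x.
  have mx : 0 <= Num.max x 0 by rewrite le_max lexx orbT.
  by rewrite lee_fin; have /andP[] := passage_value_bounds lambda_gt0 c_gt0
    theta_ge0 A_offdiag D_ge0 AD_rowsum J e mx.
have IH' f y := IH f y; move: (a0 N) IH' {IH}; rewrite !iterS.
move: (iter N (jump_average A D lambda (fun=> 1)) _) => aN aN0 IH.
rewrite /renewal /jump_average mul1r mulr_sumr -sumEFin.
apply: lee_sum => f _; rewrite mulrCA EFinM; apply: lee_wpmul2l; first by rewrite lee_fin.
set b := B * _; have b0 : 0 <= b by exact: mulr_ge0.
have [mhN hN0] := iter_measurable N mh h0.
apply: (@le_trans _ _ (\int[lebesgue_measure]_t (b%:E * (exponential_pdf (q e) t)%:E)))%E.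
  apply: ge0_le_integral => //.
  - move=> t _; apply: mule_ge0; first exact: pdf0.
    by apply: mule_ge0 => //; rewrite lee_fin level_weight_ge0.
  - apply: emeasurable_funM; first exact: measurable_pdf.
    by apply: emeasurable_funM; [exact: mWx|exact: mshift].
  - by apply: measurable_funeM; exact: measurable_pdf.
  - move=> t _; have [t0|t0] := leP 0 t; last first.
      by rewrite lt0_exponential_pdf// mul0e mule0.
    rewrite [leRHS]muleC; apply: lee_wpmul2l; first exact: pdf0.
    apply: le_trans (IH f (x + slope c e * t)).
    rewrite -[leRHS]mul1e; apply: lee_wpmul2r; first exact: hN0.
    by rewrite lee_fin level_weight_le1.
rewrite ge0_integralZl//; last exact: measurable_pdf.
by rewrite integral_exponential_pdf// mule1.
Qed.

(** The remainder after [N] terms of the iterated first-jump equation tends to 0 by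
    transience. *)
Lemma passage_mean_series e x : 0 <= x ->
  (\sum_(m <oo) iter m K C e x = h e x)%E.
Proof.
move=> x0; apply/cvg_lim => //.
have mx : 0 <= Num.max x 0 by rewrite le_max lexx orbT.
pose a N := B * iter N (jump_average A D lambda (fun=> 1)) (fun e => (tag e.2 < n)%:R) e.
have aB : (h e x - (a N)%:E)%E @[N --> \oo] --> h e x.
  rewrite /passage_mean; under eq_fun do rewrite -EFinB.
  apply: cvg_EFin; first exact: nearW.
  rewrite -[X in _ --> X]subr0; apply: cvgB; first exact: cvg_cst.
  rewrite -(mulr0 B); apply: cvgMl_tmp; exact: transient.
apply: (squeeze_cvge _ aB (cvg_cst _)); apply: nearW => N.
rewrite big_mkord; have hE := passage_mean_partial N e x0.
have [_ hN0] := iter_measurable N mh h0.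
have [mC0 _] := iter_measurable N mC C0.
apply/andP; split; last by rewrite hE leeDl.
rewrite leeBlDr//; rewrite hE; apply: leeD => //.
exact: iter_renewal_bound.
Qed.

End FluidSeries.

(** * First passage along a single path *)

Lemma integral_cst_itv {R : realType} (f : R -> R) (a b v : R) : a <= b ->
  (forall u, a <= u < b -> f u = v) ->
  lebesgue_measure.-integrable `[a, b[ (EFin \o f) /\
  (\int[lebesgue_measure]_(u in `[a, b[) f u)%R = v * (b - a).
Proof.
move=> ab fv.
have fE u : `[a, b[%classic u -> f u = v by rewrite /= in_itv/=; exact: fv.
have mu_ab : lebesgue_measure (`[a, b[%classic : set R) = (b - a)%:E.
  rewrite lebesgue_measure_itv/= lte_fin; case: ltP => // ba.
  have -> : b = a by apply/eqP; rewrite eq_le ab ba.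
  by rewrite subrr.
split.
  apply: (@eq_integrable _ _ _ lebesgue_measure _ _ (cst v%:E)) => //.
    by move=> u /set_mem uab; rewrite /= fE.
  apply/integrableP; split => //.
  rewrite integral_cst//= mu_ab -EFinM; exact: ltry.
rewrite /Rintegral (eq_integral (cst v%:E)); last by move=> u /set_mem uab; rewrite /= fE.
by rewrite integral_cst//= mu_ab.
Qed.

Lemma integrable_disjointU {R : realType} {d} {T : measurableType d}
    (mu : {measure set T -> \bar R}) (A B : set T) (f : T -> \bar R) :
  measurable A -> measurable B -> [disjoint A & B] ->
  mu.-integrable A f -> mu.-integrable B f -> mu.-integrable (A `|` B) f.
Proof.
move=> mA mB AB /integrableP[mfA iA] /integrableP[mfB iB].
have mf : measurable_fun (A `|` B) f by apply/measurable_funU.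
apply/integrableP; split => //.
rewrite ge0_integral_setU//; first exact: lte_add_pinfty.
exact: measurableT_comp.
Qed.

Section StepPath.
Context {R : realType} (S : nat -> R) (v : nat -> R) (f : R -> R).
Let Tn n := \sum_(m < n) S m.
Hypotheses (S0 : forall n, 0 < S n)
  (fv : forall n u, Tn n <= u < Tn n.+1 -> f u = v n).

Let TnS n : Tn n.+1 = Tn n + S n. Proof. by rewrite /Tn big_ord_recr. Qed.
Let Tn_ge0 n : 0 <= Tn n. Proof. by rewrite sumr_ge0// => m _; exact: ltW. Qed.

(** Induction over the sojourns; integrability is proved along because additivity of
    the integral of a signed function depends on it. *)
Lemma integral_step_path n t : Tn n <= t <= Tn n.+1 ->
  lebesgue_measure.-integrable `[0, t[ (EFin \o f) /\
  (\int[lebesgue_measure]_(u in `[0, t[) f u)%R =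
     \sum_(m < n) v m * S m + v n * (t - Tn n).
Proof.
elim: n t => [|n IH] t /andP[nt tn].
  have T0 : Tn 0 = 0 by rewrite /Tn big_ord0.
  have [|u /andP[u0 ut]|i1 i2] := @integral_cst_itv R f 0 t (v 0%N).
  - by rewrite -T0.
  - by apply: fv; rewrite T0 u0 (lt_le_trans ut).
  - by split=> //; rewrite i2 big_ord0 add0r T0.
have [|i1 e1] := IH (Tn n.+1).
  by rewrite lexx andbT TnS lerDl ltW.
have [//|u /andP[u0 ut]|i2 e2] := @integral_cst_itv R f (Tn n.+1) t (v n.+1).
  by apply: fv; rewrite u0 (lt_le_trans ut).
have U : `[0, t[%classic = `[0, Tn n.+1[ `|` `[Tn n.+1, t[ :> set R.
  apply/seteqP; split => u /=; rewrite !in_itv/=.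
    by move=> /andP[u0 ut]; have [uT|uT] := ltP u (Tn n.+1); [left; rewrite u0|right].
  case=> /andP[u0 ut]; first by rewrite u0 (lt_le_trans ut).
  by rewrite ut (le_trans _ u0).
have disj : [disjoint `[0, Tn n.+1[%classic & `[Tn n.+1, t[%classic : set R].
  rewrite disj_set2E; apply/eqP; rewrite -subset0 => u [/=]; rewrite !in_itv/=.
  by move=> /andP[_ u1] /andP[u2 _]; move: u1; rewrite ltNge u2.
have i : lebesgue_measure.-integrable `[0, t[ (EFin \o f).
  by rewrite U; apply: integrable_disjointU.
split=> //; rewrite U Rintegral_setU// -?U//.
rewrite e1 e2; congr (_ + _); rewrite big_ord_recr/=; congr (_ + v n * _).
by rewrite TnS addrC addKr.
Qed.

Lemma integral_step_path_closed n t : Tn n <= t <= Tn n.+1 ->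
  (\int[lebesgue_measure]_(u in `[0, t]) f u)%R =
     \sum_(m < n) v m * S m + v n * (t - Tn n).
Proof.
move=> nt; have [i <-] := integral_step_path nt.
by rewrite -Rintegral_itv_bndo_bndc.
Qed.

End StepPath.

Lemma find_sojourn {R : realType} (T : nat -> R) t :
  T 0%N <= t -> (exists n, t < T n) -> exists n, T n <= t < T n.+1.
Proof.
move=> T0 ex; have [[|n] tn nmin] := ex_minnP ex; first by move: tn; rewrite ltNge T0.
exists n; rewrite tn andbT leNgt; apply/negP => /nmin; by rewrite ltnn.
Qed.

Lemma nneseries_single {R : realType} (u : nat -> \bar R) n :
  (forall m, m != n -> u m = 0%E) -> (\sum_(m <oo) u m = u n)%E.
Proof.
move=> un; apply/cvg_lim => //; apply: cvg_near_cst; near=> N.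
have nN : (n < N)%N by near: N; exact: nbhs_infty_gt.
rewrite big_mkord (bigD1 (Ordinal nN))//= big1 ?adde0// => m mn.
exact: un.
Unshelve. all: by end_near. Qed.

Section PassagePath.
Context {R : realType} (s : nat -> nat) (c theta : R) {dsp} {T : measurableType dsp}.
Variables (phi : R -> T -> phase s) (w : T) (Y : nat -> phase s) (S : nat -> R).
Hypothesis c_gt0 : 0 < c.
Let Tn n := \sum_(m < n) S m.
Hypotheses (S0 : forall n, 0 < S n)
  (phiY : forall n t, Tn n <= t < Tn n.+1 -> phi t w = Y n)
  (unbounded : forall M, exists n, M < Tn n).
Variables (x : R) (x0 : 0 <= x) (L : nat -> R) (W : nat -> R).
Hypotheses (L0 : L 0%N = x) (LS : forall n, L n.+1 = L n + slope c (Y n) * S n)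
  (W0 : W 0%N = 1) (WS : forall n, W n.+1 = W n * level_weight c theta (Y n) (L n) (S n)).

Let TnS n : Tn n.+1 = Tn n + S n. Proof. by rewrite /Tn big_ord_recr. Qed.
Let T0 : Tn 0 = 0. Proof. by rewrite /Tn big_ord0. Qed.

Let Lsum n : L n = x + \sum_(m < n) slope c (Y m) * S m.
Proof.
by elim: n => [|n IH]; rewrite ?big_ord0 ?addr0// LS IH big_ord_recr/= addrA.
Qed.

Lemma level_sojourn n t : Tn n <= t < Tn n.+1 ->
  level c phi x t w = L n + slope c (Y n) * (t - Tn n).
Proof.
move=> nt; rewrite /level (@integral_step_path_closed _ S (fun n => slope c (Y n)) _ S0 _ n).
- by rewrite addrA -Lsum.
- by move=> m u /phiY ->.
- by case/andP: nt => -> /ltW.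
Qed.

Lemma time_up_sojourn n t : Tn n <= t < Tn n.+1 ->
  time_up phi t w = \sum_(m < n) (Y m).1%:R * S m + (Y n).1%:R * (t - Tn n).
Proof.
move=> nt; rewrite /time_up (@integral_step_path_closed _ S (fun n => (Y n).1%:R) _ S0 _ n)//.
- by move=> m u /phiY ->.
- by case/andP: nt => -> /ltW.
Qed.

Lemma level_ge0 n t : Tn n <= t < Tn n.+1 -> 0 <= L n -> 0 <= L n.+1 ->
  0 <= level c phi x t w.
Proof.
move=> nt Ln0 Ln1; rewrite (level_sojourn nt); move: Ln1; rewrite LS /slope.
have /andP[t0 t1] := nt; move: t1; rewrite TnS => t1.
case: (Y n).1 => Ln1.
  by rewrite addr_ge0// mulr_ge0 ?subr_ge0// ltW.
by lra.
Qed.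

(** As long as the level has not been negative at a jump time, all the indicators in
    the weight equal 1 and the exponents add up to the time spent ascending. *)
Lemma weight_alive n : (forall m, (m <= n)%N -> 0 <= L m) ->
  W n = expR (- theta * \sum_(m < n) (Y m).1%:R * S m).
Proof.
elim: n => [|n IH] Lpos; first by rewrite big_ord0 mulr0 expR0.
rewrite WS IH; last by move=> m mn; apply: Lpos; exact: leqW.
rewrite /level_weight -LS Lpos// mul1r big_ord_recr/= mulrDr expRD; congr (_ * _).
by case: ifP => _; rewrite ?mul1r// mul0r mulr0 expR0.
Qed.

Lemma weight_dead n m : L n.+1 < 0 -> (n < m)%N -> W m = 0.
Proof.
move=> Ln; elim: m => // m IH; rewrite ltnS leq_eqVlt WS => /predU1P[<-|/IH ->].
  by rewrite /level_weight -LS leNgt Ln mul0r mulr0.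
by rewrite mul0r.
Qed.

Lemma sojourn_crosses f n : f.1 = false -> (Y n == f) && (L n < S n) -> L n.+1 < 0.
Proof.
move=> fd /andP[/eqP Yn LSn]; rewrite LS /slope Yn fd mulN1r subr_lt0.
exact: LSn.
Qed.

(** Only the first sojourn that ends at a negative level can contribute: the earlier
    ones do not cross 0, and the weight of the later ones vanishes. In that sojourn [n]
    the level descends from [L n], so the passage takes place at [Tn n + L n]. *)
Lemma discounted_passage_series f : f.1 = false ->
  ((discounted_passage c theta phi x f w)%:E =
   \sum_(n <oo) ((W n)%:E * ((Y n == f) && (L n < S n)%R)%:R%:E))%E.
Proof.
move=> fd.
have locate t : 0 <= t -> exists n, Tn n <= t < Tn n.+1.
  by move=> t0; apply: find_sojourn; [rewrite T0|exact: unbounded].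
have [/= ex|nex] := pselect (exists n, L n.+1 < 0); last first.
  have Lpos n : 0 <= L n.
    case: n => [|n]; first by rewrite L0.
    by rewrite leNgt; apply/negP => Ln; apply: nex; exists n.
  have -> : discounted_passage c theta phi x f w = 0.
    rewrite /discounted_passage (_ : passage_time _ _ _ _ = +oo%E)//.
    rewrite /passage_time (_ : [set t | _] = set0) ?image_set0 ?ereal_inf0//.
    rewrite -subset0 => t [t0]; have [n nt] := locate t (ltW t0).
    by rewrite ltNge (level_ge0 nt).
  rewrite eseries0// => n _ _.
  case: (boolP (_ && _)) => [/(sojourn_crosses fd)|_]; last by rewrite mule0.
  by rewrite ltNge Lpos.
have [n Ln nmin] := ex_minnP ex.
have Lpos m : (m <= n)%N -> 0 <= L m.
  case: m => [|m] mn; first by rewrite L0.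
  by rewrite leNgt; apply/negP => /nmin; rewrite leqNgt mn.
have Yn : (Y n).1 = false.
  apply/negP => Yn; move: Ln; rewrite LS /slope Yn ltNge addr_ge0 ?Lpos//.
  by rewrite mulr_ge0 ?ltW.
have LSn : L n < S n by move: Ln; rewrite LS /slope Yn mulN1r subr_lt0.
pose tau := Tn n + L n.
have ntau : Tn n <= tau < Tn n.+1 by rewrite /tau TnS lerDl Lpos// ltrD2l.
have Tn_ge0 m : 0 <= Tn m by rewrite sumr_ge0// => k _; exact: ltW.
have tau0 : 0 <= tau by rewrite addr_ge0// Lpos.
have passage : passage_time c phi x w = tau%:E.
  apply/eqP; rewrite eq_le; apply/andP; split.
    apply/lee_addgt0Pr => e e0.
    (* A time after [tau], within [e] of it and still in the sojourn. *)
    pose t := Num.min (tau + e) ((tau + Tn n.+1) / 2).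
    have /andP[t1 t2] := ntau.
    have taut : tau < t by rewrite lt_min ltrDl e0/=; lra.
    have tT : t < Tn n.+1 by rewrite gt_min; apply/orP; right; lra.
    apply: (@le_trans _ _ t%:E); last by rewrite lee_fin ge_min lexx.
    apply: ereal_inf_lbound; exists t => //; split; first exact: le_lt_trans taut.
    rewrite (@level_sojourn n); last by rewrite tT (le_trans t1 (ltW taut)).
    by rewrite /slope Yn; move: taut; rewrite /tau; lra.
  apply: le_ereal_inf_tmp => _ [t [t0 lt] <-]; rewrite lee_fin leNgt; apply/negP => ttau.
  have [m mt] := locate t (ltW t0); move: lt; rewrite ltNge => /negP; apply.
  have /andP[m1 m2] := mt; have [mn|nm|mn] := ltngtP m n.
  - by apply: (level_ge0 mt); rewrite Lpos// ltnW.
  - have : Tn n.+1 <= Tn m.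
      rewrite -(subnKC nm) /Tn; elim: (m - n.+1)%N => [|k IHk]; first by rewrite addn0.
      by rewrite addnS [leRHS]big_ord_recr/= (le_trans IHk)// lerDl ltW.
    have /andP[_ tauT] := ntau.
    by move=> nTm; have := lt_trans ttau tauT; rewrite ltNge (le_trans nTm m1).
  - rewrite mn in mt m1 m2 *; rewrite (level_sojourn mt) /slope Yn.
    by move: ttau; rewrite /tau; lra.
rewrite (@nneseries_single _ _ n); last first.
  move=> m mn; have [m_n|n_m] := ltnP m n.
    case: (boolP (_ && _)) => [/(sojourn_crosses fd)|_]; last by rewrite mule0.
    by rewrite ltNge Lpos.
  by rewrite (weight_dead Ln) ?mul0e// ltn_neqAle eq_sym mn.
rewrite /discounted_passage passage ltry/= (phiY ntau) LSn andbT weight_alive//.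
case: eqP => _; last by rewrite mule0.
by rewrite mule1 (time_up_sojourn ntau) Yn mul0r addr0.
Qed.

End PassagePath.

(** * Non-explosion and the expectation of the discounted passage *)

Section NonMeasurable.
Context {R : realType} {d} {T : measurableType d} (mu : {measure set T -> \bar R}).
Import HBNNSimple.

(** The law says nothing of [phi] on null sets, where the passage need not be
    measurable; so [f] is arbitrary, and its integral is the supremum over the simple
    functions below it, each of which can be cut down to the complement of [N]. *)
Lemma ge0_le_integral_off_null (f g : T -> \bar R) (N : set T) :
  (forall w, 0 <= f w)%E -> (forall w, 0 <= g w)%E -> measurable N -> mu N = 0%E ->
  (forall w, ~ N w -> f w = g w) -> (\int[mu]_w f w <= \int[mu]_w g w)%E.
Proof.
move=> f0 g0 mN N0 fg; rewrite !ge0_integralTE//.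
apply: ge_ereal_sup => _ [h hf <-].
have mN' : measurable (~` N) by exact: measurableC.
have -> : sintegral mu h = sintegral mu (proj_nnsfun h mN').
  rewrite -!integralT_nnsfun; apply: ge0_ae_eq_integral => //.
  - exact/measurable_EFinP.
  - exact/measurable_EFinP.
  - by move=> w _; rewrite lee_fin.
  - by move=> w _; rewrite lee_fin.
  exists N; split => // w /= hw; apply: contrapT => Nw; apply: hw => _.
  by rewrite mindicE mem_set// mulr1.
apply: ereal_sup_ubound; exists (proj_nnsfun h mN') => //= w.
rewrite mindicE; have [/set_mem Nw|_] := boolP (w \in ~` N).
  by rewrite mulr1 -fg.
by rewrite mulr0.
Qed.

Lemma ge0_eq_integral_off_null (f g : T -> \bar R) (N : set T) :
  (forall w, 0 <= f w)%E -> (forall w, 0 <= g w)%E -> measurable N -> mu N = 0%E ->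
  (forall w, ~ N w -> f w = g w) -> (\int[mu]_w f w = \int[mu]_w g w)%E.
Proof.
move=> f0 g0 mN N0 fg; apply/eqP; rewrite eq_le.
rewrite (ge0_le_integral_off_null f0 g0 mN N0 fg)/=.
by apply: (ge0_le_integral_off_null g0 f0 mN N0) => w Nw; rewrite fg.
Qed.

End NonMeasurable.

Lemma integral_exponential_discount {R : realType} (a : R) : 0 < a ->
  (\int[lebesgue_measure]_t ((exponential_pdf a t)%:E * (expR (- t))%:E) =
   (a / (1 + a))%:E)%E.
Proof.
move=> a0; have a1 : 0 < 1 + a by rewrite addr_gt0.
pose b := 1 + a.
pose F (t : R) := - (a / b) * expR (- b * t).
have dF (t : R) : is_derive t 1 F (a * expR (- b * t)).
  have := is_deriveM (is_derive_cst (- (a / b) : R) t 1) (is_derive_expR_scale (- b) t).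
  rewrite scaler0 addr0 /GRing.scale/=; congr (is_derive _ _ _ _).
  by rewrite mulrA mulrNN divfK ?lt0r_neq0.
have df (t : R) : derivable (fun t => a * expR (- b * t)) t 1.
  by apply: derivableM.
have Fl : F t @[t --> +oo] --> 0.
  by rewrite -(mulr0 (- (a / b))); apply: cvgMl_tmp; exact: expR_cvg0.
transitivity ((0 - F 0)%:E); last first.
  by rewrite /F mulr0 expR0 mulr1 sub0r opprK.
rewrite -(FTC_halfline dF df _ Fl); last by move=> t _; rewrite mulr_ge0 ?expR_ge0 ?ltW.
rewrite [RHS]integral_mkcond; apply: eq_integral => t _.
rewrite patchE mem_setE in_itv/= andbT; have [t0|t0] := leP 0 t; last first.
  by rewrite lt0_exponential_pdf// mul0e.
rewrite exponential_pdfE// -EFinM -mulrA -expRD; congr (_ * expR _)%:E.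
by rewrite /b; ring.
Qed.

Section FluidProcess.
Context {R : realType} (s : nat -> nat).
Variables (A : forall k, 'M[R]_(s k)) (D : forall k, 'M[R]_(s k, s k.+1)).
Variables (lambda c theta : R).
Hypotheses (lambda_gt0 : 0 < lambda) (c_gt0 : 0 < c) (theta_ge0 : 0 <= theta)
  (A_offdiag : forall k i j, i != j -> 0 <= A k i j)
  (D_ge0 : forall k i j, 0 <= D k i j)
  (AD_rowsum : forall k,
      A k *m const_mx 1 + D k *m const_mx 1 = 0 :> 'cV[R]_(s k))
  (A_unit : forall k, A k \in unitmx).

Local Notation Q := (fluid_generator lambda A D).
Local Notation q := (exit_rate Q).
Local Notation p := (jump_probability Q).
Let q_gt0 e : 0 < q e. Proof. exact: exit_rate_gt0. Qed.
Let p_ge0 e f : 0 <= p e f. Proof. exact: jump_ge0. Qed.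
Let p_sum e : \sum_(f <- successors e) p e f = 1. Proof. exact: jump_sum. Qed.
Let succ_uniq (e : phase s) : uniq (successors e). Proof. exact: successors_uniq. Qed.

Context {d} {T : measurableType d} (P : probability T R) (e0 : phase s).
Variables (Y : nat -> T -> phase s) (S : nat -> T -> R).
Hypotheses (mY : forall n e, measurable [set w | Y n w = e])
  (mS : forall n, measurable_fun setT (S n)).
Hypothesis law : forall (n : nat) (e : nat -> phase s) (t : nat -> R),
  (forall m, 0 <= t m) ->
  P [set w | forall m, (m <= n)%N -> Y m w = e m /\ t m < S m w] =
  ((e 0%N == e0)%:R * (\prod_(m < n) p (e m) (e m.+1)) *
   (\prod_(m < n.+1) expR (- q (e m) * t m)))%:E.

Lemma holding_times_gt0 : {ae P, forall w, forall n, 0 < S n w}.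
Proof.
apply/ae_foralln => n; exists (~` regular (@successors s) Y S n); split.
- by apply: measurableC; exact: measurable_regular.
- have ms : forall e : phase s, measurable_fun setT (fun zt : R * R => zt.1).
    by move=> e; exact: measurable_fst.
  apply: (regular_ae q_gt0 p_ge0 (@successors_uniq s) p_sum mY mS (Z := R) (z0 := 0)
    (step := fun _ z _ => z) ms).
  exact: (markov_property q_gt0 p_ge0 (@successors_uniq s) p_sum mY mS law).
- by move=> w /= nS [[Sn _] _].
Qed.

Let discount (e : phase s) (x t : R) : R := expR (- t).
Let no_slope (e : phase s) : R := 0.

Let path_discount n w :
  path_weight Y S discount no_slope 0 n w = expR (- jump_time S n w).
Proof.
elim: n => [|n IH]; first by rewrite /jump_time big_ord0 oppr0 expR0.
by rewrite path_weightS IH /discount -expRD /jump_time big_ord_recr/= opprD.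
Qed.

(** The weights [expR (- t)] multiply to the exponential of minus the jump time; their
    mean over a sojourn is [q / (1 + q)]. *)
Lemma integral_discount n : (\int[P]_w (expR (- jump_time S n w))%:E =
  (iter n (jump_average A D lambda (fun e => (q e / (1 + q e))%R)) (fun=> 1%R) e0)%:E)%E.
Proof.
have mdisc e : measurable_fun setT (fun xt : R * R => discount e xt.1 xt.2).
  apply: (@measurableT_comp _ _ _ _ _ _ (@expR R)); first exact: measurable_expR.
  by apply: measurable_funN; exact: measurable_snd.
have disc0 e x t : 0 <= discount e x t by exact: expR_ge0.
have := integral_path_weight q_gt0 p_ge0 (@successors_uniq s) p_sum mY mS law
  (W := discount) no_slope 0 disc0 mdisc n (g := fun _ _ => 1%E)
  (fun e => measurable_cst _) (fun _ _ => lee01).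
under eq_integral do rewrite mule1 path_discount.
move=> ->; move: (0 : R) => x.
elim: n e0 x => [//|n IH] e x; rewrite !iterS /renewal.
rewrite {1}/jump_average mulr_sumr -sumEFin; apply: eq_bigr => f _.
rewrite mulrCA EFinM; congr (_ * _)%E.
transitivity (\int[lebesgue_measure]_t
  (((exponential_pdf (q e) t)%:E * (expR (- t))%:E) *
   (iter n (jump_average A D lambda (fun e => (q e / (1 + q e))%R)) (fun=> 1%R) f)%:E))%E.
  by apply: eq_integral => t _; rewrite IH muleA.
rewrite ge0_integralZr//.
- by rewrite integral_exponential_discount.
- apply: emeasurable_funM; first exact: measurable_pdf.
  by apply/measurable_EFinP; apply: (@measurableT_comp _ _ _ _ _ _ (@expR R)).
- by move=> t _; rewrite mule_ge0 ?lee_fin ?expR_ge0// exponential_pdf_ge0// ltW.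
- rewrite lee_fin; elim: n f {IH} => [|n IH] f //=.
  apply: mulr_ge0; first by apply: divr_ge0; apply: ltW => //; exact: addr_gt0.
  by rewrite sumr_ge0// => f' _; rewrite mulr_ge0.
Qed.

Let measurable_jump_time n : measurable_fun setT (jump_time S n).
Proof. by apply: measurable_sum => m. Qed.

(** On the event that all jump times are at most [M] the discount [exp (- T_n)] is at
    least [exp (- M)], while its expectation tends to 0. *)
Lemma no_explosion : {ae P, forall w, forall M : R, exists n, M < jump_time S n w}.
Proof.
pose N (M : nat) := [set w | forall n, jump_time S n w <= M%:R].
have mN M : measurable (N M).
  rewrite (_ : N M = \bigcap_n [set w | jump_time S n w <= M%:R]); last first.
    by apply/seteqP; split => w h n; [move=> _; exact: h|exact: (h n Logic.I)].
  apply: bigcapT_measurable => n.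
  rewrite -[X in measurable X]setTI.
  rewrite (_ : _ `&` _ = [set: T] `&` jump_time S n @^-1` `]-oo, M%:R]); last first.
    by apply/seteqP; split => w [_ /=]; rewrite ?in_itv/=.
  exact: measurable_jump_time.
have PN M : P (N M) = 0%E.
  have key n : ((expR (- M%:R))%:E * P (N M) <= \int[P]_w (expR (- jump_time S n w))%:E)%E.
    have mE : measurable_fun setT (fun w => (expR (- jump_time S n w))%:E).
      apply/measurable_EFinP; apply: (@measurableT_comp _ _ _ _ _ _ (@expR R)) => //.
      by apply: measurable_funN.
    rewrite -integral_cst//; apply: le_trans (_ : \int[P]_(w in N M)
      (expR (- jump_time S n w))%:E <= _)%E.
      apply: ge0_le_integral => //.
      - by move=> w _; rewrite lee_fin expR_ge0.
      - exact: measurable_funTS.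
      - by move=> w Nw; rewrite lee_fin ler_expR lerN2; exact: Nw.
    apply: ge0_subset_integral => //.
  apply: le_anti; apply/andP; split; last exact: measure_ge0.
  rewrite -(fineK (fin_num_measure P _ (mN M))) lee_fin.
  have : expR (- M%:R) * fine (P (N M)) <= 0.
    have l0 := vanishing_discount lambda_gt0 A_offdiag D_ge0 AD_rowsum A_unit e0.
    rewrite -(cvg_lim (@Rhausdorff R) l0); apply: limr_ge.
      by apply/cvg_ex; exists 0.
    apply: nearW => n; rewrite -lee_fin EFinM fineK ?fin_num_measure//.
    by rewrite -integral_discount.
  by rewrite pmulr_rle0// expR_gt0.
have : P.-negligible (\bigcup_M N M).
  by apply: negligible_bigcup => M; apply/negligibleP => //; exact: PN.
apply: negligibleS => w /= nw; apply: contrapT => nN; apply: nw => M.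
apply: contrapT => nM; apply: nN; exists (Num.bound `|M|) => // n.
rewrite leNgt; apply/negP => Mn; apply: nM; exists n.
apply: le_lt_trans Mn; apply: le_trans (ler_norm M) _.
by rewrite ltW// archi_boundP.
Qed.

Variables (phi : R -> T -> phase s).
Hypothesis phiY : {ae P, forall w, forall (n : nat) (t : R),
  jump_time S n w <= t < jump_time S n.+1 w -> phi t w = Y n w}.

(** Almost surely the path has positive holding times and does not explode, so the
    discounted passage is the pathwise series; its terms are nonnegative and can be
    integrated one by one. *)
Lemma expectation_discounted_passage n (J : 'I_(\sum_(k < n) s k)) x : 0 <= x ->
  ('E_P[discounted_passage c theta phi x (target J)] =
   passage_mean A D lambda c theta J e0 x)%E.
Proof.
move=> x0; rewrite unlock.
pose W := path_weight Y S (level_weight (R := R) c theta) (slope c) x.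
pose L := path_level Y S (level_weight (R := R) c theta) (slope c) x.
pose F n w := ((W n w)%:E * last_sojourn J (Y n w) (L n w) (S n w))%E.
have mW := measurable_level_weight (s := s) c theta.
have mF m : measurable_fun setT (F m).
  apply: emeasurable_funM.
    by apply/measurable_EFinP; exact: measurable_path_weight.
  apply: (measurable_countable_cases (g := fun e w => last_sojourn J e (L m w) (S m w))) => // e.
  apply: (measurable_fun2 (measurable_last_sojourn J e)) => //.
  exact: measurable_path_level.
have F0 m w : (0 <= F m w)%E.
  apply: mule_ge0; last exact: last_sojourn_ge0.
  by rewrite lee_fin; apply: path_weight_ge0 => *; exact: level_weight_ge0.
transitivity (\int[P]_w (\sum_(m <oo) F m w))%E.
  have [N [mN N0 NS]] : {ae P, forall w, [/\ forall n, 0 < S n w,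
      forall M : R, exists n, M < jump_time S n w &
      forall (n : nat) (t : R), jump_time S n w <= t < jump_time S n.+1 w ->
        phi t w = Y n w]}.
    by apply: filterS3 holding_times_gt0 no_explosion phiY => w.
  apply: (ge0_eq_integral_off_null _ _ mN N0).
  - by move=> w; rewrite lee_fin /discounted_passage; case: ifP => // _; exact: expR_ge0.
  - by move=> w; apply: nneseries_ge0 => m _ _; exact: F0.
  move=> w Nw; have [S0 ub ph] : [/\ forall n, 0 < S n w,
      forall M : R, exists n, M < jump_time S n w &
      forall (n : nat) (t : R), jump_time S n w <= t < jump_time S n.+1 w ->
        phi t w = Y n w].
    by apply: contrapT => nw; apply: Nw; exact: NS.
  by apply: (@discounted_passage_series _ _ c theta _ _ phi w (fun n => Y n w)
    (fun n => S n w) c_gt0 S0 ph ub x x0 (fun n => L n w) (fun n => W n w)).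
rewrite integral_nneseries//.
rewrite -(passage_mean_series lambda_gt0 c_gt0 theta_ge0 A_offdiag D_ge0 AD_rowsum A_unit J e0 x0).
apply: eq_eseriesr => m _.
apply: (integral_path_sojourn q_gt0 p_ge0 (@successors_uniq s) p_sum mY mS law).
- by move=> *; exact: level_weight_ge0.
- exact: mW.
- by move=> e; exact: measurable_last_sojourn.
- by move=> *; exact: last_sojourn_ge0.
Qed.

End FluidProcess.

(** * Identification of the passage matrices *)

Lemma target_Rank (s : nat -> nat) n (l : 'I_n) (j : 'I_(s l)) :
  target (tagnat.Rank l j) = phase_down j.
Proof. by rewrite /target /phase_down -/(block_index _) block_index_Rank. Qed.

Section Identification.
Context {R : realType} (s : nat -> nat).
Variables (A : forall k, 'M[R]_(s k)) (D : forall k, 'M[R]_(s k, s k.+1)).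
Variables (lambda c theta : R).
Hypotheses (lambda_gt0 : 0 < lambda) (c_gt0 : 0 < c) (theta_ge0 : 0 <= theta)
  (A_offdiag : forall k i j, i != j -> 0 <= A k i j)
  (D_ge0 : forall k i j, 0 <= D k i j)
  (AD_rowsum : forall k,
      A k *m const_mx 1 + D k *m const_mx 1 = 0 :> 'cV[R]_(s k))
  (A_unit : forall k, A k \in unitmx).
Context {dsp : measure_display} {T : measurableType dsp}.
Variables (P : phase s -> probability T R) (phi : R -> T -> phase s).
Hypothesis phi_jump : forall e,
  markov_jump_process (fluid_generator lambda A D) (P e) e phi.

Local Notation psi := (psi A D lambda c theta).
Local Notation umx := (umx A D lambda c theta).

Lemma expectation_passage n (J : 'I_(\sum_(k < n) s k)) e x : 0 <= x ->
  ('E_(P e)[discounted_passage c theta phi x (target J)] =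
   passage_mean A D lambda c theta J e x)%E.
Proof.
move=> x0; have [Y [S [mY mS law phiY]]] := phi_jump e.
exact: (expectation_discounted_passage lambda_gt0 c_gt0 theta_ge0 A_offdiag
  D_ge0 AD_rowsum A_unit mY mS law phiY J x0).
Qed.

(** At level 0 the exponential is the identity. Any truncation that contains both
    blocks can be used. *)
Lemma PsiE k l : Psi c theta phi P k l = psi k l.
Proof.
apply/matrixP => i j; rewrite mxE.
have kn : (k < (maxn k l).+1)%N by rewrite ltnS leq_maxl.
have ln : (l < (maxn k l).+1)%N by rewrite ltnS leq_maxr.
have := expectation_passage (tagnat.Rank (Ordinal ln) j) (phase_up i) (lexx 0).
rewrite target_Rank => ->; rewrite /passage_mean/= maxxx.
by rewrite (passage_value_Rank _ _ _ _ _ _ true (k := Ordinal kn)) expmx0 mulmx1 truncationE.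
Qed.

Lemma truncation_Phi n x : 0 <= x ->
  truncation n (Phi c theta phi P x) = expmx (x *: truncation n umx).
Proof.
move=> x0; apply/matrixP => I J.
rewrite -{1}(tagnat.sig2K I) -{1}(tagnat.sig2K J) truncationE mxE.
have := expectation_passage J (phase_down (tagnat.sig2 I)) x0.
rewrite /target => ->; rewrite /passage_mean/= max_l//.
by rewrite (passage_value_Rank _ _ _ _ _ _ false (k := tagnat.sig1 I)) tagnat.sig2K.
Qed.

Lemma passage_generator_umx : passage_generator c theta phi P umx.
Proof.
split=> [k l lk|n|x x0 n]; last exact: truncation_Phi.
  by rewrite /umx /diag_block gtn_eqF// psi_lower ?mulmx0 ?addr0// ltnW.
exact: subgenerator_truncation.
Qed.

Lemma passage_generator_unique V : passage_generator c theta phi P V ->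
  forall k l, V k l = umx k l.
Proof.
move=> [_ _ PhiV] k l; apply/matrixP => i j.
have kn : (k < (maxn k l).+1)%N by rewrite ltnS leq_maxl.
have ln : (l < (maxn k l).+1)%N by rewrite ltnS leq_maxr.
have E := truncationE (n := (maxn k l).+1) _ (k := Ordinal kn) (l := Ordinal ln) i j.
rewrite -[LHS]E -[RHS]E; congr (fun_of_matrix _ _ _).
by apply: expmx_inj => x x0; rewrite -PhiV// truncation_Phi.
Qed.

End Identification.

Unset Implicit Arguments.

Theorem proposition3p2 (R : realType) (s : nat -> nat)
    (A : forall k, 'M[R]_(s k)) (D : forall k, 'M[R]_(s k, s k.+1))
    (lambda c theta : R)
    (dsp : measure_display) (T : measurableType dsp)
    (P : phase s -> probability T R) (phi : R -> T -> phase s)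
    (s_gt0 : forall k, (0 < s k)%N)
    (A_offdiag : forall k i j, i != j -> 0 <= A k i j)
    (D_ge0 : forall k i j, 0 <= D k i j)
    (AD_rowsum : forall k,
      A k *m const_mx 1 + D k *m const_mx 1 = 0 :> 'cV[R]_(s k))
    (A_unit : forall k, A k \in unitmx)
    (lambda_gt0 : 0 < lambda) (c_gt0 : 0 < c) (theta_ge0 : 0 <= theta)
    (phi_jump : forall e,
      markov_jump_process (fluid_generator lambda A D) (P e) e phi) :
  [/\ forall k, 1%:M - (c / (lambda + theta)) *: A k \in unitmx,
      forall k,
        Psi c theta phi P k k =
        (lambda / (lambda + theta)) *:
          invmx (1%:M - (c / (lambda + theta)) *: A k),
      forall k l, (k < l)%N ->
        Psi c theta phi P k l =
        ((c / (lambda + theta)) *: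
           \sum_(k <= v < l)
             Psi c theta phi P k v *m D v *m Psi c theta phi P v.+1 l)
        *m invmx (1%:M - (c / (lambda + theta)) *: A l),
      exists U, passage_generator c theta phi P U
    & forall U, passage_generator c theta phi P U ->
      forall k l, (k <= l)%N ->
        U k l = diag_block A k l
          + (1 - (k == l)%:R) *: (D k *m Psi c theta phi P k.+1 l)].
Proof.
have PsiE := PsiE lambda_gt0 c_gt0 theta_ge0 A_offdiag D_ge0 AD_rowsum A_unit phi_jump.
split=> [k|k|k l kl||U genU k l kl].
- apply: resolvent_unit; first exact: subgenerator_block.
  by rewrite divr_ge0 ?addr_ge0// ltW.
- by rewrite PsiE psi_diag.
- rewrite PsiE psi_off ?ltn_eqF//; congr (_ *: _ *m _).
  by apply: eq_bigr => v _; rewrite !PsiE.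
- by exists (umx A D lambda c theta); exact: passage_generator_umx.
- rewrite (passage_generator_unique lambda_gt0 c_gt0 theta_ge0 A_offdiag D_ge0
    AD_rowsum A_unit phi_jump genU) PsiE /umx; congr (_ + _).
  have [<-|_] := eqVneq k l; last by rewrite subr0 scale1r.
  by rewrite psi_lower// mulmx0 scaler0.
Qed.
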